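(* Let $\widehat h_{\lambda,N}$ be the unique minimizer over $h\in\mathcal{H}_K$ of $$\frac1N\sum_{n=1}^N\big\|X_h(\mathbf{Z}^{(n)})-\mathbf{X}^{(n)}_{\sigma^2}\big\|_g^2+\lambda\|h\|_{\mathcal{H}_K}^2 .$$ Suppose that $H\in\Omega_S^\gamma:=\{h\in\mathcal{H}_K\mid h=Q^\gamma\psi,\ \psi\in\mathcal{H}_K,\ \|\psi\|_{\mathcal{H}_K}<S\}$ for some $\gamma\in(0,1)$ and $S>0$. Then, for any $\varepsilon,\delta>0$, there exist $\lambda>0$ and $n\in\mathbb{N}_+$ such that for all $N>n$, $$\mathbb{P}\Big(\big\|\widehat h_{\lambda,N}-H\big\|_{\mathcal{H}_K}>\varepsilon\Big)<\delta .$$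
   Context: $(P,\{\cdot,\cdot\})$ is a $d$-dimensional Poisson manifold with Riemannian metric $g$. With $B$ the Poisson tensor, $B(z)(\mathbf{d}F(z),\mathbf{d}G(z))=\{F,G\}(z)$, and $B(z)(\alpha,\beta)=\alpha\cdot B^\sharp(z)(\beta)$, the Hamiltonian vector field of $h$ is $X_h=B^\sharp(\mathbf{d}h)=J\nabla h$, where $J=B^\sharp\circ g^\flat:TP\to TP$ is the compatible structure. Standing assumption on $J$: $g(z)(J(z)v,J(z)v)\le\gamma_J(z)g(z)(v,v)$ for all $z\in P$, $v\in T_zP$, with $\gamma_J$ a positive function bounded above by a constant $C^2$, $C>0$. $K\in C_b^3(P\times P)$ is a Mercer kernel (symmetric positive semidefinite) with RKHS $\mathcal{H}_K$; $K_x:=K(x,\cdot)$. $C_b^s$ spaces: for a second-countable manifold $M$ with complete Riemannian metric $g=g_0$ and fixed complete Riemannian metrics $g_k$ (norm $\|\cdot\|_k$) on the iterated tangent bundles $T^kM=T(T^{k-1}M)$, and with $D^kf:T^kM\to\mathbb{R}$ the differential of $D^{k-1}f:T^{k-1}M\to\mathbb{R}$, $C_b^s(M)$ is the set of $f\in C^s(M)$ with $\|f\|_{C_b^s}:=\|f\|_\infty+\sum_{k=1}^s\|D^kf\|_\infty<\infty$, where $\|D^kf\|_\infty=\sup_{y\in T^{k-1}M}\sup_{0\ne v\in T_y(T^{k-1}M)}|D^kf(y)\cdot v|/\|v\|_{k-1}$; $C_b^s(P\times P)$ is this space for the product manifold. Data: $\mathbf{X}^{(n)}_{\sigma^2}=X_H(\mathbf{Z}^{(n)})+\boldsymbol\varepsilon^{(n)}$,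 $n=1,\dots,N$, where $H$ is the unknown Hamiltonian, $\mathbf{Z}^{(n)}$ are IID $P$-valued random variables with distribution $\mu_{\mathbf{Z}}$, and $\boldsymbol\varepsilon^{(n)}$ are independent random variables on the tangent spaces $T_{\mathbf{z}^{(n)}}P$ ($\mathbf{z}^{(n)}$ the realization of $\mathbf{Z}^{(n)}$) with mean zero and variance $\sigma^2I_d$. $Q:\mathcal{H}_K\to\mathcal{H}_K$ is the positive trace class operator $(Qh)(y)=\int_Pg(z)(X_{K_y}(z),X_h(z))\,\mathrm{d}\mu_{\mathbf{Z}}(z)$, i.e. $Q=A^*A$ with $Ah=X_h$ viewed as an operator from $\mathcal{H}_K$ to the $L^2(\mu_{\mathbf{Z}})$ vector fields with inner product $\int_P g(z)(Y(z),Y'(z))\,\mathrm{d}\mu_{\mathbf{Z}}(z)$; $Q^\gamma$ is defined by spectral calculus. *)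

(* Defs.v *)
From HB Require Import structures.
From mathcomp Require Import all_boot all_order all_algebra.
From mathcomp Require Import all_classical all_reals all_analysis.
From mathcomp Require Import measurable_realfun.

Set Implicit Arguments.
Unset Strict Implicit.
Unset Printing Implicit Defensive.

Import Order.TTheory GRing.Theory Num.Theory.
Import numFieldNormedType.Exports.

Local Open Scope classical_set_scope.
Local Open Scope ring_scope.

(* All model spaces below are finite dimensional (row vectors and iterated
   products of such), so that C^k means: all iterated directional derivatives
   up to order k exist and are continuous. *)
Fixpoint Ck (R : realType) (E F : normedModType R) (k : nat) (U : set E)
    (f : E -> F) : Prop :=
  (forall x, U x -> {for x, continuous f}) /\
  if k is k'.+1 then
    forall v : E, (forall x, U x -> derivable f x v) /\
                  Ck k' U (fun x => 'D_v f x)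
  else True.

Definition Csmooth (R : realType) (E F : normedModType R) (U : set E)
  (f : E -> F) := forall k, Ck k U f.

(* An atlas on a set of points, with a preferred chart [cat x] around each
   point x. The inverse [cinv c] of [cfun c] is only meaningful on the image of
   [cdom c]. Tangent vectors at x are represented by their coordinates in the
   preferred chart at x, hence T_x M is the model space E for every x. The
   topology of the manifold is the one induced by the charts. *)
Record atlas (R : realType) (E : normedModType R) := Atlas {
  pt :> pointedType ;
  chart : Type ;
  cdom : chart -> set pt ;
  cfun : chart -> pt -> E ;
  cinv : chart -> E -> pt ;
  cat : pt -> chart }.

Section manifolds.
Context (R : realType).

Section one_manifold.
Context (E : normedModType R) (M : atlas E).

Definition cimg (c : chart M) : set E := cfun c @` cdom c.

Definition mopen : set (set M) :=
  [set O | forall c : chart M, open (cfun c @` (O `&` cdom c))].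

Record is_manifold : Prop := IsManifold {
  mf_cover : forall x : M, cdom (cat x) x ;
  mf_cinv : forall (c : chart M) (x : M), cdom c x -> cinv c (cfun c x) = x ;
  mf_overlap : forall c c' : chart M, open (cfun c @` (cdom c' `&` cdom c)) ;
  mf_transition : forall c c' : chart M,
    Csmooth (cfun c @` (cdom c' `&` cdom c)) (cfun c' \o cinv c) ;
  mf_hausdorff : forall x y : M, x <> y ->
    exists U V, [/\ mopen U, mopen V, U x, V y & U `&` V = set0] ;
  mf_second_countable : exists B : nat -> set M, (forall n, mopen (B n)) /\
    forall O x, mopen O -> O x -> exists n, B n x /\ B n `<=` O }.

(* Coordinates in the chart c of the tangent vector v at x. *)
Definition vec_to (c : chart M) (x : M) (v : E) : E :=
  'D_v (cfun c \o cinv (cat x)) (cfun (cat x) x).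

(* Tangent vector at the point with coordinates y in the chart c, whose
   coordinates in c are w. *)
Definition vec_of (c : chart M) (y w : E) : E :=
  'D_w (cfun (cat (cinv c y)) \o cinv c) y.

Definition tangent : atlas (E * E)%type :=
  @Atlas R (E * E)%type (M * E)%type (chart M)
    (fun c => [set p | cdom c p.1])
    (fun c p => (cfun c p.1, vec_to c p.1 p.2))
    (fun c q => (cinv c q.1, vec_of c q.1 q.2))
    (fun p => cat p.1).

Definition Ckfun (k : nat) (f : M -> R) : Prop :=
  forall c : chart M, Ck k (cimg c) (f \o cinv c).

Definition smoothfun (f : M -> R) : Prop := forall k, Ckfun k f.

(* The differential of f, as a function on the tangent bundle. *)
Definition dfun (f : M -> R) : tangent -> R :=
  fun p => 'D_(p.2) (f \o cinv (cat p.1)) (cfun (cat p.1) p.1).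

Definition metric := M -> E -> E -> R.

Record is_riemannian (g : metric) : Prop := IsRiemannian {
  rm_sym : forall x u v, g x u v = g x v u ;
  rm_lin : forall x (a : R) u u' v, g x (a *: u + u') v = a * g x u v + g x u' v ;
  rm_pos : forall x v, v != 0 -> 0 < g x v v ;
  rm_smooth : forall (c : chart M) (u v : E),
    Csmooth (cimg c) (fun y => g (cinv c y) (vec_of c y u) (vec_of c y v)) }.

Definition C1curve (ga : R -> M) : Prop :=
  forall c : chart M,
    open (ga @^-1` cdom c) /\ Ck 1 (ga @^-1` cdom c) (cfun c \o ga).

Definition velocity (ga : R -> M) (t : R) : E :=
  'D_1 (cfun (cat (ga t)) \o ga) t.

Definition curve_length (g : metric) (ga : R -> M) : \bar R :=
  (\int[lebesgue_measure]_(t in `[0%R, 1%R])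
     (Num.sqrt (g (ga t) (velocity ga t) (velocity ga t)))%:E)%E.

(* +oo when x and y lie in different connected components *)
Definition rdist (g : metric) (x y : M) : \bar R :=
  ereal_inf [set curve_length g ga |
             ga in [set ga | [/\ C1curve ga, ga 0 = x & ga 1 = y]]].

Definition complete_riemannian (g : metric) : Prop :=
  is_riemannian g /\
  forall u : nat -> M,
    (forall e : R, 0 < e -> exists n0, forall m n,
        (n0 <= m)%N -> (n0 <= n)%N -> (rdist g (u m) (u n) < e%:E)%E) ->
    exists x, forall e : R, 0 < e -> exists n0, forall n,
        (n0 <= n)%N -> (rdist g (u n) x < e%:E)%E.

End one_manifold.

Definition mprod (E F : normedModType R) (M : atlas E) (N : atlas F) :
    atlas (E * F)%type :=
  @Atlas R (E * F)%type (M * N)%type (chart M * chart N)%type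
    (fun c => [set p | cdom c.1 p.1 /\ cdom c.2 p.2])
    (fun c p => (cfun c.1 p.1, cfun c.2 p.2))
    (fun c q => (cinv c.1 q.1, cinv c.2 q.2))
    (fun p => (cat p.1, cat p.2)).

Definition prod_metric (E F : normedModType R) (M : atlas E) (N : atlas F)
    (g : metric M) (g' : metric N) : metric (mprod M N) :=
  fun p u v => g p.1 u.1 v.1 + g' p.2 u.2 v.2.

Section iterated.
Context (E : normedModType R) (M : atlas E).

Fixpoint tmodel (k : nat) : normedModType R :=
  if k is k'.+1 then (tmodel k' * tmodel k')%type else E.

Fixpoint tbundle (k : nat) : atlas (tmodel k) :=
  match k return atlas (tmodel k) with
  | 0 => M
  | k'.+1 => tangent (tbundle k')
  end.

Fixpoint Dk (k : nat) (f : M -> R) : tbundle k -> R :=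
  match k return tbundle k -> R with
  | 0 => f
  | k'.+1 => dfun (@Dk k' f)
  end.
Arguments Dk : clear implicits.

(* v = 0 contributes 0 / 0 = 0, which does not change the supremum. *)
Definition Dk_sup (k : nat) (g : metric (tbundle k)) (f : M -> R) : \bar R :=
  ereal_sup [set r | exists (y : tbundle k) (v : tmodel k),
    r = (`|Dk k.+1 f (y, v)| / Num.sqrt (g y v v))%:E].

Definition Cb_norm (s : nat) (g : forall k, metric (tbundle k)) (f : M -> R) :
    \bar R :=
  (ereal_sup [set `|f x|%:E | x in [set: M]]
   + \sum_(k < s) Dk_sup (g k) f)%E.

Definition Cb (s : nat) (g : forall k, metric (tbundle k)) (f : M -> R) : Prop :=
  Ckfun s f /\ (Cb_norm s g f < +oo)%E.

End iterated.
End manifolds.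

Notation mborel M := (g_sigma_algebraType (@mopen _ _ M)).
Notation vborel E := (g_sigma_algebraType (@open E)).

Section poisson.
Context (R : realType) (d : nat) (P : atlas 'rV[R]_d).
Implicit Types (F G H h : P -> R).

Record is_poisson_bracket (br : (P -> R) -> (P -> R) -> (P -> R)) : Prop :=
  IsPoissonBracket {
  pb_smooth : forall F G, smoothfun F -> smoothfun G -> smoothfun (br F G) ;
  pb_lin : forall (a : R) F G H, smoothfun F -> smoothfun G -> smoothfun H ->
    br (fun z => a * F z + G z) H = (fun z => a * br F H z + br G H z) ;
  pb_anti : forall F G, smoothfun F -> smoothfun G ->
    br F G = (fun z => - br G F z) ;
  pb_leibniz : forall F G H, smoothfun F -> smoothfun G -> smoothfun H ->
    br (fun z => F z * G z) H = (fun z => F z * br G H z + G z * br F H z) ;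
  pb_jacobi : forall F G H, smoothfun F -> smoothfun G -> smoothfun H ->
    (fun z => br F (br G H) z + br G (br H F) z + br H (br F G) z)
      = (fun=> 0) }.

(* Covectors at z are row vectors too, alpha . v being alpha *m v^T. *)
Definition dcov h (z : P) : 'rV[R]_d := \row_i dfun h (z, delta_mx 0 i).

(* B z is the matrix of the Poisson tensor in the preferred chart at z. The
   first field says that the tensor field is smooth: its components in the
   coordinates x |-> cfun c x 0 i of any chart c are smooth. *)
Record is_poisson_tensor (br : (P -> R) -> (P -> R) -> (P -> R))
    (B : P -> 'M[R]_d) : Prop := IsPoissonTensor {
  pt_smooth : forall (c : chart P) (i j : 'I_d),
    Csmooth (cimg c) (fun y : 'rV[R]_d =>
      (dcov (fun x => cfun c x 0 i) (cinv c y) *m B (cinv c y)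
       *m (dcov (fun x => cfun c x 0 j) (cinv c y))^T) 0 0) ;
  pt_bracket : forall F G z, smoothfun F -> smoothfun G ->
    (dcov F z *m B z *m (dcov G z)^T) 0 0 = br F G z }.

(* alpha . Bsharp B z beta = B(z)(alpha, beta) *)
Definition Bsharp (B : P -> 'M[R]_d) (z : P) (beta : 'rV[R]_d) : 'rV[R]_d :=
  beta *m (B z)^T.

Definition Xham (B : P -> 'M[R]_d) h (z : P) : 'rV[R]_d := Bsharp B z (dcov h z).

Definition flat (g : metric P) (z : P) (v : 'rV[R]_d) : 'rV[R]_d :=
  \row_i g z v (delta_mx 0 i).

Definition compatJ (g : metric P) (B : P -> 'M[R]_d) (z : P) (v : 'rV[R]_d) :=
  Bsharp B z (flat g z v).

End poisson.

Definition mercer (R : realType) (T : Type) (K : T -> T -> R) : Prop :=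
  (forall x y, K x y = K y x) /\
  forall n (x : 'I_n -> T) (c : 'I_n -> R),
    0 <= \sum_(i < n) \sum_(j < n) c i * c j * K (x i) (x j).

(* The reproducing kernel Hilbert space of K; it is unique for a given K. *)
Record rkhs (R : realType) (T : Type) (K : T -> T -> R) := Rkhs {
  hset : set (T -> R) ;
  hip : (T -> R) -> (T -> R) -> R ;
  hset0 : hset (fun=> 0) ;
  hsetD : forall (a : R) f h, hset f -> hset h -> hset (fun x => a * f x + h x) ;
  hip_sym : forall f h, hset f -> hset h -> hip f h = hip h f ;
  hip_lin : forall (a : R) f f' h, hset f -> hset f' -> hset h ->
    hip (fun x => a * f x + f' x) h = a * hip f h + hip f' h ;
  hip_pos : forall f, hset f -> f <> (fun=> 0) -> 0 < hip f f ;
  hset_kernel : forall x, hset (K x) ;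
  hip_reproducing : forall f x, hset f -> hip f (K x) = f x ;
  hset_complete : forall u : nat -> (T -> R), (forall n, hset (u n)) ->
    (forall e : R, 0 < e -> exists n0, forall m n, (n0 <= m)%N -> (n0 <= n)%N ->
        Num.sqrt (hip (u m \- u n) (u m \- u n)) < e) ->
    exists2 f, hset f & forall e : R, 0 < e -> exists n0, forall n,
        (n0 <= n)%N -> Num.sqrt (hip (u n \- f) (u n \- f)) < e }.

Section operators.
Context (R : realType) (T : Type) (K : T -> T -> R) (HK : rkhs K).

Definition hnorm (f : T -> R) : R := Num.sqrt (hip HK f f).

Definition op_poly (p : {poly R}) (Q : (T -> R) -> (T -> R)) (f : T -> R) :
    T -> R :=
  fun x => \sum_(i < size p) p`_i * iter i Q f x.

(* Continuous functional calculus, for a bounded positive self-adjoint operator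
   Q: its spectrum lies in [0, M] for any bound M of its norm, and Q^ga is the
   limit in operator norm of p_n(Q) for any polynomials p_n converging to
   x |-> x^ga uniformly on [0, M]. *)
Definition is_op_powR (Q : (T -> R) -> (T -> R)) (ga : R)
    (Qga : (T -> R) -> (T -> R)) : Prop :=
  exists M : R, exists p : nat -> {poly R},
  [/\ 0 <= M /\ (forall f, hset HK f -> hset HK (Q f) /\ hnorm (Q f) <= M * hnorm f),
      forall e : R, 0 < e -> exists n0, forall n, (n0 <= n)%N ->
        forall x : R, 0 <= x <= M -> `|(p n).[x] - x `^ ga| <= e,
      forall f, hset HK f -> hset HK (Qga f) &
      forall e : R, 0 < e -> exists n0, forall n, (n0 <= n)%N ->
        forall f, hset HK f -> hnorm (op_poly (p n) Q f \- Qga f) <= e * hnorm f].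

Definition source_set (Q : (T -> R) -> (T -> R)) (ga S : R) : set (T -> R) :=
  [set h | hset HK h /\ exists Qga psi,
     [/\ is_op_powR Q ga Qga, hset HK psi, hnorm psi < S & h = Qga psi]].

End operators.

Section learning.
Context (R : realType) (d : nat) (P : atlas 'rV[R]_d).
Context (g : metric P) (B : P -> 'M[R]_d).
Context (K : P -> P -> R) (HK : rkhs K).

(* A h = X_h is square integrable for every h in the RKHS. *)
Definition A_welldefined (mu : probability (mborel P) R) : Prop :=
  forall h, hset HK h ->
    (\int[mu]_z (g z (Xham B h z) (Xham B h z))%:E < +oo)%E.

Definition Qop (mu : probability (mborel P) R) (h : P -> R) : P -> R :=
  fun y => \int[mu]_z g z (Xham B (K y) z) (Xham B h z).

Definition gnormsq (z : P) (v : 'rV[R]_d) : R := g z v v.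

(* Regularized empirical risk for the design points z and the observations x,
   x n being a tangent vector at z n. *)
Definition emp_risk (N : nat) (z : nat -> P) (x : nat -> 'rV[R]_d) (lambda : R)
    (h : P -> R) : R :=
  N%:R^-1 * (\sum_(n < N) gnormsq (z n) (Xham B h (z n) - x n))
  + lambda * hnorm HK h ^+ 2.

Definition is_minimizer (J : (P -> R) -> R) (h : P -> R) : Prop :=
  hset HK h /\ forall f, hset HK f -> J h <= J f.

End learning.

Section data.
Context (R : realType) (d : nat) (P : atlas 'rV[R]_d) (g : metric P).
Context (dO : measure_display) (Omega : measurableType dO)
        (Pr : probability Omega R).

Definition iid_with (mu : probability (mborel P) R) (Z : nat -> Omega -> P) :
    Prop :=
  [/\ forall n, @measurable_fun _ _ Omega (mborel P) setT (Z n),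
      forall n (A : set (mborel P)), measurable A -> Pr (Z n @^-1` A) = mu A &
      forall N (A : nat -> set (mborel P)), (forall n, measurable (A n)) ->
        Pr [set w | forall n, (n < N)%N -> A n (Z n w)]
        = (\prod_(n < N) Pr (Z n @^-1` A n))%E].

(* nu n z is the law of the n-th noise vector on T_z P, given that the n-th
   design point is z. Variance sigma^2 I_d is with respect to the inner product
   g(z): in a g(z)-orthonormal basis the covariance matrix is sigma^2 I_d. *)
Record noise_kernel (sigma : R) (nu : nat -> P -> probability (vborel 'rV[R]_d) R)
    : Prop := NoiseKernel {
  nk_measurable : forall n (A : set (mborel (tangent P))), measurable A ->
    @measurable_fun _ _ (mborel P) (\bar R) setT
      (fun z => nu n z [set e | A (z, e)]) ;
  nk_mean : forall n z u,
    (nu n z).-integrable setT (fun e => (g z u e)%:E) /\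
    (\int[nu n z]_e (g z u e)%:E = 0)%E ;
  nk_variance : forall n z u v,
    (nu n z).-integrable setT (fun e => (g z u e * g z v e)%:E) /\
    (\int[nu n z]_e (g z u e * g z v e)%:E = (sigma ^+ 2 * g z u v)%:E)%E }.

(* Given the realization of the design points, the noise vectors are
   independent and the n-th one has law nu n (Z n). *)
Definition noise_with (nu : nat -> P -> probability (vborel 'rV[R]_d) R)
    (Z : nat -> Omega -> P) (eps : nat -> Omega -> 'rV[R]_d) : Prop :=
  (forall n, @measurable_fun _ _ Omega (mborel (tangent P)) setT
     (fun w => (Z n w, eps n w))) /\
  forall N (A : nat -> set (mborel (tangent P))), (forall n, measurable (A n)) ->
    Pr [set w | forall n, (n < N)%N -> A n (Z n w, eps n w)]
    = (\int[Pr]_w \prod_(n < N) nu n (Z n w) [set e | A n (Z n w, e)])%E.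

End data.

(* Main.v *)
(* Write |.|_N for the empirical L^2 seminorm of vector fields and u for the error
   hhat - H. The Euler-Lagrange equation of the minimizer, tested with u, reads
     |X_u|_N^2 + lambda |u|^2 = <noise, X_u>_N - lambda <H, u>.
   The source condition is used only through its consequence that H is in the closure
   of the range of Q: H = Q eta up to a small error, and <Q eta, u> is the population
   inner product of X_eta and X_u, which the law of large numbers compares with the
   empirical one and Young's inequality then absorbs into |X_u|_N^2.

   Only finitely many directions can be controlled by a law of large numbers with
   second moments, so u is split by the projection on the first k vectors of an
   orthonormal system obtained from kernel sections at a dense sequence of points.
   A point z is good when f |-> X_f(z) has norm at most k and is almost determined by
   the projection of f. Since f |-> X_f(z) has finite rank d, every z is good for large
   k, so the measure of the bad points tends to 0; their contribution is bounded by
   the noise and by X_eta restricted to them. Taking expectations, every remaining term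
   is small compared with lambda, in the order of choices eta, lambda, tau, k, N, and
   Markov's inequality concludes. *)
Require Import Defs.
From HB Require Import structures.
From mathcomp Require Import all_boot all_order all_algebra.
From mathcomp Require Import all_classical all_reals all_analysis.
From mathcomp Require Import measurable_realfun giry.
From mathcomp Require Import ring lra.
Import Order.TTheory GRing.Theory Num.Theory.
Import numFieldNormedType.Exports.
Local Open Scope classical_set_scope.
Local Open Scope ring_scope.
Set Implicit Arguments.
Unset Strict Implicit.
Unset Printing Implicit Defensive.

(** * Inner products and projections *)

(** Since [lambda] is fixed before [N], bias and variance are not balanced against each other. Once
    [eta] is chosen, [lambda] is a multiple of 1/(|X_eta|^2 + 1), the norm being that of L^2(mu),
    and every term divided by [lambda] is paid for by the parameters chosen later.

    The law of large numbers takes the form of a second moment bound for averages of pairwise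
    uncorrelated variables. For the products g(X_{e_j}, X_eta) such a bound is not at hand, as both
    fields are only known to be square integrable; the cap k on the norm of f |-> X_f(z) at good
    points makes these products bounded there. The noise at bad points is not projected at all: it
    is paired with X_u directly and costs only sigma^2 d times the measure of the bad points.

    That f |-> X_f(z) is a bounded map of finite rank on the whole kernel space comes from the
    kernel: in a chart, the difference quotients of x |-> K_x are Cauchy in the kernel space because
    K has a continuous mixed second derivative, and their limits represent the partial derivatives
    at z. *)

Record semi_inner (R : realType) (V : lmodType R) (ip : V -> V -> R) : Prop :=
  SemiInner {
  si_sym : forall x y, ip x y = ip y x ;
  si_lin : forall (a : R) x x' y, ip (a *: x + x') y = a * ip x y + ip x' y ;
  si_ge0 : forall x, 0 <= ip x x }.

Section semi_inner_theory.
Context (R : realType) (V : lmodType R) (ip : V -> V -> R).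
Hypothesis ipP : semi_inner ip.

Lemma ipDl x x' y : ip (x + x') y = ip x y + ip x' y.
Proof. by rewrite -[x in LHS]scale1r (si_lin ipP) mul1r. Qed.

Lemma ip0l y : ip 0 y = 0.
Proof. by apply: (addrI (ip 0 y)); rewrite -ipDl !addr0. Qed.

Lemma ipZl a x y : ip (a *: x) y = a * ip x y.
Proof. by rewrite -[a *: x]addr0 (si_lin ipP) ip0l addr0. Qed.

Lemma ipNl x y : ip (- x) y = - ip x y.
Proof. by rewrite -scaleN1r ipZl mulN1r. Qed.

Lemma ipBl x x' y : ip (x - x') y = ip x y - ip x' y.
Proof. by rewrite ipDl ipNl. Qed.

Lemma ipDr x y y' : ip x (y + y') = ip x y + ip x y'.
Proof. by rewrite !(si_sym ipP x) ipDl. Qed.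

Lemma ip0r y : ip y 0 = 0.
Proof. by rewrite (si_sym ipP) ip0l. Qed.

Lemma ipZr a x y : ip x (a *: y) = a * ip x y.
Proof. by rewrite !(si_sym ipP x) ipZl. Qed.

Lemma ipNr x y : ip x (- y) = - ip x y.
Proof. by rewrite !(si_sym ipP x) ipNl. Qed.

Lemma ipBr x y y' : ip x (y - y') = ip x y - ip x y'.
Proof. by rewrite !(si_sym ipP x) ipBl. Qed.

Lemma ip_suml I (r : seq I) (P : pred I) (F : I -> V) y :
  ip (\sum_(i <- r | P i) F i) y = \sum_(i <- r | P i) ip (F i) y.
Proof. by elim/big_rec2: _ => [|i a b _ <-]; rewrite ?ip0l // ipDl. Qed.

Lemma ip_sumr I (r : seq I) (P : pred I) (F : I -> V) y :
  ip y (\sum_(i <- r | P i) F i) = \sum_(i <- r | P i) ip y (F i).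
Proof.
by rewrite (si_sym ipP) ip_suml; apply: eq_bigr => i _; rewrite (si_sym ipP).
Qed.

Lemma ip_sqrD x y : ip (x + y) (x + y) = ip x x + 2 * ip x y + ip y y.
Proof. rewrite !(ipDl, ipDr) (si_sym ipP y x); ring. Qed.

Lemma ip_sqrB x y : ip (x - y) (x - y) = ip x x - 2 * ip x y + ip y y.
Proof. rewrite !(ipBl, ipBr) (si_sym ipP y x); ring. Qed.

Lemma ip_sqrD_le x y : ip (x + y) (x + y) <= 2 * ip x x + 2 * ip y y.
Proof.
have := si_ge0 ipP (x - y); rewrite ip_sqrB ip_sqrD => h; lra.
Qed.

(** Both signs come from the square of [s x] plus or minus [y / 2], divided by [s]. The weight stays
    free because each use absorbs a different fraction. *)
Lemma ip_young s x y : 0 < s -> `|ip x y| <= s * ip x x + (4 * s)^-1 * ip y y.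
Proof.
move=> s0; have h c := si_ge0 ipP (s *: x + (c / 2) *: y).
have e c : ip (s *: x + (c / 2) *: y) (s *: x + (c / 2) *: y) =
   s * (s * ip x x + c * ip x y + c ^+ 2 * ((4 * s)^-1 * ip y y)).
  rewrite ip_sqrD !(ipZl, ipZr); field; lra.
rewrite ler_norml; apply/andP; split.
- have := h 1; rewrite e pmulr_rge0 // => {}h; lra.
- have := h (- 1); rewrite e pmulr_rge0 // => {}h; lra.
Qed.

Lemma ip_CS x y : ip x y ^+ 2 <= ip x x * ip y y.
Proof.
have x0 := si_ge0 ipP x; have y0 := si_ge0 ipP y.
have [yy0|yyn0] := eqVneq (ip y y) 0.
  have [->|xyn0] := eqVneq (ip x y) 0; first by rewrite expr0n mulr_ge0.
  (* When [ip y y = 0] the square is affine in the coefficient of [y]; this coefficient gives it the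
     value -1. *)
  have := si_ge0 ipP (x - ((ip x x + 1) / (2 * ip x y)) *: y).
  rewrite ip_sqrB !(ipZl, ipZr) yy0 mulr0 mulr0 addr0.
  have -> : 2 * ((ip x x + 1) / (2 * ip x y) * ip x y) = ip x x + 1 by field.
  lra.
have {}y0 : 0 < ip y y by rewrite lt_neqAle eq_sym yyn0.
have := si_ge0 ipP (x - (ip x y / ip y y) *: y).
rewrite ip_sqrB !(ipZl, ipZr).
have -> : ip x x - 2 * (ip x y / ip y y * ip x y) + ip x y / ip y y * (ip x y / ip y y * ip y y)
  = (ip x x * ip y y - ip x y ^+ 2) / ip y y by field.
by rewrite pmulr_lge0 ?invr_gt0 // subr_ge0.
Qed.

End semi_inner_theory.

Section rkhs_space.
Context (R : realType) (T : Type) (K : T -> T -> R) (HK : rkhs K).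

Definition hpred : {pred T -> R} := fun f => f \in hset HK.

Lemma hpred_submod : submod_closed hpred.
Proof.
split=> [|a f h fH hH]; rewrite inE; first exact: hset0.
by apply: hsetD; rewrite -in_setE.
Qed.
HB.instance Definition _ := GRing.isSubmodClosed.Build R (T -> R) hpred hpred_submod.

(** The record [rkhs] offers a set of functions and a form that is meaningful only on it. As a
    subtype closed under linear combinations it becomes a module to which the algebra of
    [semi_inner] applies. *)
Record hsp := Hsp { hfun :> T -> R ; hfunP : hpred hfun }.
HB.instance Definition _ := [isSub for hfun].
HB.instance Definition _ := [Choice of hsp by <:].
HB.instance Definition _ := [SubChoice_isSubLmodule of hsp by <:].

Lemma hsp_in (f : hsp) : hset HK f.
Proof. by case: f => f /= fP; rewrite -in_setE. Qed.

Definition to_hsp f (fP : hset HK f) : hsp := @Hsp f (mem_set fP).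

Lemma hspP (f h : hsp) : (hfun f = hfun h) -> f = h.
Proof. by move=> e; apply: val_inj. Qed.

Definition hdot (f h : hsp) : R := hip HK f h.
Definition hsq (f : hsp) : R := hdot f f.

Lemma hdot_semi : semi_inner hdot.
Proof.
split=> [f h|a f f' h|f].
- by apply: hip_sym; exact: hsp_in.
- by apply: hip_lin; exact: hsp_in.
(* [hip_pos] is silent about the zero function; there linearity with coefficient -1 gives
   [hip f f = - hip f f + hip f f]. *)
- have [f0|f0] := pselect (hfun f = (fun=> 0)); last first.
    by apply/ltW/hip_pos => //; exact: hsp_in.
  rewrite /hdot.
  have e : hfun f = (fun x => 0 * f x + f x) by apply/funext => x; rewrite mul0r add0r.
  have := @hip_lin _ _ _ HK (-1) _ _ _ (hsp_in f) (hsp_in f) (hsp_in f).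
  have -> : (fun x => -1 * f x + f x) = hfun f.
    by rewrite f0; apply/funext => x; rewrite mulr0 addr0.
  by move=> ->; lra.
Qed.

Lemma hsq_ge0 f : 0 <= hsq f. Proof. exact: (si_ge0 hdot_semi). Qed.

Definition hker x : hsp := to_hsp (hset_kernel HK x).

Lemma hdot_ker f x : hdot f (hker x) = f x.
Proof. exact/hip_reproducing/hsp_in. Qed.

Lemma hdot_kerker x y : hdot (hker x) (hker y) = K x y.
Proof. by rewrite hdot_ker. Qed.

Lemma hnormE (f : hsp) : hnorm HK f = Num.sqrt (hsq f).
Proof. by []. Qed.

Lemma hnorm_sq (f : hsp) : hnorm HK f ^+ 2 = hsq f.
Proof. by rewrite hnormE sqr_sqrtr // hsq_ge0. Qed.

Lemma hsp_complete (u : nat -> hsp) :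
  (forall e : R, 0 < e -> exists n0, forall m n, (n0 <= m)%N -> (n0 <= n)%N ->
     hsq (u m - u n) < e) ->
  exists f, forall e : R, 0 < e -> exists n0, forall n, (n0 <= n)%N -> hsq (u n - f) < e.
Proof.
move=> cu.
have [|e e0|f fH cf] := @hset_complete _ _ _ HK (fun n => hfun (u n)).
- by move=> n; exact: hsp_in.
- have [n0 n0P] := cu (e ^+ 2) (exprn_gt0 _ e0).
  exists n0 => m n mn nn; have := n0P m n mn nn.
  by rewrite -(ltr_sqrt) ?exprn_gt0 // sqrtr_sqr (gtr0_norm e0).
- exists (to_hsp fH) => e e0.
  have [|n0 n0P] := cf (Num.sqrt e); first by rewrite sqrtr_gt0.
  by exists n0 => n /n0P; rewrite ltr_sqrt.
Qed.

End rkhs_space.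

(** * Gram-Schmidt projections *)

Section gram_schmidt.
Context (R : realType) (V : lmodType R) (ip : V -> V -> R).
Hypothesis ipP : semi_inner ip.
Variable s : nat -> V.

(* The normalization of a vector of norm 0 is 0, since 0^-1 = 0. *)
Definition normalize (v : V) : V := locked ((Num.sqrt (ip v v))^-1 *: v).

Lemma normalizeE v : normalize v = (Num.sqrt (ip v v))^-1 *: v.
Proof. by rewrite /normalize -lock. Qed.

(** Vectors and projections of the Gram-Schmidt process depend on each other. Inlining the new
    vector leaves one structural recursion, from which [gsvec] is read off. *)
Fixpoint gsproj n (f : V) : V :=
  if n is m.+1 then
    let e := normalize (s m - gsproj m (s m)) in gsproj m f + ip f e *: e
  else 0.

Definition gsvec n := normalize (s n - gsproj n (s n)).

Lemma gsprojE n f : gsproj n f = \sum_(j < n) ip f (gsvec j) *: gsvec j.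
Proof. by elim: n => [|n IH]; rewrite ?big_ord0// big_ord_recr -IH. Qed.

Lemma gsprojS n f : gsproj n.+1 f = gsproj n f + ip f (gsvec n) *: gsvec n.
Proof. by []. Qed.

Lemma gsproj_lin n a f h : gsproj n (a *: f + h) = a *: gsproj n f + gsproj n h.
Proof.
rewrite !gsprojE scaler_sumr -big_split /=; apply: eq_bigr => j _.
by rewrite (ipDl ipP) (ipZl ipP) scalerDl scalerA.
Qed.

Lemma gsprojZ n a f : gsproj n (a *: f) = a *: gsproj n f.
Proof.
have p0 : gsproj n 0 = 0.
  by rewrite gsprojE big1// => j _; rewrite (ip0l ipP) scale0r.
by rewrite -[a *: f]addr0 gsproj_lin p0 addr0.
Qed.

Lemma gsprojB n f h : gsproj n (f - h) = gsproj n f - gsproj n h.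
Proof. by rewrite -scaleN1r addrC gsproj_lin scaleN1r addrC. Qed.

Lemma gsproj_sym n f h : ip (gsproj n f) h = ip f (gsproj n h).
Proof.
rewrite !gsprojE (ip_suml ipP) (ip_sumr ipP); apply: eq_bigr => j _.
by rewrite (ipZl ipP) (ipZr ipP) (si_sym ipP (gsvec j) h) mulrC.
Qed.

(** Replaces [|v| = 1]: a normalized vector is a unit vector or zero, and both satisfy this
    identity. Linearly dependent sequences therefore need no thinning out. *)
Lemma normalize_idem v : ip (normalize v) (normalize v) *: normalize v = normalize v.
Proof.
rewrite !normalizeE; have [v0|vn0] := eqVneq (ip v v) 0.
  by rewrite v0 sqrtr0 invr0 scale0r scaler0.
rewrite (ipZl ipP) (ipZr ipP) -[X in _ * (_ * X)](@sqr_sqrtr _ (ip v v)) ?(si_ge0 ipP)//.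
rewrite -[RHS]scale1r; congr (_ *: _).
have : Num.sqrt (ip v v) != 0.
  by rewrite sqrtr_eq0 -ltNge lt_neqAle eq_sym vn0 (si_ge0 ipP).
by move=> h; field.
Qed.

(** The second identity at stage [n] shows that all earlier projections kill the new vector, which
    is the orthogonality needed for both identities at stage [n.+1]; hence the joint induction. *)
Lemma gsproj_comp n m f : (m <= n)%N ->
  gsproj n (gsproj m f) = gsproj m f /\ gsproj m (gsproj n f) = gsproj m f.
Proof.
have lin n' a f' h' := @gsproj_lin n' a f' h'.
elim: n m f => [|n IH] m f; first by case: m.
have pe k : (k <= n)%N -> gsproj k (gsvec n) = 0.
  by move=> kn; rewrite /gsvec normalizeE gsprojZ gsprojB (IH _ _ kn).2 subrr scaler0.
have pD k c h : (k <= n)%N -> gsproj k (h + c *: gsvec n) = gsproj k h.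
  by move=> kn; rewrite addrC lin pe// scaler0 add0r.
rewrite leq_eqVlt => /orP[/eqP ->|mn].
  suff -> : gsproj n.+1 (gsproj n.+1 f) = gsproj n.+1 f by [].
  rewrite (gsprojS n f) gsprojS pD// (IH _ _ (leqnn n)).1.
  rewrite (ipDl ipP) (ipZl ipP) gsproj_sym pe// (ip0r ipP) add0r -scalerA.
  by rewrite normalize_idem.
rewrite !gsprojS (IH _ _ mn).1 gsproj_sym pe// (ip0r ipP) scale0r addr0; split=> //.
by rewrite pD// (IH _ _ mn).2.
Qed.

Lemma gsproj_vec n j : (j < n)%N -> gsproj n (gsvec j) = gsvec j.
Proof.
move=> jn.
have e : gsproj j.+1 (gsvec j) = gsvec j.
  rewrite gsprojS normalize_idem.
  rewrite {1}/gsvec normalizeE gsprojZ gsprojB (gsproj_comp _ (leqnn j)).2 subrr.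
  by rewrite scaler0 add0r -normalizeE.
by rewrite -e (gsproj_comp _ jn).1.
Qed.

Lemma gsproj_sq n f : ip (gsproj n f) (gsproj n f) = \sum_(j < n) ip f (gsvec j) ^+ 2.
Proof.
rewrite gsproj_sym (gsproj_comp _ (leqnn n)).1 gsprojE (ip_sumr ipP).
by apply: eq_bigr => j _; rewrite (ipZr ipP) expr2.
Qed.

Lemma gsproj_pyth n m f : (m <= n)%N ->
  ip (gsproj n f - gsproj m f) (gsproj n f - gsproj m f)
  = ip (gsproj n f) (gsproj n f) - ip (gsproj m f) (gsproj m f).
Proof.
move=> mn; rewrite (ip_sqrB ipP) !gsproj_sym (gsproj_comp _ mn).1.
rewrite !(gsproj_comp _ (leqnn _)).1; lra.
Qed.

Lemma gsproj_pythC n f :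
  ip (f - gsproj n f) (f - gsproj n f) = ip f f - ip (gsproj n f) (gsproj n f).
Proof. rewrite (ip_sqrB ipP) !gsproj_sym (gsproj_comp _ (leqnn _)).1; lra. Qed.

Lemma gsproj_le n f : ip (gsproj n f) (gsproj n f) <= ip f f.
Proof. by rewrite -subr_ge0 -gsproj_pythC (si_ge0 ipP). Qed.

Lemma gsprojC_le n f : ip (f - gsproj n f) (f - gsproj n f) <= ip f f.
Proof. by rewrite gsproj_pythC gerBl (si_ge0 ipP). Qed.

Lemma gsprojC_sym n f h : ip (f - gsproj n f) h = ip f (h - gsproj n h).
Proof. by rewrite (ipBl ipP) (ipBr ipP) gsproj_sym. Qed.

(** The residual of [s n] is either proportional to its normalization, to which [f] is orthogonal,
    or of norm 0, and then Cauchy-Schwarz makes it orthogonal to everything. *)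
Lemma gs_orth f : (forall j, ip f (gsvec j) = 0) -> forall n, ip f (s n) = 0.
Proof.
move=> f0 n; rewrite -[s n](subrK (gsproj n (s n))) (ipDr ipP).
rewrite gsprojE (ip_sumr ipP) -gsprojE big1 ?addr0; last first.
  by move=> j _; rewrite (ipZr ipP) f0 mulr0.
have := f0 n; rewrite /gsvec normalizeE; set v := (X in _ *: X).
rewrite (ipZr ipP) => /eqP; rewrite mulf_eq0 => /orP[|/eqP//].
rewrite invr_eq0 sqrtr_eq0 => v0; have {}v0 : ip v v = 0.
  by apply/eqP; rewrite eq_le v0 (si_ge0 ipP).
have := ip_CS ipP f v; rewrite v0 mulr0 => h; apply/eqP.
by rewrite -sqrf_eq0 eq_le h sqr_ge0.
Qed.

(** The squared norms of the projections increase and are bounded by that of [f], so by Pythagoras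
    the projections are Cauchy. Their limit has the same coefficients as [f], and totality of [s]
    identifies the two. *)
Lemma gsproj_cvg f :
  (forall h, (forall n, ip h (s n) = 0) -> h = 0) ->
  (forall u : nat -> V,
    (forall e : R, 0 < e -> exists n0, forall m n, (n0 <= m)%N -> (n0 <= n)%N ->
       ip (u m - u n) (u m - u n) < e) ->
    exists f, forall e : R, 0 < e -> exists n0, forall n, (n0 <= n)%N ->
       ip (u n - f) (u n - f) < e) ->
  forall e : R, 0 < e -> exists n0, forall n, (n0 <= n)%N ->
    ip (f - gsproj n f) (f - gsproj n f) < e.
Proof.
move=> tot compl.
pose c n := ip (gsproj n f) (gsproj n f).
have cnd m n : (m <= n)%N -> c m <= c n.
  by move=> mn; rewrite -subr_ge0 /c -gsproj_pyth// (si_ge0 ipP).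
(* Otherwise [c] would gain [e] again and again, exceeding every multiple of [e] and finally
   [ip f f]. *)
have ccauchy e : 0 < e -> exists n0, forall n, (n0 <= n)%N -> c n - c n0 < e.
  move=> e0; apply: contrapT => H.
  have {}H n0 : exists n, (n0 <= n)%N /\ c n0 + e <= c n.
    apply: contrapT => H'; apply: H; exists n0 => n n0n; rewrite ltNge; apply/negP => h.
    by apply: H'; exists n; split => //; lra.
  have H2 k : exists n, k%:R * e <= c n.
    elim: k => [|k [n kn]]; first by exists 0%N; rewrite mul0r (si_ge0 ipP).
    by have [m [_ nm]] := H n; exists m; rewrite -natr1; lra.
  have [k kP] := H2 (Num.truncn (ip f f / e)).+1.
  have := le_trans kP (gsproj_le k f); rewrite leNgt => /negP; apply.
  by rewrite -ltr_pdivrMr// truncnS_gt.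
have [e e0|f' f'P] := compl (fun n => gsproj n f).
  have [n0 n0P] := ccauchy e e0; exists n0 => m n n0m n0n.
  wlog mn : m n n0m n0n / (m <= n)%N.
    move=> wl; have [/wl|/ltnW/wl] := leqP m n; first exact.
    by move=> h; rewrite -opprB (ipNl ipP) (ipNr ipP) opprK h.
  rewrite -opprB (ipNl ipP) (ipNr ipP) opprK gsproj_pyth//.
  have := n0P _ n0n; have := cnd _ _ n0m; rewrite /c; lra.
suff ff' : f = f'.
  move=> e e0; have [n0 n0P] := f'P e e0; exists n0 => n n0n.
  by rewrite -opprB (ipNl ipP) (ipNr ipP) opprK {2 4}ff' n0P.
apply/eqP; rewrite -subr_eq0; apply/eqP/tot/gs_orth => j.
apply/eqP; rewrite -sqrf_eq0 eq_le sqr_ge0 andbT; apply/ler_addgt0Pr => e e0; rewrite add0r.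
have e1 : 0 < e / (ip (gsvec j) (gsvec j) + 1).
  by rewrite divr_gt0// ltr_wpDl// (si_ge0 ipP).
have [n0 /(_ (maxn n0 j.+1) (leq_maxl _ _))] := f'P _ e1.
set n := maxn _ _ => h.
have -> : ip (f - f') (gsvec j) = ip (gsproj n f - f') (gsvec j).
  by rewrite !(ipBl ipP) gsproj_sym gsproj_vec// leq_maxr.
apply: le_trans (ip_CS ipP _ _) _.
have g0 := si_ge0 ipP (gsvec j).
apply: le_trans (_ : _ <= e / (ip (gsvec j) (gsvec j) + 1) * ip (gsvec j) (gsvec j)) _.
  by rewrite ler_wpM2r// ltW.
by rewrite mulrAC ler_pdivrMr ?ler_pM2l; lra.
Qed.

End gram_schmidt.

(** * Calculus in charts *)

Section calculus.
Context (R : realType).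

(** [differentiable] speaks of the map selected by choice as the differential; exhibiting one
    continuous linear map with remainder [o(h)] shows that the selected one works. *)
Lemma differentiable_intro (V W : normedModType R) (f : V -> W)
    (df : {linear V -> W}) x : continuous df ->
  (forall e, 0 < e -> \forall h \near 0, `|f (h + x) - f x - df h| <= e * `|h|) ->
  differentiable f x.
Proof.
move=> dfc H; apply/diffP.
apply: (@getPex _ (fun (df : {linear V -> W}) => continuous df /\
  forall y, f y = f (lim (nbhs x)) + df (y - lim (nbhs x))
                  +o_(y \near x) (y - lim (nbhs x)))).
exists df; split=> //; rewrite lim_id//.
have : f = cst (f x) + (df \o center x) +o_x (center x).
  apply/eqaddoP => e e0; rewrite [\forall x \near _, _ <= _](near_shift 0).
  apply: filterS (H e e0) => h /=.
  by rewrite !fctE /= !subr0 addrK opprD addrA => ?.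
by rewrite funeqE.
Unshelve. all: by end_near. Qed.

Lemma diff_linear_dir (V W : normedModType R) (f : V -> W) x :
  differentiable f x ->
  forall (a : R) u v, 'D_(a *: u + v) f x = a *: 'D_u f x + 'D_v f x.
Proof. by move=> df a u v; rewrite !deriveE// linearP. Qed.

(** Only the curve [h |-> phi (h *: v + x)] matters, so derivability of [phi] in the single
    direction [v] is enough for the inner map. *)
Lemma chain_dir (U V W : normedModType R) (f : V -> W) (phi : U -> V) x v :
  derivable phi x v -> differentiable f (phi x) ->
  derivable (f \o phi) x v /\ 'D_v (f \o phi) x = 'D_('D_v phi x) f (phi x).
Proof.
move=> dphi df.
pose c := fun h : R => phi (h *: v + x).
have c0 : c 0 = phi x by rewrite /c scale0r add0r.
have dc : differentiable c 0 by apply/derivable1_diffP; exact: (derivable1P phi x v).1.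
have lineE (Y : normedModType R) (k : U -> Y) : 'D_1 (fun h : R => k (h *: v + x)) 0 = 'D_v k x.
  rewrite /derive; set g1 := fun h => h^-1 *: _; set g2 := fun h => h^-1 *: _.
  suff -> : g1 = g2 by [].
  by rewrite funeqE /g1 /g2 => h /=; rewrite addr0 scale0r add0r [_%:A]mulr1.
have dfc : differentiable (f \o c) 0 by apply: differentiable_comp => //; rewrite c0.
split; first by apply/(derivable1P (f \o phi) x v)/derivable1_diffP.
rewrite -lineE -[LHS]/('D_1 (f \o c) 0) deriveE// diff_comp// ?c0// -lineE.
by rewrite (deriveE _ dc) [RHS]deriveE.
Qed.

Lemma is_derive_line (V W : normedModType R) (f : V -> W) x v (s : R) :
  derivable f (x + s *: v) v ->
  is_derive s 1 (fun t : R => f (x + t *: v)) ('D_v f (x + s *: v)).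
Proof.
have e : (fun h : R => h^-1 *: (((fun t : R => f (x + t *: v)) \o shift s) (h *: 1) - f (x + s *: v)))
  = (fun h : R => h^-1 *: ((f \o shift (x + s *: v)) (h *: v) - f (x + s *: v))).
  by apply/funext => h /=; rewrite [_%:A]mulr1 scalerDl addrCA.
by move=> df; split; rewrite /derivable /derive e.
Qed.

Lemma mvt_dir (V : normedModType R) (f : V -> R) x v (t : R) :
  (forall s, `|s| <= `|t| -> derivable f (x + s *: v) v) ->
  exists2 s, `|s| <= `|t| & f (x + t *: v) - f x = t * 'D_v f (x + s *: v).
Proof.
move=> H.
have main (a b : R) : a <= b -> (forall s, a <= s <= b -> derivable f (x + s *: v) v) ->
   exists2 s, a <= s <= b & f (x + b *: v) - f (x + a *: v) = (b - a) * 'D_v f (x + s *: v).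
  move=> ab Hd.
  have [||c cab e] := @MVT_segment R (fun t => f (x + t *: v)) (fun s => 'D_v f (x + s *: v)) a b ab.
  - move=> s sab; apply: is_derive_line; apply: Hd.
    by move: sab; rewrite in_itv /= => /andP[/ltW -> /ltW ->].
  - apply: derivable_within_continuous => s; rewrite in_itv /= => sab.
    by have [] := @is_derive_line _ _ f x v s (Hd s sab).
  - by exists c; [move: cab; rewrite in_itv|rewrite e mulrC].
have [t0|/ltW t0] := leP 0 t.
  have [|s /andP[s0 st]] := main 0 t t0.
    by move=> s /andP[s0 st]; apply: H; rewrite !ger0_norm.
  by rewrite scale0r addr0 subr0 => e; exists s => //; rewrite !ger0_norm.
have [|s /andP[s0 st]] := main t 0 t0.
  by move=> s /andP[s0 st]; apply: H; rewrite !ler0_norm ?lerN2.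
rewrite scale0r addr0 sub0r mulNr => e; exists s; first by rewrite !ler0_norm ?lerN2.
by rewrite -opprB e opprK.
Qed.

Lemma continuous_sum (T : topologicalType) (V : normedModType R) I (r : seq I) (P : pred I)
    (F : I -> T -> V) (x : T) : (forall i, {for x, continuous (F i)}) ->
  {for x, continuous (fun y => \sum_(i <- r | P i) F i y)}.
Proof.
move=> cF; rewrite /prop_for /continuous_at.
elim: r => [|i r IH]; first by under eq_fun do rewrite big_nil; rewrite big_nil; exact: cvg_cst.
under eq_fun do rewrite big_cons; rewrite big_cons; case: ifP => // _.
by apply: cvgD => //; exact: cF.
Qed.

Section C1.
Context (d : nat).

Definition lincomb (c : 'I_d -> R) (v : 'rV[R]_d) : R := \sum_i v 0 i * c i.

Lemma lincomb_linear c : linear (lincomb c).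
Proof.
move=> a u v; rewrite /lincomb scaler_sumr -big_split; apply: eq_bigr => i _ /=.
by rewrite !mxE mulrDl /GRing.scale /= mulrA.
Qed.
HB.instance Definition _ c :=
  GRing.isLinear.Build R 'rV[R]_d R _ (lincomb c) (lincomb_linear c).

Lemma lincomb_continuous c : continuous (lincomb c).
Proof.
move=> v; apply: continuous_sum => i; apply: continuousM; [exact: coord_continuous|exact: cst_continuous].
Qed.

Lemma coord_le_norm (h : 'rV[R]_d) i : `|h 0 i| <= `|h|.
Proof.
by rewrite [leRHS]/Num.Def.normr/= mx_normrE; apply: (le_bigmax _ (fun ij => `|h ij.1 ij.2|) (0, i)).
Qed.

(** The increment is split along a path parallel to the axes, and the mean value theorem is applied
    on each edge; all intermediate points stay in the ball where the partial derivatives are close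
    to those at [x]. *)
Lemma C1_differentiable (f : 'rV[R]_d -> R) x :
  (\forall y \near x, forall i, derivable f y (delta_mx 0 i)) ->
  (forall i, {for x, continuous (fun y => 'D_(delta_mx 0 i) f y)}) ->
  differentiable f x.
Proof.
move=> fd fc.
pose c i := 'D_(delta_mx 0 i) f x.
apply: (@differentiable_intro _ _ f (lincomb c)); first exact: lincomb_continuous.
(* Each of the [d] edges contributes at most [e' * |h|]; the [+ 1] covers [d = 0]. *)
move=> e e0; pose e' := e / (d%:R + 1).
have e'0 : 0 < e' by rewrite divr_gt0// ltr_wpDl.
have near2 : \forall y \near x, forall i, derivable f y (delta_mx 0 i) /\
    `|'D_(delta_mx 0 i) f y - c i| <= e'.
  have near1 : \forall y \near x, forall i, `|'D_(delta_mx 0 i) f y - c i| <= e'.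
    have := @filter_forall _ 'I_d (fun i y => `|'D_(delta_mx 0 i) f y - c i| <= e') (nbhs x) _; apply.
    move=> i; have := fc i => /cvgrPdist_le /(_ e' e'0); rewrite /prop_for /= => h.
    by apply: filterS h => y; rewrite distrC.
  by apply: filterS2 fd near1 => y h1 h2 i; split.
move: near2 => /nbhs_ballP [r /= r0 near2].
apply/nbhs_ballP; exists r => //= h; rewrite -ball_normE /= sub0r normrN => hr.
(* [hk k] keeps the first [k] coordinates of [h]. *)
pose hk k : 'rV[R]_d := \row_(i < d) (if (i < k)%N then h 0 i else 0).
have hkS (k : 'I_d) : hk k.+1 = hk k + h 0 k *: delta_mx 0 k.
  apply/rowP => i; rewrite !mxE eqxx /=; have [->|ik] := eqVneq i k.
    by rewrite ltnSn ltnn add0r mulr1.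
  by rewrite mulr0 addr0 ltnS leq_eqVlt val_eqE (negbTE ik).
have hkb (k : 'I_d) s : `|s| <= `|h 0 k| -> ball x r (x + hk k + s *: delta_mx 0 k).
  move=> sh; split => // i j; rewrite -ball_normE /= ord1 -addrA !mxE eqxx /= opprD addrA subrr sub0r normrN.
  apply: le_lt_trans hr; have [->|jk] := eqVneq j k.
    by rewrite ltnn add0r mulr1; apply: le_trans sh (coord_le_norm _ _).
  by rewrite mulr0 addr0; case: ifP => _; rewrite ?normr0// coord_le_norm.
have step (k : 'I_d) : `|f (x + hk k.+1) - f (x + hk k) - h 0 k * c k| <= e' * `|h|.
  have [s sh|s sh] := @mvt_dir _ f (x + hk k) (delta_mx 0 k) (h 0 k).
    by have [] := near2 _ (hkb k s sh) k.
  rewrite hkS addrA => ->; rewrite -mulrBr normrM mulrC.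
  by apply: ler_pM => //; [have [] := near2 _ (hkb k s sh) k|exact: coord_le_norm].
have tele : f (h + x) - f x - lincomb c h =
    \sum_(k < d) (f (x + hk k.+1) - f (x + hk k) - h 0 k * c k).
  rewrite big_split sumrN /=; congr (_ - _).
  rewrite -(big_mkord xpredT (fun k => f (x + hk k.+1) - f (x + hk k))) telescope_sumr//.
  congr (f _ - f _); first by rewrite addrC; congr (_ + _); apply/rowP => i; rewrite mxE ltn_ord.
  by rewrite -[LHS]addr0; congr (_ + _); apply/rowP => i; rewrite !mxE.
rewrite tele; apply: le_trans (ler_norm_sum _ _ _) _.
apply: le_trans (_ : _ <= \sum_(k < d) e' * `|h|) _; first by apply: ler_sum.
rewrite sumr_const card_ord -mulr_natl mulrA ler_wpM2r// /e' mulrCA mulrA.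
rewrite ler_pdivrMr ?ltr_wpDl//; nra.
Qed.

End C1.

Lemma differentiable_row d m (F : 'rV[R]_d -> 'rV[R]_m) x :
  (forall i, differentiable (fun y => F y 0 i) x) -> differentiable F x.
Proof.
move=> dF.
have -> : F = \sum_(i < m) (fun y => F y 0 i *: (delta_mx 0 i : 'rV[R]_m)).
  by apply/funext => y; rewrite [LHS]row_sum_delta fct_sumE.
by apply: differentiable_sum => i; exact: differentiableZl.
Qed.

Lemma Ck1_differentiable_row d m n (U : set 'rV[R]_d) (F : 'rV[R]_d -> 'rV[R]_m) x :
  open U -> U x -> Ck n.+1 U F -> differentiable F x.
Proof.
move=> oU Ux [_ C1]; apply: differentiable_row => j.
have nU := open_nbhs_nbhs (conj oU Ux).
apply: C1_differentiable.
  apply: filterS nU => y Uy i.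
  by have /derivable_mxP := (C1 (delta_mx 0 i)).1 y Uy; exact.
move=> i; have [dF] := C1 (delta_mx 0 i).
have e y : U y -> 'D_(delta_mx 0 i) F y 0 j = 'D_(delta_mx 0 i) (fun y => F y 0 j) y.
  by move=> Uy; rewrite derive_mx ?mxE//; exact: dF.
move=> CF; have cF : {for x, continuous (fun y => 'D_(delta_mx 0 i) F y)}.
  by case: n CF {C1} => [|n] /= [+ _]; exact.
have : {for x, continuous (fun y => 'D_(delta_mx 0 i) F y 0 j)}.
  exact: (continuous_comp cF (@coord_continuous _ _ _ 0 j _)).
rewrite /prop_for /continuous_at -e// => h; apply: cvg_trans h.
have eN : \forall y \near x, 'D_(delta_mx 0 i) F y 0 j = 'D_(delta_mx 0 i) (fun y => F y 0 j) y.
  exact: filterS nU.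
exact: near_eq_cvg eN.
Qed.

Lemma is_derive_translate (V W : normedModType R) (f : V -> W) x v c :
  derivable f (x + c) v -> is_derive x v (fun y => f (y + c)) ('D_v f (x + c)).
Proof.
have e : (fun h : R => h^-1 *: (((fun y => f (y + c)) \o shift x) (h *: v) - f (x + c)))
  = (fun h : R => h^-1 *: ((f \o shift (x + c)) (h *: v) - f (x + c))).
  by apply/funext => h /=; rewrite addrA.
by move=> df; split; rewrite /derivable /derive e.
Qed.

(** The mean value theorem is applied in direction [a] to [y |-> k (y + t *: b) - k y], then in
    direction [b] to ['D_a k]. The estimate holds for [s] and [t] independently small, which the
    Cauchy property of difference quotients requires. *)
Lemma mixed_difference (V : normedModType R) (k : V -> R) z a b :
  (\forall y \near z, derivable k y a /\ derivable (fun y => 'D_a k y) y b) ->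
  {for z, continuous (fun y => 'D_b (fun y => 'D_a k y) y)} ->
  forall e, 0 < e -> exists2 r, 0 < r & forall s t, `|s| < r -> `|t| < r ->
    `|k (z + s *: a + t *: b) - k (z + s *: a) - k (z + t *: b) + k z
      - s * t * 'D_b (fun y => 'D_a k y) z| <= e * `|s| * `|t|.
Proof.
move=> kd kc e e0.
have near2 : \forall y \near z, (derivable k y a /\ derivable (fun y => 'D_a k y) y b) /\
    `|'D_b (fun y => 'D_a k y) y - 'D_b (fun y => 'D_a k y) z| <= e.
  apply: filterS2 kd ((cvgrPdist_le _ _).1 kc e e0) => y h1 h2; split => //.
  by rewrite distrC.
move: near2 => /nbhs_ballP [r0 /= r0gt0 near2].
have den : 0 < `|a| + `|b| + 1 by rewrite ltr_wpDl// addr_ge0.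
exists (r0 / (`|a| + `|b| + 1)); first by rewrite divr_gt0.
move=> s t; rewrite !ltr_pdivlMr// => sr tr.
have inb s' t' : `|s'| <= `|s| -> `|t'| <= `|t| -> ball z r0 (z + s' *: a + t' *: b).
  move=> ss tt; rewrite -ball_normE /= -addrA opprD addrA subrr sub0r normrN.
  apply: le_lt_trans (ler_normD _ _) _; rewrite !normrZ.
  apply: le_lt_trans (lerD (ler_wpM2r (normr_ge0 a) ss) (ler_wpM2r (normr_ge0 b) tt)) _.
  have := normr_ge0 a; have := normr_ge0 b; have := normr_ge0 s; have := normr_ge0 t.
  move: sr tr; nra.
pose f y := k (y + t *: b) - k y.
have df s' : `|s'| <= `|s| ->
    is_derive (z + s' *: a) a f ('D_a k (z + s' *: a + t *: b) - 'D_a k (z + s' *: a)).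
  move=> ss; have [[dk1 _] _] := near2 _ (inb s' t ss (lexx _)).
  have t0 : `|0 : R| <= `|t| by rewrite normr0.
  have [[] + _ _] := near2 _ (inb s' 0 ss t0); rewrite scale0r addr0 => dk2.
  by have h1 := is_derive_translate dk1; have h2 := derivableP dk2; exact: is_deriveB.
have [s' ss|s' ss] := @mvt_dir _ f z a s; first by have [] := df s' ss.
rewrite (@derive_val _ _ _ _ _ _ _ (df s' ss)).
have [t' tt|t' tt] := @mvt_dir _ (fun y => 'D_a k y) (z + s' *: a) b t.
  by have [[_ +] _] := near2 _ (inb s' t' ss tt).
move=> ->; rewrite /f => eq.
have -> : k (z + s *: a + t *: b) - k (z + s *: a) - k (z + t *: b) + k z =
  k (z + s *: a + t *: b) - k (z + s *: a) - (k (z + t *: b) - k z) by ring.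
rewrite eq mulrA -mulrBr !normrM -[leRHS]mulrA [leRHS]mulrC.
by rewrite ler_wpM2l ?mulr_ge0//; have [_ +] := near2 _ (inb s' t' ss tt).
Qed.

End calculus.

(** * Borel measurability of functions continuous in charts *)

Section borel_charts.
Context (R : realType) (E : normedModType R) (M : atlas E).
Hypothesis opM : forall c : chart M, open (cimg c).
Hypothesis invM : forall (c : chart M) (x : M), cdom c x -> cinv c (cfun c x) = x.

(** The preimage of an open interval is open in every chart, hence one of the sets generating the
    Borel sigma-algebra of the manifold. *)
Lemma measurable_chart (F : M -> R) :
  (forall (c : chart M) y, cimg c y -> {for y, continuous (F \o cinv c)}) ->
  @measurable_fun _ _ (mborel M) R setT F.
Proof.
move=> cF; apply: (measurability _ (RGenOpens.measurableE R)) => _ [_ [a [b ->]] <-].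
have oU : open `]a, b[%classic by exact: interval_open.
move: `]a, b[%classic oU => U oU.
rewrite setTI; apply: sub_sigma_algebra => c.
rewrite openE => _ [x [Ux cx] <-]; rewrite /interior.
have ix : cimg c (cfun c x) by exists x.
have n1 : nbhs (cfun c x) (cimg c) := open_nbhs_nbhs (conj (opM c) ix).
have n2 : nbhs (cfun c x) ((F \o cinv c) @^-1` U).
  by apply: cF => //; rewrite /= invM//; apply: open_nbhs_nbhs.
apply: filterS2 n1 n2 => _ [x' cx' <-] /=; rewrite invM// => Ux'.
by exists x'.
Qed.

End borel_charts.

Section manifold_theory.
Context (R : realType) (d : nat) (P : atlas 'rV[R]_d) (HP : is_manifold P).
Implicit Types (c : chart P) (z : P).

Lemma cimg_open c : open (cimg c).
Proof. by have := mf_overlap HP c c; rewrite setIid. Qed.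

Lemma cfun_in c z : cdom c z -> cimg c (cfun c z).
Proof. by exists z. Qed.

Lemma cat_in z : cdom (Defs.cat z) z.
Proof. exact: (mf_cover HP). Qed.

Lemma transition_differentiable c c' z : cdom c z -> cdom c' z ->
  differentiable (cfun c' \o cinv c) (cfun c z).
Proof.
move=> cz c'z; have := mf_transition HP c c' 1.
apply: Ck1_differentiable_row; first exact: (mf_overlap HP).
by exists z.
Qed.

Lemma near_overlap c c' z (Q : 'rV[R]_d -> Prop) : cdom c z -> cdom c' z ->
  (forall x, cdom c x -> cdom c' x -> Q (cfun c x)) -> \forall y \near cfun c z, Q y.
Proof.
move=> cz c'z H.
have h : nbhs (cfun c z) (cfun c @` (cdom c' `&` cdom c)).
  by apply: open_nbhs_nbhs; split; [exact: (mf_overlap HP)|exists z].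
by apply: filterS h => _ [x [c'x cx] <-]; exact: H.
Qed.

Lemma transition_inv c c' z w : cdom c z -> cdom c' z ->
  'D_('D_w (cfun c' \o cinv c) (cfun c z)) (cfun c \o cinv c') (cfun c' z) = w.
Proof.
move=> cz c'z.
have e : (cfun c' \o cinv c) (cfun c z) = cfun c' z by rewrite /= (mf_cinv HP).
have td : differentiable (cfun c \o cinv c') ((cfun c' \o cinv c) (cfun c z)).
  by rewrite e; exact: transition_differentiable.
have [_] := @chain_dir _ _ _ _ (cfun c \o cinv c') (cfun c' \o cinv c) (cfun c z) w
  (@diff_derivable _ _ _ _ _ _ (transition_differentiable cz c'z)) td.
rewrite e => <-.
rewrite -[RHS](derive_id (cfun c z) w); apply: near_eq_derive.
by apply: near_overlap cz c'z _ => x cx c'x /=; rewrite !(mf_cinv HP).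
Qed.

Lemma vec_ofE c z w : cdom c z ->
  vec_of c (cfun c z) w = 'D_w (cfun (Defs.cat z) \o cinv c) (cfun c z).
Proof. by move=> cz; rewrite /vec_of (mf_cinv HP). Qed.

Lemma vec_toK c z w : cdom c z -> vec_to c z (vec_of c (cfun c z) w) = w.
Proof. by move=> cz; rewrite vec_ofE// /vec_to transition_inv//; exact: cat_in. Qed.

Lemma vec_ofK c z v : cdom c z -> vec_of c (cfun c z) (vec_to c z v) = v.
Proof. by move=> cz; rewrite vec_ofE// /vec_to transition_inv//; exact: cat_in. Qed.

Lemma vec_to_lin c z (a : R) u v : cdom c z ->
  vec_to c z (a *: u + v) = a *: vec_to c z u + vec_to c z v.
Proof.
by move=> cz; apply: diff_linear_dir; apply: transition_differentiable => //; exact: cat_in.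
Qed.

Lemma vec_of_lin c z (a : R) u v : cdom c z ->
  vec_of c (cfun c z) (a *: u + v) = a *: vec_of c (cfun c z) u + vec_of c (cfun c z) v.
Proof.
move=> cz; rewrite !vec_ofE//.
by apply: diff_linear_dir; apply: transition_differentiable => //; exact: cat_in.
Qed.

Lemma vec_to_cat z v : vec_to (Defs.cat z) z v = v.
Proof.
rewrite -[RHS](derive_id (cfun (Defs.cat z) z) v); apply: near_eq_derive.
apply: near_overlap (cat_in z) (cat_in z) _ => x cx _ /=; by rewrite (mf_cinv HP).
Qed.

Lemma lin_sum_delta (V : lmodType R) (f : 'rV[R]_d -> V) :
  (forall (a : R) u v, f (a *: u + v) = a *: f u + f v) ->
  forall v, f v = \sum_i v 0 i *: f (delta_mx 0 i).
Proof.
move=> flin v; have f0 : f 0 = 0.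
  by apply: (addrI (f 0)); rewrite -{1}[f 0]scale1r -flin scaler0 !addr0.
rewrite {1}[v]row_sum_delta; elim/big_rec2: _ => // i y1 y2 _ <-.
exact: flin.
Qed.

Lemma tangent_cimg (c : chart P) q : @cimg _ _ (tangent P) c q <-> cimg c q.1.
Proof.
split=> [[[x v] /= cx <-]|[x cx e]]; first by exists x.
exists (x, vec_of c (cfun c x) q.2) => //=.
by rewrite vec_toK// e; case: q {e}.
Qed.

Lemma tangent_cimg_open c : open (@cimg _ _ (tangent P) c).
Proof.
have -> : @cimg _ _ (tangent P) c = fst @^-1` (cimg c).
  by apply/seteqP; split => q; rewrite tangent_cimg.
by apply: open_comp; [move=> q _; exact: cvg_fst|exact: cimg_open].
Qed.

Lemma tangent_cinv (c : chart (tangent P)) (p : tangent P) :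
  cdom c p -> cinv c (cfun c p) = p.
Proof. by case: p => x v /= cx; rewrite (mf_cinv HP)// vec_ofK. Qed.

Lemma tangent_fst_measurable :
  @measurable_fun _ _ (mborel (tangent P)) (mborel P) setT (fun p => p.1).
Proof.
apply: (@measurability _ _ (mborel (tangent P)) (mborel P) _ _ (@mopen _ _ P)) => // _ [A oA <-].
rewrite setTI; apply: sub_sigma_algebra => c.
have -> : cfun c @` (fst @^-1` A `&` @cdom _ _ (tangent P) c) =
   fst @^-1` (@cfun _ _ P c @` (A `&` @cdom _ _ P c)).
  apply/seteqP; split=> [_ [[x v] /= [Ax cx] <-]|[y w] /= [x [Ax cx] e]]; first by exists x.
  exists (x, @vec_of _ _ P c (@cfun _ _ P c x) w) => //=.
  by rewrite vec_toK// e.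
by apply: open_comp; [move=> q _; exact: cvg_fst|exact: oA].
Qed.

Lemma tangent_fiber_measurable z :
  @measurable_fun _ _ (vborel 'rV[R]_d) (mborel (tangent P)) setT (fun e => (z, e)).
Proof.
apply: (@measurability _ _ (vborel 'rV[R]_d) (mborel (tangent P)) _ _ (@mopen _ _ (tangent P))) => // _ [A oA <-].
rewrite setTI; apply: sub_sigma_algebra.
(* In the preferred chart at [z] the coordinates of a vector at [z] are the vector itself, so the
   slice of [A] is a slice of an open set of the model space. *)
have -> : (fun e => (z, e)) @^-1` A =
   (fun e : 'rV[R]_d => (cfun (Defs.cat z) z, e)) @^-1` (@cfun _ _ (tangent P) (Defs.cat z) @` (A `&` @cdom _ _ (tangent P) (Defs.cat z))).
  apply/seteqP; split=> [e /= Ae|e /= [[x v] /= [Ax cx] [e1 e2]]].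
    exists (z, e); first by split => //=; exact: cat_in.
    by rewrite /= vec_to_cat.
  have xz : x = z by rewrite -(mf_cinv HP cx) e1 (mf_cinv HP)//; exact: cat_in.
  by subst x; rewrite -e2 vec_to_cat.
apply: open_comp; last exact: oA.
move=> e _; apply: (@cvg_pair _ _ _ (nbhs e) (nbhs (cfun (Defs.cat z) z)) (nbhs e)
  _ _ _ (fun=> cfun (Defs.cat z) z) id); [exact: cvg_cst|exact: cvg_id].
Qed.

Section functions.
Variable (f : P -> R).
Hypothesis fd : forall c y, cimg c y -> differentiable (f \o cinv c) y.

Lemma dfun_chart c z v : cdom c z ->
  dfun f (z, v) = 'D_(vec_to c z v) (f \o cinv c) (cfun c z).
Proof.
move=> cz; rewrite /dfun /vec_to /=.
have cz' := cat_in z.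
have e : (cfun c \o cinv (Defs.cat z)) (cfun (Defs.cat z) z) = cfun c z by rewrite /= (mf_cinv HP).
have td : differentiable (f \o cinv c) ((cfun c \o cinv (Defs.cat z)) (cfun (Defs.cat z) z)).
  by rewrite e; exact/fd/cfun_in.
have [_] := @chain_dir _ _ _ _ (f \o cinv c) (cfun c \o cinv (Defs.cat z)) (cfun (Defs.cat z) z) v
  (@diff_derivable _ _ _ _ _ _ (transition_differentiable cz' cz)) td.
rewrite e => <-.
apply: near_eq_derive.
by apply: near_overlap cz' cz _ => x cx c'x /=; rewrite !(mf_cinv HP).
Qed.

Lemma dcov_coord c z i v : cdom c z ->
  (dcov (fun x => cfun c x 0 i) z *m v^T) 0 0 = vec_to c z v 0 i.
Proof.
move=> cz; rewrite [vec_to c z v](@lin_sum_delta _ (vec_to c z)); last first.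
  by move=> a u u'; rewrite vec_to_lin.
rewrite mxE summxE; apply: eq_bigr => j _; rewrite !mxE mulrC; congr (_ * _).
rewrite /dfun /vec_to /= derive_mx ?mxE//.
by apply: diff_derivable; apply: transition_differentiable => //; exact: cat_in.
Qed.

(** The formula df = sum_j (d_j f) dx_j in the chart; it expresses the differential through the
    coordinate covectors on which [pt_smooth] controls [B]. *)
Lemma dcov_chart c z : cdom c z ->
  dcov f z = \sum_j 'D_(delta_mx 0 j) (f \o cinv c) (cfun c z) *: dcov (fun x => cfun c x 0 j) z.
Proof.
move=> cz; apply/rowP => i; rewrite mxE (dfun_chart _ cz).
have dl := diff_linear_dir (fd (cfun_in cz)).
rewrite (@lin_sum_delta R^o (fun v => 'D_v (f \o cinv c) (cfun c z)) dl).
rewrite summxE; apply: eq_bigr => j _; rewrite [in RHS]mxE [RHS]mulrC; congr (_ * _).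
rewrite -dcov_coord// mxE (bigD1 i)//= big1 ?addr0; last first.
  by move=> l li; rewrite !mxE eqxx (negbTE li) mulr0.
by rewrite !mxE !eqxx mulr1.
Qed.

End functions.
End manifold_theory.

Lemma open_eq_continuous (T U : topologicalType) (O : set T) (f h : T -> U) x :
  open O -> O x -> (forall y, O y -> f y = h y) ->
  {for x, continuous h} -> {for x, continuous f}.
Proof.
move=> oO Ox e ch; rewrite /prop_for /continuous_at e//.
apply: cvg_trans ch; apply: (near_eq_cvg (F := nbhs x)).
by apply: filterS (open_nbhs_nbhs (conj oO Ox)) => y Oy; rewrite /= e.
Qed.

Section hamiltonian_fields.
Context (R : realType) (d : nat) (P : atlas 'rV[R]_d) (HP : is_manifold P).
Context (br : (P -> R) -> (P -> R) -> (P -> R)) (B : P -> 'M[R]_d).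
Hypothesis HB : is_poisson_tensor br B.
Context (g : metric P) (Hg : is_riemannian g).

Definition C1fun (f : P -> R) := forall (c : chart P) y, cimg c y ->
  differentiable (f \o cinv c) y /\
  forall i, {for y, continuous (fun y => 'D_(delta_mx 0 i) (f \o cinv c) y)}.

Definition poisson_coef (c : chart P) (y : 'rV[R]_d) (i j : 'I_d) : R :=
  (dcov (fun x => cfun c x 0 i) (cinv c y) *m B (cinv c y)
       *m (dcov (fun x => cfun c x 0 j) (cinv c y))^T) 0 0.

Definition metric_coef (c : chart P) (y : 'rV[R]_d) (i j : 'I_d) : R :=
  g (cinv c y) (vec_of c y (delta_mx 0 i)) (vec_of c y (delta_mx 0 j)).

(** The components of X_f in the chart [c]: X_f^i = sum_j B(dx_i, dx_j) d_j f. *)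
Definition ham_coef (f : P -> R) (c : chart P) (y : 'rV[R]_d) (i : 'I_d) : R :=
  \sum_j 'D_(delta_mx 0 j) (f \o cinv c) y * poisson_coef c y i j.

Lemma metric_semi z : semi_inner (g z).
Proof.
have s := rm_sym Hg z; have l := rm_lin Hg z; split => // v.
have [->|v0] := eqVneq v 0; last by apply/ltW/(rm_pos Hg).
have e : g z 0 0 = - g z 0 0 + g z 0 0 by have := l (-1) 0 0 0; rewrite scaler0 addr0 mulN1r.
by move: e; lra.
Qed.

Lemma poisson_coef_continuous c y i j : cimg c y ->
  {for y, continuous (fun y => poisson_coef c y i j)}.
Proof. by move=> cy; have [h _] := pt_smooth HB c i j 0; exact: h. Qed.

Lemma metric_coef_continuous c y i j : cimg c y ->
  {for y, continuous (fun y => metric_coef c y i j)}.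
Proof. by move=> cy; have [h _] := rm_smooth Hg c (delta_mx 0 i) (delta_mx 0 j) 0; exact: h. Qed.

Lemma ham_coef_continuous f c y i : C1fun f -> cimg c y ->
  {for y, continuous (fun y => ham_coef f c y i)}.
Proof.
move=> fC cy; apply: continuous_sum => j; apply: continuousM; last exact: poisson_coef_continuous.
exact: (fC c y cy).2.
Qed.

Lemma ham_chart f c z : C1fun f -> cdom c z ->
  Xham B f z = vec_of c (cfun c z) (\row_i ham_coef f c (cfun c z) i).
Proof.
move=> fC cz; rewrite -[LHS](vec_ofK HP _ cz); congr vec_of.
apply/rowP => i; rewrite mxE -(dcov_coord HP _ _ cz) /Xham /Bsharp.
rewrite trmx_mul trmxK mulmxA.
rewrite (dcov_chart HP (fun c y cy => (fC c y cy).1) cz).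
rewrite linear_sum mulmx_sumr summxE; apply: eq_bigr => j _.
by rewrite linearZ -scalemxAr mxE /poisson_coef (mf_cinv HP).
Qed.

Lemma metric_chart c z u v : cdom c z ->
  g z (vec_of c (cfun c z) u) (vec_of c (cfun c z) v) =
  \sum_i \sum_j u 0 i * v 0 j * metric_coef c (cfun c z) i j.
Proof.
move=> cz; have s := metric_semi z.
rewrite (lin_sum_delta (fun a u v => vec_of_lin HP a u v cz) u).
rewrite (lin_sum_delta (fun a u v => vec_of_lin HP a u v cz) v).
rewrite (ip_suml s); apply: eq_bigr => i _; rewrite (ipZl s) (ip_sumr s) mulr_sumr.
by apply: eq_bigr => j _; rewrite (ipZr s) mulrA /metric_coef (mf_cinv HP).
Qed.

Lemma ham_metric_measurable f h : C1fun f -> C1fun h ->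
  @measurable_fun _ _ (mborel P) R setT (fun z => g z (Xham B f z) (Xham B h z)).
Proof.
move=> fC hC; apply: (measurable_chart (cimg_open HP) (mf_cinv HP)) => c y cy.
apply: (@open_eq_continuous _ _ (cimg c) _ (fun y => \sum_i \sum_j
  ham_coef f c y i * ham_coef h c y j * metric_coef c y i j)) => //.
- exact: cimg_open.
- move=> _ [z cz <-] /=; rewrite (mf_cinv HP)// !(ham_chart _ cz)// metric_chart//.
  by apply: eq_bigr => i _; apply: eq_bigr => j _; rewrite !mxE.
- apply: continuous_sum => i; apply: continuous_sum => j.
  apply: continuousM; last exact: metric_coef_continuous.
  by apply: continuousM; exact: ham_coef_continuous.
Qed.

(** One statement for both g(e, X_f) and g(e, e): [a] and [b] are the chart components of the two
    vectors being paired. *)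
Lemma tangent_measurable (F : P -> 'rV[R]_d -> R) (a b : chart P -> 'rV[R]_d * 'rV[R]_d -> 'I_d -> R) :
  (forall c z w, cdom c z -> F z (vec_of c (cfun c z) w) =
     \sum_i \sum_j a c (cfun c z, w) i * b c (cfun c z, w) j * metric_coef c (cfun c z) i j) ->
  (forall c q i, cimg c q.1 -> {for q, continuous (fun q => a c q i)}) ->
  (forall c q i, cimg c q.1 -> {for q, continuous (fun q => b c q i)}) ->
  @measurable_fun _ _ (mborel (tangent P)) R setT (fun p => F p.1 p.2).
Proof.
move=> e ca cb.
apply: (@measurable_chart _ _ (tangent P) (@tangent_cimg_open _ _ _ HP)
  (@tangent_cinv _ _ _ HP) (fun p => F p.1 p.2)) => c q cq.
apply: (@open_eq_continuous _ _ (@cimg _ _ (tangent P) c) _ (fun q => \sum_i \sum_j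
  a c q i * b c q j * metric_coef c q.1 i j)) => //.
- exact: tangent_cimg_open.
- move=> [y w] /(tangent_cimg HP) [z cz /= <-] /=; rewrite (mf_cinv HP)//.
  exact: e.
- move/(tangent_cimg HP) : cq => cq.
  apply: continuous_sum => i; apply: continuous_sum => j.
  apply: continuousM; last first.
    apply: (continuous_comp (f := fst) (g := fun y => metric_coef c y i j)); first exact: cvg_fst.
    exact: metric_coef_continuous.
  by apply: continuousM; [exact: ca|exact: cb].
Qed.

Lemma snd_coord_continuous (q : 'rV[R]_d * 'rV[R]_d) i :
  {for q, continuous (fun q : 'rV[R]_d * 'rV[R]_d => q.2 0 i)}.
Proof.
apply: (continuous_comp (f := snd) (g := fun y : 'rV[R]_d => y 0 i)); first exact: cvg_snd.
exact: coord_continuous.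
Qed.

Lemma tangent_ham_measurable f : C1fun f ->
  @measurable_fun _ _ (mborel (tangent P)) R setT (fun p => g p.1 p.2 (Xham B f p.1)).
Proof.
move=> fC; apply: (@tangent_measurable (fun z e => g z e (Xham B f z))
  (fun c q i => q.2 0 i) (fun c q i => ham_coef f c q.1 i)).
- move=> c z w cz; rewrite (ham_chart _ cz)// metric_chart//.
  by apply: eq_bigr => i _; apply: eq_bigr => j _; rewrite !mxE.
- by move=> c q i _; exact: snd_coord_continuous.
- move=> c q i cq; apply: (continuous_comp (f := fst) (g := fun y => ham_coef f c y i)).
    exact: cvg_fst.
  exact: ham_coef_continuous.
Qed.

Lemma tangent_sq_measurable :
  @measurable_fun _ _ (mborel (tangent P)) R setT (fun p => g p.1 p.2 p.2).
Proof.
apply: (@tangent_measurable (fun z e => g z e e)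
  (fun c q i => q.2 0 i) (fun c q i => q.2 0 i)).
- by move=> c z w cz; rewrite metric_chart.
- by move=> c q i _; exact: snd_coord_continuous.
- by move=> c q i _; exact: snd_coord_continuous.
Qed.

End hamiltonian_fields.

(** * Derivatives in a smooth kernel space *)

Section smooth_kernel.
Context (R : realType) (d : nat) (P : atlas 'rV[R]_d) (HP : is_manifold P).
Context (K : P -> P -> R).
Hypothesis HKC : Ckfun 3 (fun xy : mprod P P => K xy.1 xy.2).
Context (HK : rkhs K).
Implicit Types (c : chart P) (f : hsp HK).

Definition kchart c c' (q : 'rV[R]_d * 'rV[R]_d) : R := K (cinv c q.1) (cinv c' q.2).

Lemma kchart_Ck c c' : Ck 3 (fun q => cimg c q.1 /\ cimg c' q.2) (kchart c c').
Proof.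
have := HKC (c, c'); suff -> : @cimg _ _ (mprod P P) (c, c') = (fun q => cimg c q.1 /\ cimg c' q.2).
  exact.
apply/seteqP; split=> [_ [[x x'] /= [cx cx'] <-]|[y y'] /= [[x cx <-] [x' cx' <-]]].
  by split => /=; [exists x|exists x'].
by exists (x, x').
Qed.

Lemma kchart_open c c' : open (fun q => cimg c q.1 /\ cimg c' q.2).
Proof.
have -> : (fun q : 'rV[R]_d * 'rV[R]_d => cimg c q.1 /\ cimg c' q.2) =
   (fst @^-1` cimg c) `&` (snd @^-1` cimg c') by [].
apply: openI; apply: open_comp; try exact: (cimg_open HP).
- by move=> q _; exact: cvg_fst.
- by move=> q _; exact: cvg_snd.
Qed.

Lemma kchart_continuous c c' q : cimg c q.1 -> cimg c' q.2 ->
  {for q, continuous (kchart c c')}.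
Proof. by move=> h1 h2; have [h _] := kchart_Ck c c'; apply: h. Qed.

Lemma hsq_kerB x x' : hsq (hker HK x - hker HK x') = K x x - 2 * K x x' + K x' x'.
Proof. by rewrite /hsq (ip_sqrB (hdot_semi HK)) !hdot_kerker. Qed.

Lemma hsp_continuous f c y : cimg c y -> {for y, continuous (f \o cinv c)}.
Proof.
move=> cy.
have diag : {for y, continuous (fun y' => (y', y') : 'rV[R]_d * 'rV[R]_d)}.
  by apply: (@cvg_pair _ _ _ (nbhs y) (nbhs y) (nbhs y) _ _ _ id id); exact: cvg_id.
have left : {for y, continuous (fun y' => (y', y) : 'rV[R]_d * 'rV[R]_d)}.
  by apply: (@cvg_pair _ _ _ (nbhs y) (nbhs y) (nbhs y) _ _ _ id (fun=> y)); [exact: cvg_id|exact: cvg_cst].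
have kC := @kchart_continuous c c (y, y) cy cy.
pose k y' := hsq (hker HK (cinv c y') - hker HK (cinv c y)).
have kE : k = fun y' => kchart c c (y', y') - 2 * kchart c c (y', y) + kchart c c (y, y).
  by apply/funext => y'; rewrite /k hsq_kerB.
have kC1 : {for y, continuous k}.
  rewrite kE; apply: continuousD; last exact: cst_continuous.
  apply: continuousB; first exact: (continuous_comp diag kC).
  by apply: continuousM; [exact: cst_continuous|exact: (continuous_comp left kC)].
have ky : k y = 0 by rewrite /k subrr /hsq (ip0l (hdot_semi HK)).
apply: (cvgrPdist_lt (F := nbhs y) _ _).2 => e e0.
have e1 : 0 < e ^+ 2 / (hsq f + 1) by rewrite divr_gt0 ?exprn_gt0// ltr_wpDl// hsq_ge0.
have hk : \forall t \near y, `|k y - k t| < e ^+ 2 / (hsq f + 1).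
  exact: (cvgrPdist_lt (F := nbhs y) _ _).1 kC1 _ e1.
apply: filterS hk => y'.
rewrite ky sub0r normrN ger0_norm ?hsq_ge0// => h.
have : (f (cinv c y') - f (cinv c y)) ^+ 2 < e ^+ 2.
  rewrite -!(hdot_ker f) -(ipBr (hdot_semi HK)).
  apply: le_lt_trans (ip_CS (hdot_semi HK) _ _) _.
  have f0 := hsq_ge0 f; have k'0 := hsq_ge0 (hker HK (cinv c y') - hker HK (cinv c y)).
  move: h; rewrite ltr_pdivlMr ?ltr_wpDl// => h; apply: le_lt_trans h.
  by rewrite mulrC ler_wpM2l// /hsq lerDl.
by rewrite -real_normK ?num_real// distrC ltr_pXn2r ?nnegrE//= ltW.
Qed.

Definition kquot c y v (t : R) : hsp HK :=
  t^-1 *: (hker HK (cinv c (y + t *: v)) - hker HK (cinv c y)).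

(** By the reproducing property the inner product of two quotients is a mixed second difference of
    the kernel at the diagonal, divided by [s * t]. It tends to the mixed derivative however [s] and
    [t] tend to 0. *)
Lemma kquot_dot c y v : cimg c y -> exists m, forall e, 0 < e -> exists2 r, 0 < r &
  forall s t, s != 0 -> t != 0 -> `|s| < r -> `|t| < r ->
    `|hdot (kquot c y v s) (kquot c y v t) - m| <= e.
Proof.
move=> cy; pose a := (v, 0) : 'rV[R]_d * 'rV[R]_d; pose b := (0, v) : 'rV[R]_d * 'rV[R]_d.
have [_ C2] := kchart_Ck c c; have [d1 [_ C1]] := C2 a; have [d2 [c2 _]] := C1 b.
have oU := @kchart_open c c.
have Uy : (fun q : 'rV[R]_d * 'rV[R]_d => cimg c q.1 /\ cimg c q.2) (y, y) by [].
exists ('D_b (fun q => 'D_a (kchart c c) q) (y, y)) => e e0.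
have nd : \forall q \near (y, y), derivable (kchart c c) q a /\ derivable (fun q => 'D_a (kchart c c) q) q b.
  apply: filterS (open_nbhs_nbhs (conj oU Uy)) => q Uq; split; [exact: d1|exact: d2].
have [r r0 H] := mixed_difference nd (c2 _ Uy) e0.
exists r => // s t s0 t0 sr tr; have := H s t sr tr.
have -> : (y, y) + s *: a + t *: b = (y + s *: v, y + t *: v).
  by rewrite /a /b; congr (_, _) => /=; rewrite !scaler0 addr0.
have -> : (y, y) + s *: a = (y + s *: v, y).
  by rewrite /a /b; congr (_, _) => /=; rewrite !scaler0 addr0.
have -> : (y, y) + t *: b = (y, y + t *: v).
  by rewrite /a /b; congr (_, _) => /=; rewrite !scaler0 addr0.
rewrite /kchart /= => h.
have hs := hdot_semi HK.
rewrite /kquot (ipZl hs) (ipZr hs) (ipBl hs) !(ipBr hs) !hdot_kerker.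
set D := 'D_b _ _ in h *.
have st : 0 < `|s| * `|t| by rewrite mulr_gt0 ?normr_gt0.
rewrite -(ler_pM2l st); have -> : `|s| * `|t| * e = e * `|s| * `|t| by ring.
apply: le_trans h; rewrite -!normrM le_eqVlt; apply/orP; left; apply/eqP.
by congr `|_|; field; rewrite s0 t0.
Qed.

(** All inner products of quotients tend to the same [m], so the quotients are Cauchy as the step
    tends to 0, and pairing [f] with their limit is differentiating [f]. Every element of the kernel
    space is thereby differentiable along lines in charts. *)
Lemma derivative_representer c y v : cimg c y -> exists rho : hsp HK,
  forall f, is_derive y v (f \o cinv c) (hdot f rho).
Proof.
move=> cy; have [m H] := kquot_dot v cy; have hs := hdot_semi HK.
pose q t := kquot c y v t.
have H2 e : 0 < e -> exists2 r, 0 < r & forall s t, s != 0 -> t != 0 ->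
    `|s| < r -> `|t| < r -> hsq (q s - q t) < e.
  (* In the expansion of the square [m] cancels and four errors of at most [e / 8] remain. *)
  move=> e0; have e8 : 0 < e / 8 by rewrite divr_gt0.
  have [r r0 Hr] := H _ e8; exists r => // s t s0 t0 sr tr.
  rewrite /hsq (ip_sqrB hs).
  have := Hr s s s0 s0 sr sr; have := Hr s t s0 t0 sr tr; have := Hr t t t0 t0 tr tr.
  rewrite !ler_norml /q => /andP[? ?] /andP[? ?] /andP[? ?]; lra.
pose u n := q (n.+1%:R^-1).
have small r : 0 < r -> exists n0, forall n, (n0 <= n)%N -> `|n.+1%:R^-1 : R| < r.
  move=> r0; exists (Num.truncn r^-1) => n nn.
  rewrite ger0_norm// invf_plt ?posrE//.
  by apply: lt_le_trans (truncnS_gt _) _; rewrite ler_nat ltnS.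
have un0 n : (n.+1%:R^-1 : R) != 0 by rewrite invr_eq0 pnatr_eq0.
have [e e0|rho rhoP] := @hsp_complete _ _ _ HK u.
  have [r r0 Hr] := H2 _ e0; have [n0 n0P] := small r r0.
  by exists n0 => i j ni nj; apply: Hr => //; exact: n0P.
(* Completeness concerns sequences; the Cauchy bound carries the limit along [1/(n+1)] over to all
   small steps. *)
have H3 e : 0 < e -> exists2 r, 0 < r & forall t, t != 0 -> `|t| < r -> hsq (q t - rho) < e.
  move=> e0; have e4 : 0 < e / 4 by rewrite divr_gt0.
  have [r r0 Hr] := H2 _ e4; have [n0 n0P] := small r r0; have [n1 n1P] := rhoP _ e4.
  exists r => // t t0 tr; pose n := maxn n0 n1.
  have -> : q t - rho = (q t - u n) + (u n - rho) by rewrite addrA subrK.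
  apply: le_lt_trans (ip_sqrD_le hs _ _) _.
  have h1 := Hr _ _ t0 (un0 n) tr (n0P n (leq_maxl _ _)); have h2 := n1P n (leq_maxr _ _).
  move: h1 h2; rewrite /hsq /u; lra.
exists rho => f.
have cvg : (fun h : R => h^-1 *: (((f \o cinv c) \o shift y) (h *: v) - (f \o cinv c) y)) @ 0^'
    --> hdot f rho.
  apply/cvgrPdist_lt => e e0.
  have f0 := hsq_ge0 f.
  have e1 : 0 < e ^+ 2 / (hsq f + 1) by rewrite divr_gt0 ?exprn_gt0// ltr_wpDl.
  have [r r0 Hr] := H3 _ e1.
  apply/nbhs_ballP; exists r => // t; rewrite -ball_normE /= sub0r normrN => tr t0.
  have := Hr t t0 tr.
  have -> : t^-1 *: (f (cinv c (t *: v + y)) - f (cinv c y)) = hdot f (q t).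
    by rewrite /q /kquot (ipZr hs) (ipBr hs) !hdot_ker [t *: v + y]addrC.
  rewrite distrC -(ipBr hs) ltr_pdivlMr ?ltr_wpDl// => h.
  have : hdot f (q t - rho) ^+ 2 < e ^+ 2.
    apply: le_lt_trans (ip_CS hs _ _) _; apply: le_lt_trans h.
    by rewrite mulrC ler_wpM2l ?hsq_ge0// lerDl.
  by rewrite -real_normK ?num_real// ltr_pXn2r ?nnegrE//= ltW.
split; first by apply/cvg_ex; exists (hdot f rho).
exact: (cvg_lim _ cvg).
Qed.

(** For a kernel section the derivative is a partial derivative of [K] with one variable frozen,
    hence continuous. The other elements of the kernel space become measurable through limits of
    combinations of sections. *)
Lemma hker_C1 x : C1fun (hker HK x).
Proof.
move=> c y cy; pose y0 := cfun (Defs.cat x) x; pose k := kchart (Defs.cat x) c.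
have cy0 : cimg (Defs.cat x) y0 := cfun_in (cat_in HP x).
have der y' v : cimg c y' -> derivable (hker HK x \o cinv c) y' v.
  by move=> cy'; have [rho H] := derivative_representer v cy'; have [] := H (hker HK x).
have cont i : {for y, continuous (fun y => 'D_(delta_mx 0 i) (hker HK x \o cinv c) y)}.
  pose b := (0, delta_mx 0 i) : 'rV[R]_d * 'rV[R]_d.
  have [_ C2] := kchart_Ck (Defs.cat x) c; have [_ [c1 _]] := C2 b.
  have -> : 'D_(delta_mx 0 i) (hker HK x \o cinv c) = (fun y => 'D_b k (y0, y)).
    apply/funext => y'; rewrite /derive; set g1 := fun h => h^-1 *: _; set g2 := fun h => h^-1 *: _.
    suff -> : g1 = g2 by [].
    apply/funext => h; rewrite /g1 /g2 /=.
    by rewrite /k /kchart /= scaler0 add0r /y0 (mf_cinv HP)//; exact: cat_in.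
  apply: (continuous_comp (f := fun y => (y0, y)) (g := fun q => 'D_b k q)); last exact: c1.
  by apply: (@cvg_pair _ _ _ (nbhs y) (nbhs y0) (nbhs y) _ _ _ (fun=> y0) id); [exact: cvg_cst|exact: cvg_id].
have nd : \forall y' \near y, forall i, derivable (hker HK x \o cinv c) y' (delta_mx 0 i).
  have nc : nbhs y (cimg c) := open_nbhs_nbhs (conj (cimg_open HP (c := c)) cy).
  by apply: filterS nc => y' cy' i; exact: der.
by split => //; exact: C1_differentiable.
Qed.

Definition rep z (i : 'I_d) : hsp HK :=
  sval (cid (derivative_representer (delta_mx 0 i) (cfun_in (cat_in HP z)))).

Lemma dcov_rep f z i : dcov f z 0 i = hdot f (rep z i).
Proof.
rewrite mxE /dfun /=; have [_] := svalP (cid (derivative_representer (delta_mx 0 i) (cfun_in (cat_in HP z)))) f.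
exact.
Qed.

Lemma dense_points : exists s : nat -> P, forall f, (forall n, f (s n) = 0) -> f = 0.
Proof.
have [Bn [oB Bb]] := mf_second_countable HP.
(* If [Bn n] is empty, [get] returns an arbitrary point, and an extra zero of [f] does no harm. *)
exists (fun n => get (Bn n)) => f f0; apply/hspP/funext => x.
rewrite [RHS](_ : _ = 0); last by [].
apply: contrapT => /eqP fx.
pose O := [set y | f y != 0].
have oO : mopen O.
  move=> c; rewrite openE => _ [y [Oy cy] <-]; rewrite /interior.
  have n1 := open_nbhs_nbhs (conj (cimg_open HP (c := c)) (cfun_in cy)).
  have cf := hsp_continuous (f := f) (cfun_in cy).
  have n2 : nbhs (cfun c y) ((f \o cinv c) @^-1` [set t | t != 0]).
    apply: cf; apply: open_nbhs_nbhs; split; last by rewrite /= (mf_cinv HP).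
    exact: open_neq.
  apply: filterS2 n1 n2 => _ [y' cy' <-] /=; rewrite (mf_cinv HP)// => h.
  by exists y'.
have [n [nx nO]] := Bb O x oO fx.
have /nO := getPex (ex_intro _ x nx).
by rewrite /O /= f0 eqxx.
Qed.

End smooth_kernel.

(** Iterates [ip_sqrD_le]. The factor [2 ^+ n] is crude, but [n] is always fixed before the
    smallness of the summands is used. *)
Lemma ip_sum_le (R : realType) (V : lmodType R) (ip : V -> V -> R) n (F : 'I_n -> V) :
  semi_inner ip ->
  ip (\sum_i F i) (\sum_i F i) <= 2 ^+ n * \sum_i ip (F i) (F i).
Proof.
move=> s; elim: n F => [|n IH] F; first by rewrite !big_ord0 mulr0 (ip0l s).
rewrite !big_ord_recr /=; apply: le_trans (ip_sqrD_le s _ _) _.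
have := IH (fun i => F (widen_ord (leqnSn n) i)); have h0 := si_ge0 s (F ord_max).
have p1 : 1 <= 2 ^+ n :> R by rewrite exprn_ege1// ler1n.
set A := ip _ _; set S := \sum_(i < n) _; set b := ip _ _ in h0 *; rewrite exprS => h.
have : b <= 2 ^+ n * b by rewrite ler_peMl.
move: h; set p := 2 ^+ n in p1 *; lra.
Qed.

(** An induction principle: a property stable under linear combinations passes from kernel sections
    to basis vectors and projections. It is used for measurability and for the identity defining
    Q. *)
Lemma gs_span (R : realType) (V : lmodType R) (ip : V -> V -> R) (s : nat -> V) (Q : V -> Prop) :
  Q 0 -> (forall a f h, Q f -> Q h -> Q (a *: f + h)) -> (forall n, Q (s n)) ->
  (forall n, Q (gsvec ip s n)) /\ forall n f, Q (gsproj ip s n f).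
Proof.
move=> Q0 QD Qs.
have QZ a f : Q f -> Q (a *: f) by move=> Qf; rewrite -[_ *: _]addr0; exact: QD.
have main n : (forall f, Q (gsproj ip s n f)) -> Q (gsvec ip s n).
  move=> Qp; rewrite /gsvec normalizeE; apply: QZ; rewrite addrC -scaleN1r; exact: QD.
have pr n : forall f, Q (gsproj ip s n f).
  elim: n => [//|n IH] f; rewrite gsprojS addrC; apply: QD => //; exact: main.
by split => // n; exact: main.
Qed.

(** * Orthonormal system and countable dense sequence of the kernel space *)

Section rkhs_density.
Context (R : realType) (d : nat) (P : atlas 'rV[R]_d) (HP : is_manifold P).
Context (K : P -> P -> R).
Hypothesis HKC : Ckfun 3 (fun xy : mprod P P => K xy.1 xy.2).
Context (HK : rkhs K).
Implicit Types (f h : hsp HK).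

Let hs := hdot_semi HK.

Definition kpts : nat -> P := sval (cid (dense_points HP HKC HK)).
Definition kvec (n : nat) : hsp HK := hker HK (kpts n).
Definition onb : nat -> hsp HK := gsvec (@hdot _ _ _ HK) kvec.
Definition pr (n : nat) : hsp HK -> hsp HK := gsproj (@hdot _ _ _ HK) kvec n.

Lemma pr_cvg f e : 0 < e -> exists n0, forall n, (n0 <= n)%N -> hsq (f - pr n f) < e.
Proof.
apply: (gsproj_cvg hs); last by move=> u cu; exact: hsp_complete.
move=> h h0; apply: (svalP (cid (dense_points HP HKC HK))) => n.
by rewrite -hdot_ker; exact: h0.
Qed.

Lemma prE n f : pr n f = \sum_(j < n) hdot f (onb j) *: onb j.
Proof. exact: gsprojE. Qed.

(** Parseval's identity for [onb j] itself reads [x = S + x ^+ 2] with [S >= 0], whence [x <= 1];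
    both unit and zero vectors are allowed. *)
Lemma hsq_onb j : hsq (onb j) <= 1.
Proof.
have := gsproj_sq hs kvec j.+1 (onb j).
rewrite (gsproj_vec hs kvec (ltnSn j)) big_ord_recr /= -/(hsq (onb j)) => e.
have s0 : 0 <= \sum_(i < j) hdot (onb j) (onb i) ^+ 2 by apply: sumr_ge0 => i _; exact: sqr_ge0.
have e2 : hsq (onb j) = \sum_(i < j) hdot (onb j) (onb i) ^+ 2 + hsq (onb j) ^+ 2 by exact: e.
have := hsq_ge0 (onb j); move: e2 s0; set S := \sum_(i < j) _; set x := hsq _; nra.
Qed.

(** Rational combinations of basis vectors, enumerated through the countability of [seq rat]; a
    number that codes no list gives 0. *)
Definition dseq (n : nat) : hsp HK :=
  if unpickle n is Some l then \sum_(j < size l) ratr (nth 0 l j : rat) *: onb j else 0.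

Lemma dseq_dense f e : 0 < e -> exists n, hsq (f - dseq n) < e.
Proof.
move=> e0; have e4 : 0 < e / 4 by rewrite divr_gt0.
have [k /(_ k (leqnn k)) hk] := pr_cvg f e4.
(* Rounding the [k] coefficients by at most [eta] costs at most [2 ^+ k * k * eta ^+ 2], which this
   choice keeps below [e / 4]. *)
pose eta : R := Num.sqrt (e / 4 / (2 ^+ k * (k%:R + 1))).
have den : 0 < 2 ^+ k * (k%:R + 1) :> R by rewrite mulr_gt0 ?exprn_gt0// ltr_wpDl.
have eta0 : 0 < eta by rewrite sqrtr_gt0 divr_gt0.
have app (j : 'I_k) : {q : rat | `|hdot f (onb j) - ratr q| <= eta}.
  apply: cid; have [|q] := @rat_in_itvoo R (hdot f (onb j) - eta) (hdot f (onb j) + eta).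
    by rewrite ltrD2l gtrN.
  rewrite in_itv /= => /andP[h1 h2]; exists q; rewrite ler_norml; lra.
pose l : seq rat := [seq sval (app j) | j <- enum 'I_k].
have sl : size l = k by rewrite size_map size_enum_ord.
exists (pickle l); rewrite /dseq pickleK.
have -> : \sum_(j < size l) ratr (nth 0 l j) *: onb j = \sum_(j < k) ratr (sval (app j)) *: onb j.
  rewrite sl; apply: eq_bigr => j _; congr (ratr _ *: _).
  by rewrite (nth_map j) ?size_enum_ord// nth_ord_enum.
set S := \sum_(j < k) _.
have -> : f - S = (f - pr k f) + (pr k f - S) by rewrite addrA subrK.
apply: le_lt_trans (ip_sqrD_le hs _ _) _.
suff : hdot (pr k f - S) (pr k f - S) <= e / 4 by move: hk; rewrite /hsq; lra.
rewrite prE /S -sumrB; apply: le_trans (ip_sum_le _ hs) _.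
have : \sum_(i < k) hdot (hdot f (onb i) *: onb i - ratr (sval (app i)) *: onb i)
    (hdot f (onb i) *: onb i - ratr (sval (app i)) *: onb i) <= \sum_(i < k) eta ^+ 2.
  apply: ler_sum => i _; rewrite -scalerBl (ipZl hs) (ipZr hs) mulrA -expr2.
  rewrite -[leRHS]mulr1 -real_normK ?num_real//; apply: ler_pM; rewrite ?sqr_ge0//.
  - exact: hsq_ge0.
  - by rewrite ler_sqr ?nnegrE// ?(ltW eta0)//; exact: (svalP (app i)).
  - exact: hsq_onb.
rewrite sumr_const card_ord -(mulr_natl (eta ^+ 2)) => h.
apply: le_trans (ler_wpM2l _ h) _; first by rewrite exprn_ge0.
have k1 : 0 < k%:R + 1 :> R by rewrite ltr_wpDl.
have q0 : 0 < 2 ^+ k :> R by rewrite exprn_gt0.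
have -> : eta ^+ 2 = e / 4 / (2 ^+ k * (k%:R + 1)) by rewrite sqr_sqrtr// divr_ge0// ltW.
have -> : 2 ^+ k * (k%:R * (e / 4 / (2 ^+ k * (k%:R + 1)))) = e / 4 * (k%:R / (k%:R + 1)).
  by field; rewrite !gt_eqF.
by rewrite ler_piMr// ?(ltW e4)// ler_pdivrMr// mul1r lerDl.
Qed.

(** [Phi f] is the pointwise limit of [Phi (pr n f)], a finite combination of the functions [Phi] at
    kernel sections. The bounding constant may depend on [t], as only pointwise convergence is
    needed. *)
Lemma hsp_family_measurable (dT : measure_display) (T : measurableType dT) (Phi : hsp HK -> T -> R) :
  (forall a f h t, Phi (a *: f + h) t = a * Phi f t + Phi h t) ->
  (forall t, exists2 C, 0 <= C & forall f, Phi f t ^+ 2 <= C * hsq f) ->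
  (forall x, measurable_fun setT (Phi (hker HK x))) ->
  forall f, measurable_fun setT (Phi f).
Proof.
move=> lin bnd mk f.
have P0 t : Phi 0 t = 0.
  by have := lin (-1) 0 0 t; rewrite scaler0 addr0 mulN1r => e; lra.
have [_ mpr] : (forall n, measurable_fun setT (Phi (onb n))) /\
   forall n f, measurable_fun setT (Phi (pr n f)).
  apply: (@gs_span _ _ (@hdot _ _ _ HK) kvec (fun f => measurable_fun setT (Phi f)))
    => [|a f1 f2 m1 m2|n].
  - have -> : Phi 0 = cst 0 by apply/funext => t; rewrite P0.
    exact: measurable_cst.
  - have -> : Phi (a *: f1 + f2) = (fun t => a * Phi f1 t + Phi f2 t).
      by apply/funext => t; rewrite lin.
    by apply: measurable_funD => //; apply: measurable_funM => //; exact: measurable_cst.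
  - exact: mk.
apply: (@measurable_fun_cvg _ _ _ _ (fun n => Phi (pr n f))) => // t _.
apply/cvgrPdist_lt => e e0; have [C C0 HC] := bnd t.
have e1 : 0 < e ^+ 2 / (C + 1) by rewrite divr_gt0 ?exprn_gt0// ltr_wpDl.
have [n0 n0P] := pr_cvg f e1.
exists n0 => // n /= /n0P h.
have eD : Phi f t - Phi (pr n f) t = Phi (f - pr n f) t.
  by rewrite [f - _]addrC -(scaleN1r (pr n f)) lin; lra.
have : (Phi f t - Phi (pr n f) t) ^+ 2 < e ^+ 2.
  rewrite eD; apply: le_lt_trans (HC _) _; move: h.
  by have := hsq_ge0 (f - pr n f); rewrite ltr_pdivlMr ?ltr_wpDl//; nra.
by rewrite -real_normK ?num_real// ltr_pXn2r ?nnegrE//= ltW.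
Qed.

End rkhs_density.

(** * Hamiltonian fields and the covariance operator *)

Section integration_lemmas.
Context (dT : measure_display) (T : measurableType dT) (R : realType).
Context (mu : {measure set T -> \bar R}).

Lemma dominated_integrable_real (f h : T -> R) : measurable_fun setT f ->
  (forall x, `|f x| <= h x) -> mu.-integrable setT (EFin \o h) ->
  mu.-integrable setT (EFin \o f).
Proof.
move=> mf fh ih; apply: le_integrable ih => //; first exact/measurable_EFinP.
move=> x _ /=; rewrite lee_fin; apply: le_trans (fh x) _.
by rewrite ler_norm.
Qed.

(** Dominated convergence with [f] as the dominating function. Applied to the bad points, both for
    their measure and for the energy of X_eta on them. *)
Lemma vanishing_integral (f : T -> R) (A : nat -> set T) : (forall k, measurable (A k)) ->
  (forall x, exists k0, forall k, (k0 <= k)%N -> ~ A k x) ->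
  (forall x, 0 <= f x) -> mu.-integrable setT (EFin \o f) ->
  forall e, 0 < e -> exists k0, forall k, (k0 <= k)%N ->
    \int[mu]_x (f x * \1_(A k) x) < e.
Proof.
move=> mA vA f0 fi e e0.
have mf : measurable_fun setT f by apply/measurable_EFinP; case/integrableP : fi.
have mfA k : measurable_fun setT (fun x => f x * \1_(A k) x).
  by apply: measurable_funM => //; exact: measurable_indic.
have := @dominated_convergence _ _ _ mu setT measurableT
  (fun k x => (f x * \1_(A k) x)%:E) (cst 0) (EFin \o f) _ _ _ fi _.
case.
- by move=> k; exact/measurable_EFinP.
- exact: measurable_cst.
- apply: aeW => x _; have [k0 k0P] := vA x.
  apply: (cvg_near_cst (0%E : \bar R)); exists k0 => // k /= /k0P nA.
  by rewrite indicE memNset// mulr0.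
- apply: aeW => x k _ /=; rewrite lee_fin normrM ger0_norm// indicE.
  by case: (x \in A k); rewrite ?normr1 ?mulr1// normr0 mulr0.
move=> _ _; rewrite integral0 => /fine_cvgP [_] /cvgrPdist_lt /(_ e e0) [k0 _ k0P].
exists k0 => k kk; have := k0P k kk; rewrite /= sub0r normrN.
by apply: le_lt_trans; rewrite ler_norm.
Qed.

End integration_lemmas.

Section ham_rkhs.
Context (R : realType) (d : nat) (P : atlas 'rV[R]_d) (HP : is_manifold P).
Context (br : (P -> R) -> (P -> R) -> (P -> R)) (B : P -> 'M[R]_d).
Hypothesis HB : is_poisson_tensor br B.
Context (g : metric P) (Hg : is_riemannian g).
Context (K : P -> P -> R).
Hypothesis HKC : Ckfun 3 (fun xy : mprod P P => K xy.1 xy.2).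
Context (HK : rkhs K).
Implicit Types (f h : hsp HK).

Let hs := hdot_semi HK.
Let gs z := metric_semi Hg z.

Lemma Xham_lin (a : R) f h z : Xham B (a *: f + h) z = a *: Xham B f z + Xham B h z.
Proof.
rewrite /Xham /Bsharp scalemxAl -mulmxDl; congr (_ *m _).
apply/rowP => i; rewrite [RHS]mxE [X in _ = X + _]mxE.
by rewrite !(dcov_rep HP HKC) (si_lin hs).
Qed.

Lemma XhamB f h z : Xham B (f - h) z = Xham B f z - Xham B h z.
Proof. by rewrite [f - h]addrC -(scaleN1r h) Xham_lin scaleN1r addrC. Qed.

Lemma Xham0 z : Xham B (0 : hsp HK) z = 0.
Proof. by rewrite -[0 in LHS](subrr 0) XhamB subrr. Qed.

Lemma XhamZ a f z : Xham B (a *: f) z = a *: Xham B f z.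
Proof. by rewrite -[a *: f]addr0 Xham_lin Xham0 addr0. Qed.

Lemma XhamD f h z : Xham B (f + h) z = Xham B f z + Xham B h z.
Proof. by rewrite -[f in LHS]scale1r Xham_lin scale1r. Qed.

Lemma Xham_sum n (F : 'I_n -> hsp HK) z :
  Xham B (\sum_i F i) z = \sum_i Xham B (F i) z.
Proof.
elim: n F => [|n IH] F; first by rewrite !big_ord0 Xham0.
by rewrite !big_ord_recr /= XhamD IH.
Qed.

(** X_f(z) depends on [f] only through its inner products with the [d] representers at [z]: the
    quantitative form of finite rank. *)
Lemma Xham_rep_bound z : exists2 C, 0 <= C & forall f,
  g z (Xham B f z) (Xham B f z) <= C * \sum_i hdot f (rep HP HKC HK z i) ^+ 2.
Proof.
pose w i := Bsharp B z (delta_mx 0 i).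
exists (2 ^+ d * \sum_i g z (w i) (w i)).
  by rewrite mulr_ge0 ?exprn_ge0// sumr_ge0// => i _; exact: (si_ge0 (gs z)).
move=> f; have -> : Xham B f z = \sum_i hdot f (rep HP HKC HK z i) *: w i.
  rewrite /Xham /Bsharp [dcov f z]row_sum_delta mulmx_suml; apply: eq_bigr => i _.
  by rewrite -scalemxAl (dcov_rep HP HKC).
apply: le_trans (ip_sum_le _ (gs z)) _; rewrite -mulrA ler_wpM2l ?exprn_ge0//.
rewrite mulr_sumr; apply: ler_sum => i _; rewrite (ipZl (gs z)) (ipZr (gs z)) mulrA -expr2 mulrC.
rewrite ler_wpM2r ?sqr_ge0// (bigD1 i)//= lerDl sumr_ge0// => j _.
exact: (si_ge0 (gs z)).
Qed.

Lemma Xham_bound z : exists2 C, 0 <= C & forall f,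
  g z (Xham B f z) (Xham B f z) <= C * hsq f.
Proof.
have [C C0 HC] := Xham_rep_bound z.
exists (C * \sum_i hsq (rep HP HKC HK z i)).
  by rewrite mulr_ge0// sumr_ge0// => i _; exact: hsq_ge0.
move=> f; apply: le_trans (HC f) _; rewrite -mulrA ler_wpM2l// mulr_suml.
by apply: ler_sum => i _; rewrite mulrC; exact: (ip_CS hs).
Qed.

(** The two arguments are extended from kernel sections to the whole space one at a time, each
    extension being linear in one function. *)
Lemma ham_pair_measurable f h :
  @measurable_fun _ _ (mborel P) R setT (fun z => g z (Xham B f z) (Xham B h z)).
Proof.
have bnd z (v : 'rV[R]_d) : exists2 C, 0 <= C & forall f : hsp HK, g z (Xham B f z) v ^+ 2 <= C * hsq f.
  have [C C0 HC] := Xham_bound z; exists (C * g z v v); first by rewrite mulr_ge0// (si_ge0 (gs z)).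
  move=> f'; apply: le_trans (ip_CS (gs z) _ _) _.
  by rewrite mulrAC ler_wpM2r// (si_ge0 (gs z)).
have lin z v a (f1 f2 : hsp HK) : g z (Xham B (a *: f1 + f2) z) v = a * g z (Xham B f1 z) v + g z (Xham B f2 z) v.
  by rewrite Xham_lin (si_lin (gs z)).
apply: (@hsp_family_measurable _ _ _ HP _ HKC HK _ (mborel P)
  (fun f z => g z (Xham B f z) (Xham B h z))) => // x.
have -> : (fun z => g z (Xham B (hker HK x) z) (Xham B h z)) =
          (fun z => g z (Xham B h z) (Xham B (hker HK x) z)).
  by apply/funext => z; rewrite (si_sym (gs z)).
apply: (@hsp_family_measurable _ _ _ HP _ HKC HK _ (mborel P)
  (fun h z => g z (Xham B h z) (Xham B (hker HK x) z))) => // x'.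
by apply: (ham_metric_measurable HP HB Hg); exact: hker_C1.
Qed.

Lemma tangent_pair_measurable f :
  @measurable_fun _ _ (mborel (tangent P)) R setT (fun p => g p.1 p.2 (Xham B f p.1)).
Proof.
apply: (@hsp_family_measurable _ _ _ HP _ HKC HK _ (mborel (tangent P))
  (fun f p => g p.1 p.2 (Xham B f p.1))).
- by move=> a f1 f2 [z e] /=; rewrite Xham_lin (ipDr (gs z)) (ipZr (gs z)).
- move=> [z e] /=; have [C C0 HC] := Xham_bound z.
  exists (C * g z e e); first by rewrite mulr_ge0// (si_ge0 (gs z)).
  move=> f'; apply: le_trans (ip_CS (gs z) _ _) _.
  by rewrite mulrAC [leRHS]mulrC ler_wpM2l// (si_ge0 (gs z)).
- by move=> x; apply: (tangent_ham_measurable HP HB Hg); exact: hker_C1.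
Qed.

(* The points where the rank-k projection of the kernel space captures X_f up to
   an error tau, and where f |-> X_f(z) has norm at most k. *)
Definition good (tau : R) (k : nat) : set P := [set z | forall i : nat,
  g z (Xham B (dseq HP HKC HK i - pr HP HKC k (dseq HP HKC HK i)) z)
      (Xham B (dseq HP HKC HK i - pr HP HKC k (dseq HP HKC HK i)) z)
    <= tau ^+ 2 * hsq (dseq HP HKC HK i) /\
  g z (Xham B (dseq HP HKC HK i) z) (Xham B (dseq HP HKC HK i) z)
    <= k%:R ^+ 2 * hsq (dseq HP HKC HK i)].

(** The conditions are imposed only along the dense sequence, which makes the set a countable
    intersection; [dense_form_le] recovers them for all [f] up to a factor 4. *)
Lemma good_measurable tau k : measurable (good tau k : set (mborel P)).
Proof.
have -> : good tau k = \bigcap_i ([set z | g z (Xham B (dseq HP HKC HK i - pr HP HKC k (dseq HP HKC HK i)) z)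
      (Xham B (dseq HP HKC HK i - pr HP HKC k (dseq HP HKC HK i)) z)
    <= tau ^+ 2 * hsq (dseq HP HKC HK i)] `&` [set z |
  g z (Xham B (dseq HP HKC HK i) z) (Xham B (dseq HP HKC HK i) z)
    <= k%:R ^+ 2 * hsq (dseq HP HKC HK i)]).
  by apply/seteqP; split => [z Gz i _|z Gz i]; [have [] := Gz i|have [] := Gz i I].
apply: bigcapT_measurable => i.
have le_meas (F : P -> R) (c : R) : @measurable_fun _ _ (mborel P) R setT F ->
    measurable ([set z | F z <= c] : set (mborel P)).
  move=> mF; have := mF measurableT `]-oo, c]%classic (measurable_itv _).
  rewrite setTI; suff -> : F @^-1` `]-oo, c]%classic = [set z | F z <= c] by [].
  by apply/seteqP; split => z /=; rewrite in_itv.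
by apply: measurableI; apply: le_meas; exact: ham_pair_measurable.
Qed.

(** One factor 2 comes from splitting [f] into [D] and [f - D] in the form, the other from bounding
    [hsq D] by [hsq f]. The map [L] is either the identity or the complement of a projection. *)
Lemma dense_form_le z (L : hsp HK -> hsp HK) (c : R) : 0 <= c ->
  (forall f h, L (f - h) = L f - L h) -> (forall f, hsq (L f) <= hsq f) ->
  (forall i, g z (Xham B (L (dseq HP HKC HK i)) z) (Xham B (L (dseq HP HKC HK i)) z)
     <= c * hsq (dseq HP HKC HK i)) ->
  forall f, g z (Xham B (L f) z) (Xham B (L f) z) <= 4 * c * hsq f.
Proof.
move=> c0 Llin Lle H f; have [C C0 HC] := Xham_bound z.
apply/ler_addgt0Pr => e e0.
(* The total coefficient of [hsq (f - D)] in the estimate is [2 * C + 4 * c]. *)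
have den : 0 < 2 * C + 4 * c + 1 by lra.
have [i hi] := dseq_dense HP HKC f (divr_gt0 e0 den).
set D := dseq _ _ _ _ in hi; have Hi := H i; rewrite -/D in Hi.
have -> : Xham B (L f) z = Xham B (L (f - D)) z + Xham B (L D) z by rewrite -XhamD Llin subrK.
apply: le_trans (ip_sqrD_le (gs z) _ _) _.
have h1 := HC (L (f - D)); have h2 := Lle (f - D).
have h3 : hsq D <= 2 * hsq f + 2 * hsq (f - D).
  have -> : D = f - (f - D) by rewrite subKr.
  have := ip_sqrD_le hs f (- (f - D)); rewrite (ipNl hs) (ipNr hs) opprK.
  by rewrite subKr.
have f0 := hsq_ge0 f; have fD0 := hsq_ge0 (f - D).
move: hi; rewrite ltr_pdivlMr// => hi.
have h4 : C * hsq (L (f - D)) <= C * hsq (f - D) by rewrite ler_wpM2l.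
have h5 : c * hsq D <= c * (2 * hsq f + 2 * hsq (f - D)) by rewrite ler_wpM2l.
move: hi h1 h4 h5 Hi; set x := hsq (f - D); set y := hsq f; set t := g _ _ _; set t' := g _ _ _.
nra.
Qed.

Lemma good_tail tau k z f : good tau k z ->
  g z (Xham B (f - pr HP HKC k f) z) (Xham B (f - pr HP HKC k f) z) <= 4 * tau ^+ 2 * hsq f.
Proof.
move=> Gz; apply: (@dense_form_le z (fun f => f - pr HP HKC k f)).
- exact: sqr_ge0.
- by move=> f1 f2; rewrite /pr (gsprojB hs) opprD opprK addrACA opprD opprK.
- by move=> f1; exact: (gsprojC_le hs).
- by move=> i; have [] := Gz i.
Qed.

Lemma good_bound tau k z f : good tau k z ->
  g z (Xham B f z) (Xham B f z) <= 4 * k%:R ^+ 2 * hsq f.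
Proof.
move=> Gz; apply: (@dense_form_le z id) => // i.
by have [] := Gz i.
Qed.

(** By symmetry, testing [f - pr k f] on a representer is testing [f] on the representer minus its
    projection, which is small for large [k] simultaneously for the [d] representers and uniformly
    in [f]. *)
Lemma good_eventually tau z : 0 < tau -> exists k0, forall k, (k0 <= k)%N -> good tau k z.
Proof.
move=> tau0; have [C C0 HC] := Xham_rep_bound z; have [C' C'0 HC'] := Xham_bound z.
pose e := tau ^+ 2 / (C * d%:R + 1).
have den : 0 < C * d%:R + 1 by rewrite ltr_wpDl// mulr_ge0.
have e0 : 0 < e by rewrite divr_gt0// exprn_gt0.
have near1 : \forall k \near \oo, forall i : 'I_d,
    hsq (rep HP HKC HK z i - pr HP HKC k (rep HP HKC HK z i)) < e.
  have := @filter_forall _ 'I_d (fun i k => hsq (rep HP HKC HK z i - pr HP HKC k (rep HP HKC HK z i)) < e) \oo _; apply.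
  by move=> i; have [n0 n0P] := pr_cvg HP HKC (rep HP HKC HK z i) e0; exists n0.
move: near1 => [k1 _ k1P].
(* The second bound forces [k >= C'] and [k >= 1], so that [C' <= k <= k ^+ 2]. *)
exists (maxn k1 (Num.truncn C').+1) => k; rewrite geq_max => /andP[/k1P/= kk1 kk2] i; split.
- set f := dseq _ _ _ _; apply: le_trans (HC _) _.
  have : \sum_i hdot (f - pr HP HKC k f) (rep HP HKC HK z i) ^+ 2 <= \sum_(i < d) hsq f * e.
    apply: ler_sum => j _; rewrite (gsprojC_sym hs); apply: le_trans (ip_CS hs _ _) _.
    by rewrite ler_wpM2l// ?hsq_ge0// ltW//; exact: kk1.
  rewrite sumr_const card_ord -(mulr_natl (hsq f * e)) => h.
  apply: le_trans (ler_wpM2l C0 h) _.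
  have -> : C * (d%:R * (hsq f * e)) = tau ^+ 2 * hsq f * (C * d%:R / (C * d%:R + 1)).
    by rewrite /e; field; rewrite gt_eqF.
  apply: ler_piMr; first by rewrite mulr_ge0 ?sqr_ge0 ?hsq_ge0.
  by rewrite ler_pdivrMr// mul1r lerDl.
- apply: le_trans (HC' _) _; rewrite ler_wpM2r ?hsq_ge0//.
  have h1 : C' <= k%:R.
    by apply: le_trans (ltW (truncnS_gt _)) _; rewrite ler_nat.
  apply: le_trans h1 _; rewrite expr2 ler_peMr// ler1n.
  by apply: leq_trans kk2.
Qed.

End ham_rkhs.

Section covariance_operator.
Context (R : realType) (d : nat) (P : atlas 'rV[R]_d) (HP : is_manifold P).
Context (br : (P -> R) -> (P -> R) -> (P -> R)) (B : P -> 'M[R]_d).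
Hypothesis HB : is_poisson_tensor br B.
Context (g : metric P) (Hg : is_riemannian g).
Context (K : P -> P -> R).
Hypothesis HKC : Ckfun 3 (fun xy : mprod P P => K xy.1 xy.2).
Context (HK : rkhs K).
Context (mu : probability (mborel P) R).
Hypothesis HA : A_welldefined g B HK mu.
Implicit Types (f h : hsp HK).

Let hs := hdot_semi HK.
Let gs z := metric_semi Hg z.

Lemma ham_sq_integrable f :
  mu.-integrable setT (EFin \o (fun z => g z (Xham B f z) (Xham B f z))).
Proof.
apply/integrableP; split.
  by apply/measurable_EFinP; apply: (ham_pair_measurable HP HB Hg HKC).
have := HA (hsp_in f); congr (_ < _)%E; apply: eq_integral => z _ /=.
by rewrite ger0_norm// (si_ge0 (gs z)).
Qed.

Lemma ham_pair_integrable f h :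
  mu.-integrable setT (EFin \o (fun z => g z (Xham B f z) (Xham B h z))).
Proof.
apply: (@dominated_integrable_real _ (mborel P) R mu
  (fun z => g z (Xham B f z) (Xham B h z)) (fun z => g z (Xham B f z) (Xham B f z) + g z (Xham B h z) (Xham B h z))).
- exact: (ham_pair_measurable HP HB Hg HKC).
- move=> z; have := ip_young (gs z) (Xham B f z) (Xham B h z) ltr01.
  have := si_ge0 (gs z) (Xham B h z); lra.
- have -> : EFin \o (fun z => g z (Xham B f z) (Xham B f z) + g z (Xham B h z) (Xham B h z)) =
   (EFin \o (fun z => g z (Xham B f z) (Xham B f z))) \+
   (EFin \o (fun z => g z (Xham B h z) (Xham B h z))) by [].
  by apply: integrableD => //; exact: ham_sq_integrable.
Qed.

Definition L2dot f h : R := \int[mu]_z g z (Xham B f z) (Xham B h z).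

Lemma L2dot_semi : semi_inner L2dot.
Proof.
split=> [f h|a f f' h|f].
- by apply: eq_Rintegral => z _; exact: (si_sym (gs z)).
- rewrite /L2dot -RintegralZl//; last exact: ham_pair_integrable.
  rewrite -RintegralD//; last 2 first.
  + have i := ham_pair_integrable (a *: f) h; apply: eq_integrable i => // z _ /=.
    by rewrite (XhamZ HP B HKC) (ipZl (gs z)).
  + exact: ham_pair_integrable.
  by apply: eq_Rintegral => z _; rewrite (Xham_lin HP B HKC) (si_lin (gs z)).
- by apply: Rintegral_ge0 => z _; exact: (si_ge0 (gs z)).
Qed.

Context (M : R) (M0 : 0 <= M).
Hypothesis QM : forall f, hset HK f ->
  hset HK (Qop g B K mu f) /\ hnorm HK (Qop g B K mu f) <= M * hnorm HK f.

Definition Qh f : hsp HK := to_hsp (QM (hsp_in f)).1.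

Lemma Qh_ker f y : hdot (Qh f) (hker HK y) = L2dot (hker HK y) f.
Proof. by rewrite hdot_ker. Qed.

Lemma Qh_lin a f h : Qh (a *: f + h) = a *: Qh f + Qh h.
Proof.
apply/hspP/funext => y; rewrite -[LHS]hdot_ker Qh_ker -[RHS]/(a * Qh f y + Qh h y).
by rewrite (ipDr L2dot_semi) (ipZr L2dot_semi) -!Qh_ker !hdot_ker.
Qed.

Lemma Qh_sq f : hsq (Qh f) <= M ^+ 2 * hsq f.
Proof.
have [_ h] := QM (hsp_in f); rewrite -!hnorm_sq -exprMn ler_sqr// nnegrE.
  exact: sqrtr_ge0.
by rewrite mulr_ge0// sqrtr_ge0.
Qed.

(** On kernel sections this is the definition of Q, and linearity extends it to their span. Later it
    is tested only on the projection of the error, so no passage to the limit is made. *)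
Lemma Qh_span f : (forall j, hdot (Qh f) (onb HP HKC HK j) = L2dot (onb HP HKC HK j) f) /\
  forall n h, hdot (Qh f) (pr HP HKC n h) = L2dot (pr HP HKC n h) f.
Proof.
have ms := L2dot_semi.
apply: (@gs_span _ _ (@hdot _ _ _ HK) (kvec HP HKC HK) (fun h => hdot (Qh f) h = L2dot h f)).
- by rewrite (ip0r hs) (ip0l ms).
- move=> a f1 f2 e1 e2; rewrite (ipDr hs) (ipZr hs) e1 e2.
  by rewrite (si_lin ms).
- by move=> n; exact: Qh_ker.
Qed.

(** The operator bound of Q, read through the identity for <Q p, p>, bounds the L^2 norm of X_p. *)
Lemma L2dot_pr_le n f : L2dot (pr HP HKC n f) (pr HP HKC n f) <= M * hsq f.
Proof.
rewrite -(Qh_span _).2; set p := pr _ _ _ _.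
have pf : hsq p <= hsq f := gsproj_le hs _ _ _.
apply: le_trans (ler_wpM2l M0 pf).
have h1 := ip_CS hs (Qh p) p; have h2 := Qh_sq p.
have p0 := hsq_ge0 p.
have h3 : hdot (Qh p) p ^+ 2 <= (M * hsq p) ^+ 2.
  apply: le_trans h1 _; rewrite -!/(hsq _).
  have := ler_wpM2r p0 h2; rewrite exprMn; nra.
apply: le_trans (ler_norm _) _.
by rewrite -ler_sqr ?nnegrE ?mulr_ge0// real_normK ?num_real.
Qed.

Lemma Qh_sum n (F : 'I_n -> hsp HK) : Qh (\sum_i F i) = \sum_i Qh (F i).
Proof.
have Q0 : Qh 0 = 0.
  by apply: (addrI (Qh 0)); rewrite -{1}[Qh 0]scale1r -Qh_lin scaler0 !addr0.
elim: n F => [|n IH] F; first by rewrite !big_ord0.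
by rewrite !big_ord_recr /= -[X in X + _]scale1r Qh_lin scale1r IH.
Qed.

Lemma QhZ a f : Qh (a *: f) = a *: Qh f.
Proof.
have Q0 : Qh 0 = 0.
  by apply: (addrI (Qh 0)); rewrite -{1}[Qh 0]scale1r -Qh_lin scaler0 !addr0.
by rewrite -[a *: f]addr0 Qh_lin Q0 addr0.
Qed.

Lemma hfun_sum n (F : 'I_n -> hsp HK) x : (\sum_i F i) x = \sum_i F i x.
Proof.
elim: n F => [|n IH] F; first by rewrite !big_ord0.
by rewrite !big_ord_recr /= -IH.
Qed.

Lemma op_polyE (p : {poly R}) f :
  op_poly p (Qop g B K mu) f =
  hfun (p`_0 *: f + Qh (\sum_(i < size p) p`_i.+1 *: iter i Qh f)).
Proof.
have it i : iter i (Qop g B K mu) f = hfun (iter i Qh f).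
  elim: i => [|i IH]; first by [].
  rewrite iterS IH iterS.
  by [].
have -> : p`_0 *: f + Qh (\sum_(i < size p) p`_i.+1 *: iter i Qh f) =
   \sum_(i < size p) p`_i *: iter i Qh f.
  (* The added coefficient lies beyond the size and vanishes; it makes room for shifting the index
     when Q is factored out. *)
  have -> : \sum_(i < size p) p`_i *: iter i Qh f = \sum_(i < (size p).+1) p`_i *: iter i Qh f.
    by rewrite [RHS]big_ord_recr /= nth_default// scale0r addr0.
  rewrite big_ord_recl; congr (_ + _); rewrite Qh_sum; apply: eq_bigr => i _.
  by rewrite QhZ.
apply/funext => x; rewrite /op_poly hfun_sum; apply: eq_bigr => i _.
by rewrite it.
Qed.

End covariance_operator.

Section source_condition.
Context (R : realType) (d : nat) (P : atlas 'rV[R]_d) (HP : is_manifold P).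
Context (br : (P -> R) -> (P -> R) -> (P -> R)) (B : P -> 'M[R]_d).
Hypothesis HB : is_poisson_tensor br B.
Context (g : metric P) (Hg : is_riemannian g).
Context (K : P -> P -> R).
Hypothesis HKC : Ckfun 3 (fun xy : mprod P P => K xy.1 xy.2).
Context (HK : rkhs K).
Context (mu : probability (mborel P) R).
Hypothesis HA : A_welldefined g B HK mu.

(* As p_n(Q) psi tends to H and p_n(0) to 0^gamma = 0, H is a limit of elements
   Q (q_n(Q) psi) with p_n = p_n(0) + X q_n: it lies in the closure of the range of Q. *)
Lemma source_closure_range (gamma S : R) (H : P -> R) : 0 < gamma ->
  source_set HK (Qop g B K mu) gamma S H ->
  exists HH : hset HK H, exists M, exists2 QM : (forall f, hset HK f ->
    hset HK (Qop g B K mu f) /\ hnorm HK (Qop g B K mu f) <= M * hnorm HK f), 0 <= M &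
  forall e, 0 < e -> exists eta, hsq (to_hsp HH - Qh QM eta) <= e.
Proof.
move=> g0 [HH [Qga [psi [[M [p [[M0 QM] unif Qgah lim]]] psih _ HE]]]].
exists HH, M, QM => // e e0; pose psi' := to_hsp psih.
have hs := hdot_semi HK.
have den : 0 < 4 * (hsq psi' + 1) by rewrite mulr_gt0// ltr_wpDl// hsq_ge0.
(* Both p_n(0) psi and p_n(Q) psi - H have squared norm at most [t ^+ 2 * hsq psi'], and the square
   of their difference doubles each: [4 * t ^+ 2 * hsq psi' <= e]. *)
pose t := Num.sqrt (e / (4 * (hsq psi' + 1))).
have t0 : 0 < t by rewrite sqrtr_gt0 divr_gt0.
have [n1 n1P] := unif t t0; have [n2 n2P] := lim t t0.
pose n := maxn n1 n2.
have p0 : `|(p n)`_0| <= t.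
  have := n1P n (leq_maxl _ _) 0; rewrite lexx M0 => /(_ isT).
  by rewrite powR0 ?gt_eqF// subr0 horner_coef0.
have hn := n2P n (leq_maxr _ _) psi psih.
exists (\sum_(i < size (p n)) (p n)`_i.+1 *: iter i (Qh QM) psi').
set eta := \sum_(i < _) _.
have opE : op_poly (p n) (Qop g B K mu) psi = _ := op_polyE HP HB Hg HKC HA QM (p n) psi'.
move: hn; rewrite opE -HE; set v := (p n)`_0 *: psi' + Qh QM eta.
rewrite -[X in hnorm HK X]/(hfun (v - to_hsp HH)) -[psi]/(hfun psi') !hnormE => h.
have h1 : hsq (v - to_hsp HH) <= t ^+ 2 * hsq psi'.
  rewrite -(sqr_sqrtr (hsq_ge0 (v - _))) -(sqr_sqrtr (hsq_ge0 psi')) -exprMn.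
  by rewrite ler_sqr ?nnegrE ?mulr_ge0 ?sqrtr_ge0// ltW.
have -> : to_hsp HH - Qh QM eta = (p n)`_0 *: psi' - (v - to_hsp HH).
  by rewrite /v opprB; set a := _ *: psi'; rewrite opprD addrCA (addrA a) subrr add0r.
apply: le_trans (ip_sqrD_le hs _ _) _; rewrite (ipNl hs) (ipNr hs) opprK (ipZl hs) (ipZr hs).
have h2 : (p n)`_0 * ((p n)`_0 * hdot psi' psi') <= t ^+ 2 * hsq psi'.
  rewrite mulrA -expr2 ler_wpM2r ?hsq_ge0// -real_normK ?num_real//.
  by rewrite ler_sqr ?nnegrE// ltW.
have h3 : 4 * (t ^+ 2 * hsq psi') <= e.
  rewrite /t sqr_sqrtr; last by rewrite ltW// divr_gt0.
  have -> : 4 * (e / (4 * (hsq psi' + 1)) * hsq psi') = e * (hsq psi' / (hsq psi' + 1)).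
    by field; have := hsq_ge0 psi'; lra.
  apply: ler_piMr; first exact: ltW.
  by rewrite ler_pdivrMr ?mul1r ?lerDl// ltr_wpDl// hsq_ge0.
move: h1 h2 h3; rewrite /hsq; lra.
Qed.

End source_condition.

(** * Laws and moments of the data *)

Section mixture.
Local Open Scope ereal_scope.
Context (d1 d2 : measure_display) (T1 : measurableType d1) (T2 : measurableType d2) (R : realType).
Context (m1 : subprobability T1 R) (kappa : T1 -> subprobability T2 R) (m2 : {measure set T2 -> \bar R}).
Hypothesis mk : forall A, measurable A -> measurable_fun setT (kappa ^~ A).
Hypothesis m2E : forall A, measurable A -> m2 A = \int[m1]_x kappa x A.

(** [m2] is the bind of [m1] and [kappa] in the Giry monad, whose integrals are iterated
    integrals. *)
Lemma integral_mixture (h : T2 -> \bar R) : measurable_fun setT h -> (forall y, 0 <= h y) ->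
  \int[m2]_y h y = \int[m1]_x \int[kappa x]_y h y.
Proof.
move=> mh h0.
have mk' : measurable_fun setT (kappa : T1 -> giry T2 R).
  by apply: measurable_giry_codensity.
have := @giry_int_bind _ _ _ _ _ (m1 : giry T1 R) _ mk' h mh h0; rewrite /giry_int => <-.
apply: eq_measure_integral => A mA _; rewrite m2E// /giry_bind /=.
by rewrite giry_int_map//; exact: measurable_giry_ev.
Qed.

Lemma measurable_mixture (h : T2 -> \bar R) : measurable_fun setT h -> (forall y, 0 <= h y) ->
  measurable_fun setT (fun x => \int[kappa x]_y h y).
Proof.
move=> mh h0.
have mk' : measurable_fun setT (kappa : T1 -> giry T2 R).
  by apply: measurable_giry_codensity.
exact: (measurableT_comp (measurable_giry_int mh h0) mk').
Qed.

End mixture.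

Section independence.
Local Open Scope ereal_scope.
Context (dO d1 d2 : measure_display) (Omega : measurableType dO)
  (T1 : measurableType d1) (T2 : measurableType d2) (R : realType).
Context (Pr : probability Omega R).
Context (X : Omega -> T1) (Y : Omega -> T2).
Hypothesis mX : measurable_fun setT X.
Hypothesis mY : measurable_fun setT Y.
Hypothesis XY : forall A B, measurable A -> measurable B ->
  Pr (X @^-1` A `&` Y @^-1` B) = Pr (X @^-1` A) * Pr (Y @^-1` B).

Let mXY : measurable_fun setT (fun w => (X w, Y w)).
Proof. exact/measurable_fun_pair. Qed.

Let lX : subprobability T1 R := giry_map mX (Pr : giry Omega R).
Let lY : subprobability T2 R := giry_map mY (Pr : giry Omega R).
Let lXY : subprobability (T1 * T2)%type R := giry_map mXY (Pr : giry Omega R).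

(** Independence on rectangles determines the law of the pair as the product of the two laws;
    Tonelli and Fubini then factor expectations. *)
Let joint_law (A : set (T1 * T2)) : measurable A -> (lX \x lY) A = lXY A.
Proof. by apply: product_measure_unique => A' B' mA mB; exact: XY. Qed.

Lemma indep_integral_ge0 (f : T1 -> \bar R) (h : T2 -> \bar R) :
  measurable_fun setT f -> measurable_fun setT h ->
  (forall x, 0 <= f x) -> (forall y, 0 <= h y) ->
  \int[Pr]_w (f (X w) * h (Y w)) = \int[Pr]_w f (X w) * \int[Pr]_w h (Y w).
Proof.
move=> mf mh f0 h0; pose F (p : T1 * T2) := f p.1 * h p.2.
have mF : measurable_fun setT F.
  by apply: emeasurable_funM; apply: measurableT_comp.
have F0 p : 0 <= F p by apply: mule_ge0.
transitivity (\int[lXY]_p F p).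
  by rewrite -[RHS]/(giry_int (giry_map mXY (Pr : giry Omega R)) F) giry_int_map.
rewrite (@eq_measure_integral _ _ _ _ (lX \x lY)); last by move=> A mA _; symmetry; exact: joint_law.
rewrite fubini_tonelli1// /fubini_F.
have -> : \int[Pr]_w h (Y w) = \int[lY]_y h y.
  by rewrite -[RHS]/(giry_int (giry_map mY (Pr : giry Omega R)) h) giry_int_map.
have -> : \int[Pr]_w f (X w) = \int[lX]_x f x.
  by rewrite -[RHS]/(giry_int (giry_map mX (Pr : giry Omega R)) f) giry_int_map.
under eq_integral do rewrite /F /= ge0_integralZl//.
by rewrite ge0_integralZr// integral_ge0.
Qed.

Lemma indep_integral (f : T1 -> R) (h : T2 -> R) :
  measurable_fun setT f -> measurable_fun setT h ->
  Pr.-integrable setT (fun w => (f (X w))%:E) -> Pr.-integrable setT (fun w => (h (Y w))%:E) ->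
  Pr.-integrable setT (fun w => (f (X w) * h (Y w))%:E) /\
  \int[Pr]_w (f (X w) * h (Y w))%:E = \int[Pr]_w (f (X w))%:E * \int[Pr]_w (h (Y w))%:E.
Proof.
move=> mf mh fi hi; pose F (p : T1 * T2) := (f p.1 * h p.2)%:E.
have mF : measurable_fun setT F.
  by apply/measurable_EFinP; apply: measurable_funM; apply: measurableT_comp.
have iF : Pr.-integrable setT (fun w => (f (X w) * h (Y w))%:E).
  apply/integrableP; split; first exact: (measurableT_comp mF mXY).
  under eq_integral do rewrite /= normrM EFinM.
  rewrite (indep_integral_ge0 (f := fun x => `|f x|%:E) (h := fun y => `|h y|%:E))//; first last.
  - by apply/measurable_EFinP; exact: measurableT_comp.
  - by apply/measurable_EFinP; exact: measurableT_comp.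
  - case/integrableP : fi => _ fi; case/integrableP : hi => _ hi.
    apply: lte_mul_pinfty; [exact: integral_ge0| |exact: hi].
    by rewrite ge0_fin_numE; [exact: fi|exact: integral_ge0].
split => //.
have pX (k : T1 -> R) : measurable_fun setT k -> Pr.-integrable setT (fun w => (k (X w))%:E) ->
    \int[lX]_x (k x)%:E = \int[Pr]_w (k (X w))%:E /\ lX.-integrable setT (fun x => (k x)%:E).
  move=> mk ik; split.
    by apply: (@integral_pushforward _ _ _ _ _ X mX Pr setT (EFin \o k)); [exact/measurable_EFinP|exact: ik|exact: measurableT].
  by apply: (@integrable_pushforward _ _ _ _ _ X mX Pr setT (EFin \o k)); [exact/measurable_EFinP|exact: ik|exact: measurableT].
have pY (k : T2 -> R) : measurable_fun setT k -> Pr.-integrable setT (fun w => (k (Y w))%:E) ->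
    \int[lY]_x (k x)%:E = \int[Pr]_w (k (Y w))%:E /\ lY.-integrable setT (fun x => (k x)%:E).
  move=> mk ik; split.
    by apply: (@integral_pushforward _ _ _ _ _ Y mY Pr setT (EFin \o k)); [exact/measurable_EFinP|exact: ik|exact: measurableT].
  by apply: (@integrable_pushforward _ _ _ _ _ Y mY Pr setT (EFin \o k)); [exact/measurable_EFinP|exact: ik|exact: measurableT].
have e1 : \int[Pr]_w (f (X w) * h (Y w))%:E = \int[lXY]_p F p.
  by apply/esym; apply: (@integral_pushforward _ _ _ _ _ _ mXY Pr setT F).
have [fE fi'] := pX f mf fi; have [hE hi'] := pY h mh hi.
rewrite e1 -fE -hE.
rewrite (@eq_measure_integral _ _ _ _ (lX \x lY)); last by move=> A mA _; symmetry; exact: joint_law.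
have iF' : (lX \x lY).-integrable setT F.
  apply/integrableP; split => //.
  rewrite (@eq_measure_integral _ _ _ _ lXY); last by move=> A mA _; exact: joint_law.
  by have /integrableP[] : lXY.-integrable setT F by apply: (@integrable_pushforward _ _ _ _ _ _ mXY Pr setT F).
rewrite -integral12_prod_meas1// /fubini_F.
under eq_integral do (rewrite /F /=; under eq_integral do rewrite EFinM; rewrite integralZl//).
have hfin : \int[lY]_y (h y)%:E \is a fin_num by exact: integrable_fin_num.
by rewrite -(fineK hfin) integralZr.
Qed.

End independence.

Section L1.
Context (dO : measure_display) (Omega : measurableType dO) (R : realType).
Context (Pr : probability Omega R).

Definition L1 (f : Omega -> R) := Pr.-integrable setT (EFin \o f).
Definition E (f : Omega -> R) : R := \int[Pr]_w f w.

Lemma L1_meas f : L1 f -> measurable_fun setT f.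
Proof. by move=> /integrableP[/measurable_EFinP]. Qed.

Lemma L1D f h : L1 f -> L1 h -> L1 (fun w => f w + h w).
Proof. by move=> lf lh; have := integrableD measurableT lf lh. Qed.

Lemma L1Z c f : L1 f -> L1 (fun w => c * f w).
Proof. by move=> lf; have := integrableZl measurableT c lf. Qed.

Lemma L1_cst c : L1 (fun=> c).
Proof. exact: finite_measure_integrable_cst. Qed.

Lemma E_D f h : L1 f -> L1 h -> E (fun w => f w + h w) = E f + E h.
Proof. by move=> lf lh; exact: RintegralD. Qed.

Lemma E_Z c f : L1 f -> E (fun w => c * f w) = c * E f.
Proof. by move=> lf; exact: RintegralZl. Qed.

Lemma E_cst c : E (fun=> c) = c.
Proof. by rewrite /E /Rintegral integral_cst//= probability_setT mule1. Qed.

Lemma L1_sum N (f : 'I_N -> Omega -> R) : (forall i, L1 (f i)) ->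
  L1 (fun w => \sum_i f i w) /\ E (fun w => \sum_i f i w) = \sum_i E (f i).
Proof.
elim: N f => [|N IH] f lf.
  have -> : (fun w => \sum_i f i w) = fun=> 0 by apply/funext => w; rewrite big_ord0.
  by rewrite E_cst big_ord0; split => //; exact: L1_cst.
have -> : (fun w => \sum_i f i w) =
    fun w => \sum_(i < N) f (widen_ord (leqnSn N) i) w + f ord_max w.
  by apply/funext => w; rewrite big_ord_recr.
have [l e] := IH (fun i => f (widen_ord (leqnSn N) i)) (fun i => lf _).
by split; [exact: L1D|rewrite E_D// e big_ord_recr].
Qed.

Lemma E_le f h : L1 f -> L1 h -> (forall w, f w <= h w) -> E f <= E h.
Proof. by move=> lf lh fh; apply: le_Rintegral. Qed.

Lemma L1_dom (f h : Omega -> R) : measurable_fun setT f -> (forall w, `|f w| <= h w) -> L1 h -> L1 f.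
Proof. exact: dominated_integrable_real. Qed.

Lemma E_of_integral (f : Omega -> R) c : measurable_fun setT f -> (forall w, 0 <= f w) ->
  (\int[Pr]_w (f w)%:E = c%:E)%E -> L1 f /\ E f = c.
Proof.
move=> mf f0 e; split; last by rewrite /E /Rintegral e.
apply/integrableP; split; first exact/measurable_EFinP.
under eq_integral do rewrite /= ger0_norm//.
by rewrite e ltry.
Qed.

Lemma E_le_of_integral (f : Omega -> R) c : measurable_fun setT f -> (forall w, 0 <= f w) ->
  (\int[Pr]_w (f w)%:E <= c%:E)%E -> L1 f /\ E f <= c.
Proof.
move=> mf f0 e.
have i0 : (0 <= \int[Pr]_w (f w)%:E)%E by apply: integral_ge0 => w _; rewrite lee_fin.
have fi : (\int[Pr]_w (f w)%:E)%E \is a fin_num.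
  by rewrite ge0_fin_numE//; apply: le_lt_trans e (ltry _).
have [l eq] := E_of_integral mf f0 (esym (fineK fi)).
by split => //; rewrite eq -lee_fin fineK.
Qed.

Lemma markov_bound (A : set Omega) (W : Omega -> R) c : measurable A -> 0 < c -> L1 W ->
  (forall w, 0 <= W w) -> (forall w, A w -> c <= W w) -> (Pr A <= (E W / c)%:E)%E.
Proof.
move=> mA c0 lW W0 AW.
have fA : Pr A \is a fin_num by exact: fin_num_measure.
have lA : L1 (fun w => c * \1_A w) by apply: L1Z; exact: integrable_indic.
have h : E (fun w => c * \1_A w) <= E W.
  apply: E_le => // w; rewrite indicE; case: (boolP (w \in A)) => [/set_mem/AW|_].
    by rewrite mulr1.
  by rewrite mulr0.
rewrite -(fineK fA) lee_fin ler_pdivlMr// mulrC; apply: le_trans h.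
rewrite E_Z; last exact: integrable_indic.
by rewrite /E /Rintegral integral_indic// setIT.
Qed.

(** In the expanded square only the [N] diagonal terms survive, each at most [c], against the factor
    [N ^- 2]. *)
Lemma uncorrelated_mean N (Y : nat -> Omega -> R) c : (0 < N)%N ->
  (forall n, L1 (fun w => Y n w ^+ 2)) -> (forall n, E (fun w => Y n w ^+ 2) <= c) ->
  (forall n m, n != m -> L1 (fun w => Y n w * Y m w) /\ E (fun w => Y n w * Y m w) = 0) ->
  L1 (fun w => (N%:R^-1 * \sum_(n < N) Y n w) ^+ 2) /\
  E (fun w => (N%:R^-1 * \sum_(n < N) Y n w) ^+ 2) <= c / N%:R.
Proof.
move=> N0 l2 e2 off.
have -> : (fun w => (N%:R^-1 * \sum_(n < N) Y n w) ^+ 2) =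
    fun w => N%:R^-1 ^+ 2 * \sum_(n < N) \sum_(m < N) Y n w * Y m w.
  by apply/funext => w; rewrite exprMn [(\sum_(n < N) _) ^+ 2]expr2 big_distrlr.
have lnm (n m : nat) : L1 (fun w => Y n w * Y m w).
  by have [->|/off[]//] := eqVneq n m; have := l2 m; congr L1; apply/funext => w; rewrite expr2.
have row (n : 'I_N) := L1_sum (fun m : 'I_N => lnm n m).
have [li ei] := L1_sum (fun n => (row n).1).
split; first exact: L1Z.
rewrite E_Z// ei.
have -> : \sum_(n < N) E (fun w => \sum_(m < N) Y n w * Y m w) = \sum_(n < N) E (fun w => Y n w ^+ 2).
  apply: eq_bigr => n _; rewrite (row n).2 (bigD1 n)//= big1 ?addr0.
    by congr E; apply/funext => w; rewrite expr2.
  by move=> m mn; have [] := off n m; rewrite // eq_sym.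
have h : \sum_(n < N) E (fun w => Y n w ^+ 2) <= N%:R * c.
  apply: le_trans (_ : _ <= \sum_(n < N) c) _; first by apply: ler_sum => n _; exact: e2.
  by rewrite sumr_const card_ord mulr_natl.
have N0' : 0 < N%:R :> R by rewrite ltr0n.
apply: le_trans (ler_wpM2l _ h) _; first by rewrite sqr_ge0.
by rewrite le_eqVlt; apply/orP; left; apply/eqP; field; rewrite gt_eqF.
Qed.

End L1.

Section data_laws.
Context (R : realType) (d : nat) (P : atlas 'rV[R]_d) (HP : is_manifold P).
Context (g : metric P) (Hg : is_riemannian g).
Context (dO : measure_display) (Omega : measurableType dO) (Pr : probability Omega R).
Context (mu : probability (mborel P) R) (Z : nat -> Omega -> P) (HZ : iid_with Pr mu Z).
Context (sigma : R) (nu : nat -> P -> probability (vborel 'rV[R]_d) R).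
Hypothesis Hnu : noise_kernel g sigma nu.
Context (noise : nat -> Omega -> 'rV[R]_d) (Hnoise : noise_with Pr nu Z noise).

Let gs z := metric_semi Hg z.

Definition zeta n (w : Omega) : tangent P := (Z n w, noise n w).

Lemma mZ n : @measurable_fun _ _ Omega (mborel P) setT (Z n).
Proof. by have [h _ _] := HZ. Qed.

Lemma mzeta n : @measurable_fun _ _ Omega (mborel (tangent P)) setT (zeta n).
Proof. by have [h _] := Hnoise; exact: h. Qed.

Lemma Z_indep n m (A B : set (mborel P)) : n != m -> measurable A -> measurable B ->
  (Pr (Z n @^-1` A `&` Z m @^-1` B) = Pr (Z n @^-1` A) * Pr (Z m @^-1` B))%E.
Proof.
move=> nm mA mB; have [_ _ ind] := HZ.
(* The product formula for finitely many indices becomes pairwise independence by taking the full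
   space at all other indices. *)
pose C i : set (mborel P) := if i == n then A else if i == m then B else setT.
have mC i : measurable (C i) by rewrite /C; case: ifP => // _; case: ifP.
have nN : (n < (maxn n m).+1)%N by rewrite ltnS leq_maxl.
have mN : (m < (maxn n m).+1)%N by rewrite ltnS leq_maxr.
have := ind (maxn n m).+1 C mC.
have -> : [set w | forall i, (i < (maxn n m).+1)%N -> C i (Z i w)] = Z n @^-1` A `&` Z m @^-1` B.
  apply/seteqP; split=> [w /= H|w /= [Aw Bw] i _].
    split; first by have := H n nN; rewrite /C eqxx.
    by have := H m mN; rewrite /C eqxx eq_sym (negbTE nm).
  by rewrite /C; case: eqP => [->//|_]; case: eqP => [->|].
move=> ->; rewrite (bigD1 (Ordinal nN))//= (bigD1 (Ordinal mN))/=; last first.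
  by apply: contra nm => /eqP[->].
rewrite big1 ?mule1; last first.
  move=> i /andP[i1 i2].
  have e1 : (nat_of_ord i == n) = false.
    by apply/negbTE; apply: contra i1 => /eqP e; apply/eqP/val_inj.
  have e2 : (nat_of_ord i == m) = false.
    by apply/negbTE; apply: contra i2 => /eqP e; apply/eqP/val_inj.
  by rewrite /C e1 e2 preimage_setT probability_setT.
by rewrite /C !eqxx [m == n]eq_sym (negbTE nm).
Qed.

Lemma integral_Z n (f : P -> \bar R) : @measurable_fun _ _ (mborel P) (\bar R) setT f ->
  (forall z, 0 <= f z)%E -> (\int[Pr]_w f (Z n w) = \int[mu]_z f z)%E.
Proof.
move=> mf f0.
rewrite -[LHS](@giry_int_map _ _ _ _ _ _ (mZ n) (Pr : giry Omega R))//.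
by apply: eq_measure_integral => A mA _; have [_ h _] := HZ; exact: h.
Qed.

(** The law of the noise at [z] carried to the tangent bundle, concentrated on the fiber over [z];
    the law of [zeta n] is a mixture of these. *)
Definition fiber_law n z : subprobability (mborel (tangent P)) R :=
  giry_map (tangent_fiber_measurable HP z) (nu n z : giry (vborel 'rV[R]_d) R).

Lemma fiber_lawE n z (A : set (mborel (tangent P))) : fiber_law n z A = nu n z [set e | A (z, e)].
Proof. by []. Qed.

Lemma fiber_law_measurable n (A : set (mborel (tangent P))) : measurable A ->
  @measurable_fun _ _ (mborel P) (\bar R) setT (fun z => fiber_law n z A).
Proof. by move=> mA; exact: (nk_measurable Hnu). Qed.

Lemma fiber_law_setT n z : (fiber_law n z setT = 1)%E.
Proof. by rewrite fiber_lawE; exact: probability_setT. Qed.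

Lemma zeta_joint n m (A B : set (mborel (tangent P))) : n != m -> measurable A -> measurable B ->
  (Pr (zeta n @^-1` A `&` zeta m @^-1` B) =
    \int[Pr]_w (fiber_law n (Z n w) A * fiber_law m (Z m w) B))%E.
Proof.
move=> nm mA mB; have [_ ind] := Hnoise.
pose C i : set (mborel (tangent P)) := if i == n then A else if i == m then B else setT.
have mC i : measurable (C i) by rewrite /C; case: ifP => // _; case: ifP.
have nN : (n < (maxn n m).+1)%N by rewrite ltnS leq_maxl.
have mN : (m < (maxn n m).+1)%N by rewrite ltnS leq_maxr.
have := ind (maxn n m).+1 C mC.
have -> : [set w | forall i, (i < (maxn n m).+1)%N -> C i (Z i w, noise i w)] = zeta n @^-1` A `&` zeta m @^-1` B.
  apply/seteqP; split=> [w /= H|w /= [Aw Bw] i _].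
    split; first by have := H n nN; rewrite /C eqxx.
    by have := H m mN; rewrite /C eqxx eq_sym (negbTE nm).
  by rewrite /C; case: eqP => [->//|_]; case: eqP => [->|].
move=> ->; apply: eq_integral => w _.
rewrite (bigD1 (Ordinal nN))//= (bigD1 (Ordinal mN))/=; last first.
  by apply: contra nm => /eqP[->].
rewrite big1 ?mule1; last first.
  move=> i /andP[i1 i2].
  have e1 : (nat_of_ord i == n) = false.
    by apply/negbTE; apply: contra i1 => /eqP e; apply/eqP/val_inj.
  have e2 : (nat_of_ord i == m) = false.
    by apply/negbTE; apply: contra i2 => /eqP e; apply/eqP/val_inj.
  rewrite /C e1 e2.
  exact: probability_setT.
by rewrite /C !eqxx [m == n]eq_sym (negbTE nm).
Qed.

Lemma zeta_law n (A : set (mborel (tangent P))) : measurable A ->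
  (Pr (zeta n @^-1` A) = \int[Pr]_w fiber_law n (Z n w) A)%E.
Proof.
(* A single law is the joint law with any other index whose event is the full space. *)
move=> mA; have nm : n != n.+1 by rewrite neq_ltn ltnSn.
have := zeta_joint nm mA (@measurableT _ (mborel (tangent P))).
rewrite preimage_setT setIT => ->; apply: eq_integral => w _.
by rewrite fiber_law_setT mule1.
Qed.

(** Given the design points the probability factors into a function of [Z n] and a function of
    [Z m], and these are independent. *)
Lemma zeta_indep n m (A B : set (mborel (tangent P))) : n != m -> measurable A -> measurable B ->
  (Pr (zeta n @^-1` A `&` zeta m @^-1` B) = Pr (zeta n @^-1` A) * Pr (zeta m @^-1` B))%E.
Proof.
move=> nm mA mB; rewrite zeta_joint// !zeta_law//.
apply: (indep_integral_ge0 (mZ n) (mZ m) _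
  (f := fun z => fiber_law n z A) (h := fun z => fiber_law m z B)) => //.
- by move=> A' B' mA' mB'; exact: Z_indep.
- exact: fiber_law_measurable.
- exact: fiber_law_measurable.
Qed.

Lemma integral_zeta n (f : tangent P -> \bar R) :
  @measurable_fun _ _ (mborel (tangent P)) (\bar R) setT f -> (forall p, 0 <= f p)%E ->
  (\int[Pr]_w f (zeta n w) = \int[mu]_z \int[nu n z]_e f (z, e))%E.
Proof.
move=> mf f0.
rewrite -[LHS](@giry_int_map _ _ _ _ _ _ (mzeta n) (Pr : giry Omega R))//.
have mk A : measurable A -> measurable_fun setT (fun w => fiber_law n (Z n w) A).
  by move=> mA; exact: (measurableT_comp (fiber_law_measurable n mA) (mZ n)).
rewrite /giry_int (@integral_mixture _ _ Omega (mborel (tangent P)) R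
  (Pr : subprobability Omega R) (fun w => fiber_law n (Z n w)) _ mk _ f mf f0); last first.
  by move=> A mA; exact: zeta_law.
rewrite (integral_Z n (f := fun z => \int[fiber_law n z]_p f p)%E); last first.
- by move=> z; apply: integral_ge0.
- by apply: measurable_mixture => // A mA; exact: fiber_law_measurable.
apply: eq_integral => z _.
exact: (@giry_int_map _ _ _ _ _ _ (tangent_fiber_measurable HP z) (nu n z : giry (vborel 'rV[R]_d) R)).
Qed.

Definition gram z : 'M[R]_d := \matrix_(i, j) g z (delta_mx 0 i) (delta_mx 0 j).

Lemma gram_row z (v : 'rV[R]_d) j : (v *m gram z) 0 j = g z v (delta_mx 0 j).
Proof.
rewrite mxE [in RHS](row_sum_delta v) (ip_suml (gs z)); apply: eq_bigr => i _.
by rewrite mxE (ipZl (gs z)).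
Qed.

Lemma gram_dot z (u v : 'rV[R]_d) : (u *m gram z *m v^T) 0 0 = g z u v.
Proof.
rewrite mxE [in RHS](row_sum_delta v) (ip_sumr (gs z)); apply: eq_bigr => j _.
by rewrite gram_row mxE (ipZr (gs z)) mulrC.
Qed.

Lemma gram_unit z : gram z \in unitmx.
Proof.
rewrite unitmxE unitfE; apply/negP => /det0P [v v0 vG].
by have := rm_pos Hg z v0; rewrite -gram_dot vG mul0mx mxE ltxx.
Qed.

(** With the Gram matrix inverted, the squared norm becomes a combination of products g(u, e) g(v,
    e), the quantities whose means [nk_variance] prescribes. Their expectation is sigma^2 times the
    trace of the identity. *)
Lemma metric_expand z (e : 'rV[R]_d) : g z e e =
  \sum_i \sum_j invmx (gram z) i j * (g z (delta_mx 0 i) e * g z (delta_mx 0 j) e).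
Proof.
have sym : (gram z)^T = gram z by apply/matrixP => i j; rewrite !mxE (si_sym (gs z)).
have -> : g z e e = ((e *m gram z) *m invmx (gram z) *m (e *m gram z)^T) 0 0.
  by rewrite trmx_mul sym mulmxK ?gram_unit// mulmxA gram_dot.
rewrite mxE exchange_big /=; apply: eq_bigr => j _; rewrite mxE mulr_suml; apply: eq_bigr => i _.
rewrite gram_row mxE gram_row !(si_sym (gs z) e); ring.
Qed.

Lemma noise_sq n z : (\int[nu n z]_e (g z e e)%:E = (sigma ^+ 2 * d%:R)%:E)%E.
Proof.
pose F i j (e : vborel 'rV[R]_d) : R := invmx (gram z) i j * (g z (delta_mx 0 i) e * g z (delta_mx 0 j) e).
have lF (i j : 'I_d) : L1 (nu n z) (F i j).
  by apply: L1Z; have [] := nk_variance Hnu n z (delta_mx 0 i) (delta_mx 0 j).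
have eF (i j : 'I_d) : E (nu n z) (F i j) = invmx (gram z) i j * (sigma ^+ 2 * gram z j i).
  have [li ei] := nk_variance Hnu n z (delta_mx 0 i) (delta_mx 0 j).
  by rewrite E_Z// mxE (si_sym (gs z)) /E /Rintegral ei.
have row (i : 'I_d) := L1_sum (lF i).
have [ls es] := L1_sum (fun i => (row i).1).
have -> : (fun e : vborel 'rV[R]_d => (g z e e)%:E) = EFin \o (fun e => \sum_i \sum_j F i j e).
  by apply/funext => e; rewrite /= metric_expand.
transitivity (E (nu n z) (fun e => \sum_i \sum_j F i j e))%:E.
  by rewrite /E /Rintegral fineK//; exact: integrable_fin_num.
rewrite es; congr (_%:E).
have -> : \sum_i E (nu n z) (fun w => \sum_i0 F i i0 w) =
   sigma ^+ 2 * \tr (invmx (gram z) *m gram z).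
  rewrite /mxtrace mulr_sumr; apply: eq_bigr => i _; rewrite (row i).2 mxE mulr_sumr.
  by apply: eq_bigr => j _; rewrite eF; ring.
by rewrite mulVmx ?gram_unit// mxtrace1.
Qed.

End data_laws.

Section data_moments.
Context (R : realType) (d : nat) (P : atlas 'rV[R]_d) (HP : is_manifold P).
Context (br : (P -> R) -> (P -> R) -> (P -> R)) (B : P -> 'M[R]_d).
Hypothesis HB : is_poisson_tensor br B.
Context (g : metric P) (Hg : is_riemannian g).
Context (K : P -> P -> R).
Hypothesis HKC : Ckfun 3 (fun xy : mprod P P => K xy.1 xy.2).
Context (HK : rkhs K).
Context (dO : measure_display) (Omega : measurableType dO) (Pr : probability Omega R).
Context (mu : probability (mborel P) R) (Z : nat -> Omega -> P) (HZ : iid_with Pr mu Z).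
Hypothesis HA : A_welldefined g B HK mu.
Context (sigma : R) (nu : nat -> P -> probability (vborel 'rV[R]_d) R).
Hypothesis Hnu : noise_kernel g sigma nu.
Context (noise : nat -> Omega -> 'rV[R]_d) (Hnoise : noise_with Pr nu Z noise).

Let gs z := metric_semi Hg z.
Let mZ' n : @measurable_fun _ _ Omega (mborel P) setT (Z n) := mZ HZ n.
Let mzeta' n : @measurable_fun _ _ Omega (mborel (tangent P)) setT (zeta Z noise n) := mzeta Hnoise n.

Lemma L1_Z n (f : P -> R) : @measurable_fun _ _ (mborel P) R setT f ->
  (forall z, 0 <= f z) -> mu.-integrable setT (EFin \o f) ->
  L1 Pr (fun w => f (Z n w)) /\ E Pr (fun w => f (Z n w)) = \int[mu]_z f z.
Proof.
move=> mf f0 fi; apply: E_of_integral => //.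
  exact: (measurableT_comp mf (mZ' n)).
rewrite (integral_Z HZ n (f := EFin \o f)).
- by rewrite /Rintegral fineK//; exact: integrable_fin_num.
- exact/measurable_EFinP.
- by move=> z; rewrite lee_fin.
Qed.

Lemma noise_sq_moment n (A : set (mborel P)) : measurable A ->
  L1 Pr (fun w => \1_A (Z n w) * g (Z n w) (noise n w) (noise n w)) /\
  E Pr (fun w => \1_A (Z n w) * g (Z n w) (noise n w) (noise n w))
    = sigma ^+ 2 * d%:R * \int[mu]_z \1_A z.
Proof.
move=> mA; pose phi (p : tangent P) : R := \1_A p.1 * g p.1 p.2 p.2.
have mphi : @measurable_fun _ _ (mborel (tangent P)) R setT phi.
  apply: measurable_funM; last exact: (tangent_sq_measurable HP Hg).
  apply: (measurableT_comp (f := \1_A : mborel P -> R)); first exact: measurable_indic.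
  exact: (tangent_fst_measurable HP).
have phi0 p : 0 <= phi p by rewrite mulr_ge0// ?(si_ge0 (gs _))// indicE.
apply: E_of_integral => //.
- exact: (measurableT_comp mphi (mzeta' n)).
- by move=> w; exact: (phi0 (zeta Z noise n w)).
rewrite -[LHS]/(\int[Pr]_w (EFin \o phi) (zeta Z noise n w))%E.
rewrite (integral_zeta HP HZ Hnu Hnoise n (f := EFin \o phi)); first last.
- by move=> p; rewrite lee_fin.
- exact/measurable_EFinP.
have e z : (\int[nu n z]_e (EFin \o phi) (z, e) = (sigma ^+ 2 * d%:R * \1_A z)%:E)%E.
  have [l0 e0] := E_of_integral (Pr := nu n z) (f := fun e => g z e e)
    (measurableT_comp (tangent_sq_measurable HP Hg) (tangent_fiber_measurable HP z))
    (fun e => si_ge0 (gs z) e) (noise_sq Hg Hnu n z).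
  transitivity (E (nu n z) (fun e => \1_A z * g z e e))%:E.
    by rewrite /E /Rintegral fineK//; apply: integrable_fin_num => //; exact: L1Z.
  by rewrite E_Z// e0 mulrC.
rewrite (eq_integral (fun z => (sigma ^+ 2 * d%:R * \1_A z)%:E)); last by move=> z _; rewrite e.
have lA : L1 mu (\1_A : mborel P -> R) by exact: integrable_indic.
have := E_Z (sigma ^+ 2 * d%:R) lA; rewrite /E /Rintegral => <-; rewrite fineK//.
by apply: integrable_fin_num => //; exact: L1Z.
Qed.

Lemma noise_ham_sq n (A : set (mborel P)) (f : hsp HK) : measurable A ->
  L1 Pr (fun w => (\1_A (Z n w) * g (Z n w) (noise n w) (Xham B f (Z n w))) ^+ 2) /\
  E Pr (fun w => (\1_A (Z n w) * g (Z n w) (noise n w) (Xham B f (Z n w))) ^+ 2)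
    <= sigma ^+ 2 * L2dot B g mu f f.
Proof.
move=> mA; pose phi (p : tangent P) : R := (\1_A p.1 * g p.1 p.2 (Xham B f p.1)) ^+ 2.
have mphi : @measurable_fun _ _ (mborel (tangent P)) R setT phi.
  apply: measurable_funX; apply: measurable_funM.
    apply: (measurableT_comp (f := \1_A : mborel P -> R)); first exact: measurable_indic.
    exact: (tangent_fst_measurable HP).
  exact: (tangent_pair_measurable HP HB Hg HKC).
have phi0 p : 0 <= phi p by exact: sqr_ge0.
apply: E_le_of_integral => //.
- exact: (measurableT_comp mphi (mzeta' n)).
- by move=> w; exact: (phi0 (zeta Z noise n w)).
rewrite -[leLHS]/(\int[Pr]_w (EFin \o phi) (zeta Z noise n w))%E.
rewrite (integral_zeta HP HZ Hnu Hnoise n (f := EFin \o phi)); first last.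
- by move=> p; rewrite lee_fin.
- exact/measurable_EFinP.
have e z : (\int[nu n z]_e (EFin \o phi) (z, e) =
    ((\1_A z) ^+ 2 * sigma ^+ 2 * g z (Xham B f z) (Xham B f z))%:E)%E.
  have [l0 e0] := nk_variance Hnu n z (Xham B f z) (Xham B f z).
  transitivity (E (nu n z) (fun e => (\1_A z) ^+ 2 * (g z (Xham B f z) e * g z (Xham B f z) e)))%:E.
    rewrite /E /Rintegral fineK; last by apply: integrable_fin_num => //; exact: L1Z.
    by apply: eq_integral => x _; rewrite /phi /= exprMn (si_sym (gs z) x) expr2.
  by rewrite E_Z// /E /Rintegral e0 mulrA.
have lf := ham_sq_integrable HP HB Hg HKC HA f.
have lf' := L1Z (sigma ^+ 2) lf.
apply: (@le_trans _ _ (\int[mu]_z (sigma ^+ 2 * g z (Xham B f z) (Xham B f z))%:E)%E).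
  apply: ge0_le_integral => //.
  - move=> z _; rewrite e lee_fin; apply: mulr_ge0; last exact: (si_ge0 (gs z)).
    by apply: mulr_ge0; exact: sqr_ge0.
  - apply: (eq_measurable_fun (fun z => ((\1_A z) ^+ 2 * sigma ^+ 2 * g z (Xham B f z) (Xham B f z))%:E)).
      by move=> z _; rewrite e.
    apply/measurable_EFinP; apply: measurable_funM; last exact: (ham_pair_measurable HP HB Hg HKC).
    by apply: measurable_funM => //; apply: measurable_funX; exact: measurable_indic.
  - by apply/measurable_EFinP; exact: (L1_meas lf').
  - move=> z _; rewrite e lee_fin -mulrA mulrA indicE; case: (z \in A) => /=.
      by rewrite expr1n mul1r.
    rewrite expr0n /= !mul0r; apply: mulr_ge0; last exact: (si_ge0 (gs z)).
    exact: sqr_ge0.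
have := E_Z (sigma ^+ 2) lf; rewrite /E => <-.
by rewrite /Rintegral fineK//; exact: integrable_fin_num.
Qed.

(** Disintegration over the fibers is available for nonnegative functions, so positive and negative
    parts are treated separately; mean zero noise gives them equal integrals in every fiber. *)
Lemma noise_ham_mean n (A : set (mborel P)) (f : hsp HK) : measurable A ->
  L1 Pr (fun w => \1_A (Z n w) * g (Z n w) (noise n w) (Xham B f (Z n w))) /\
  E Pr (fun w => \1_A (Z n w) * g (Z n w) (noise n w) (Xham B f (Z n w))) = 0.
Proof.
move=> mA; pose phi (p : tangent P) : R := \1_A p.1 * g p.1 p.2 (Xham B f p.1).
have mphi : @measurable_fun _ _ (mborel (tangent P)) R setT phi.
  apply: measurable_funM.
    apply: (measurableT_comp (f := \1_A : mborel P -> R)); first exact: measurable_indic.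
    exact: (tangent_fst_measurable HP).
  exact: (tangent_pair_measurable HP HB Hg HKC).
have mphiZ : measurable_fun setT (fun w => phi (zeta Z noise n w)) := measurableT_comp mphi (mzeta' n).
have l1 : L1 Pr (fun w => phi (zeta Z noise n w)).
  have [l2 _] := noise_ham_sq n f mA.
  (* Integrability follows from the second moment through |t| <= 1 + t^2. *)
  apply: (L1_dom (h := fun w => 1 + (phi (zeta Z noise n w)) ^+ 2)) => //.
    move=> w; set t := phi _; have := sqr_ge0 (`|t| - 1); rewrite -[t ^+ 2]real_normK ?num_real//.
    by have := normr_ge0 t; nra.
  by apply: L1D; [exact: L1_cst|exact: l2].
split => //; rewrite -[LHS]/(E Pr (fun w => phi (zeta Z noise n w))) /E /Rintegral integralE.
have mE : @measurable_fun _ _ (mborel (tangent P)) (\bar R) setT (EFin \o phi) by exact/measurable_EFinP.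
have ep : (\int[Pr]_w (fun w => (phi (zeta Z noise n w))%:E)^\+ w =
   \int[mu]_z \int[nu n z]_e ((EFin \o phi)^\+ (z, e)))%E.
  rewrite (funepos_comp (EFin \o phi) (zeta Z noise n)).
  exact: (integral_zeta HP HZ Hnu Hnoise n (measurable_funepos mE) (fun p => funepos_ge0 _ p)).
have en : (\int[Pr]_w (fun w => (phi (zeta Z noise n w))%:E)^\- w =
   \int[mu]_z \int[nu n z]_e ((EFin \o phi)^\- (z, e)))%E.
  rewrite (funeneg_comp (EFin \o phi) (zeta Z noise n)).
  exact: (integral_zeta HP HZ Hnu Hnoise n (measurable_funeneg mE) (fun p => funeneg_ge0 _ p)).
have fp : (\int[Pr]_w (fun w => (phi (zeta Z noise n w))%:E)^\+ w)%E \is a fin_num.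
  exact: (integrable_pos_fin_num measurableT l1).
suff ee : (\int[Pr]_w (fun w => (phi (zeta Z noise n w))%:E)^\+ w =
   \int[Pr]_w (fun w => (phi (zeta Z noise n w))%:E)^\- w)%E.
  by rewrite -ee subee.
rewrite ep en; apply: eq_integral => z _.
have [l0 e0] := nk_mean Hnu n z (Xham B f z).
have lz : L1 (nu n z) (fun e => phi (z, e)).
  have := L1Z (\1_A z) l0; congr L1; apply/funext => e.
  by rewrite /phi /= (si_sym (gs z) e).
have Ez : (\int[nu n z]_e (phi (z, e))%:E = 0)%E.
  transitivity (E (nu n z) (fun e => \1_A z * g z (Xham B f z) e))%:E.
    rewrite /E /Rintegral fineK; last by apply: integrable_fin_num => //; exact: L1Z.
    by apply: eq_integral => x _; rewrite /phi /= (si_sym (gs z) x).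
  by rewrite E_Z// /E /Rintegral e0 /= mulr0.
move: Ez; rewrite integralE => /eqP.
rewrite sube_eq ?add0e; last 2 first.
- exact: (integrable_pos_fin_num measurableT lz).
- by rewrite fin_num_adde_defr//; exact: (integrable_neg_fin_num measurableT lz).
rewrite (funepos_comp (EFin \o phi) (fun e => (z, e))).
by rewrite (funeneg_comp (EFin \o phi) (fun e => (z, e))) => /eqP.
Qed.

Lemma noise_ham_cross n m (A : set (mborel P)) (f : hsp HK) : measurable A -> n != m ->
  L1 Pr (fun w => (\1_A (Z n w) * g (Z n w) (noise n w) (Xham B f (Z n w))) *
                  (\1_A (Z m w) * g (Z m w) (noise m w) (Xham B f (Z m w)))) /\
  E Pr (fun w => (\1_A (Z n w) * g (Z n w) (noise n w) (Xham B f (Z n w))) *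
                 (\1_A (Z m w) * g (Z m w) (noise m w) (Xham B f (Z m w)))) = 0.
Proof.
move=> mA nm; pose phi (p : mborel (tangent P)) : R := \1_A p.1 * g p.1 p.2 (Xham B f p.1).
have mphi : measurable_fun setT phi.
  apply: measurable_funM.
    apply: (measurableT_comp (f := \1_A : mborel P -> R)); first exact: measurable_indic.
    exact: (tangent_fst_measurable HP).
  exact: (tangent_pair_measurable HP HB Hg HKC).
have [l1 e1] := noise_ham_mean n f mA; have [l2 e2] := noise_ham_mean m f mA.
have [l e] := indep_integral (mzeta' n) (mzeta' m)
  (fun A B mA mB => zeta_indep HP HZ Hnu Hnoise nm mA mB) mphi mphi l1 l2.
split; first exact: l.
rewrite /E /Rintegral e fineM; [|exact: (integrable_fin_num measurableT l1)|exact: (integrable_fin_num measurableT l2)].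
by rewrite -[X in X * _]/(E Pr _) e1 mul0r.
Qed.

Lemma bounded_Z n (f : P -> R) c : @measurable_fun _ _ (mborel P) R setT f ->
  (forall z, `|f z| <= c) -> L1 Pr (fun w => f (Z n w)) /\
  E Pr (fun w => f (Z n w)) = \int[mu]_z f z.
Proof.
move=> mf fc.
(* Adding [c] makes the function nonnegative, so that [L1_Z] applies. *)
have mfc : @measurable_fun _ _ (mborel P) R setT (fun z => f z + c) by apply: measurable_funD.
have c0 z : 0 <= f z + c by have := fc z; rewrite ler_norml => /andP[]; lra.
have lf : L1 mu (f : mborel P -> R) by apply: (L1_dom (h := fun=> c)) => //; exact: L1_cst.
have lfc : L1 mu ((fun z => f z + c) : mborel P -> R) by apply: L1D => //; exact: L1_cst.
have [l e] := L1_Z n mfc c0 lfc.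
have l1 : L1 Pr (fun w => f (Z n w)).
  have := L1D l (L1_cst Pr (- c)); congr L1; apply/funext => w; lra.
split => //.
have := E_D l1 (L1_cst Pr c); rewrite e E_cst.
have := E_D lf (L1_cst mu c); rewrite E_cst /E => -> h.
by apply: (addIr c).
Qed.

Lemma bounded_Z_centered (f : P -> R) c : @measurable_fun _ _ (mborel P) R setT f ->
  (forall z, `|f z| <= c) -> let q := \int[mu]_z f z in
  [/\ forall n, L1 Pr (fun w => (f (Z n w) - q) ^+ 2),
      forall n, E Pr (fun w => (f (Z n w) - q) ^+ 2) <= (2 * c) ^+ 2 &
      forall n m, n != m -> L1 Pr (fun w => (f (Z n w) - q) * (f (Z m w) - q)) /\
        E Pr (fun w => (f (Z n w) - q) * (f (Z m w) - q)) = 0].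
Proof.
move=> mf fc q.
have lf : L1 mu (f : mborel P -> R) by apply: (L1_dom (h := fun=> c)) => //; exact: L1_cst.
have qc : `|q| <= c.
  have h1 : E mu (fun=> - c) <= E mu f.
    by apply: E_le => [||z]; [exact: L1_cst|exact: lf|have := fc z; rewrite ler_norml => /andP[]].
  have h2 : E mu f <= E mu (fun=> c).
    by apply: E_le => [||z]; [exact: lf|exact: L1_cst|have := fc z; rewrite ler_norml => /andP[]].
  by rewrite !E_cst in h1 h2; rewrite ler_norml h1.
have mfq : @measurable_fun _ _ (mborel P) R setT (fun z => f z - q) by apply: measurable_funB.
have fq z : `|f z - q| <= 2 * c by have := fc z; move: qc; rewrite !ler_norml => /andP[? ?] /andP[? ?]; lra.
have f2 z : `|(f z - q) ^+ 2| <= (2 * c) ^+ 2.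
  rewrite normrX ler_sqr ?nnegrE//; apply: le_trans (fq z); exact: normr_ge0.
have mf2 : @measurable_fun _ _ (mborel P) R setT (fun z => (f z - q) ^+ 2) by exact: measurable_funX.
have l2 n := bounded_Z n mf2 f2.
split=> [n|n|n m nm]; first by have [] := l2 n.
  rewrite -[leRHS](E_cst Pr); apply: E_le; [by have [] := l2 n|exact: L1_cst|move=> w].
  by apply: le_trans (f2 (Z n w)); exact: ler_norm.
have [l1 e1] := bounded_Z n mfq fq; have [l1' e1'] := bounded_Z m mfq fq.
have [l e] := indep_integral (mZ' n) (mZ' m)
  (fun A B mA mB => Z_indep HZ nm mA mB) mfq mfq l1 l1'.
split; first exact: l.
rewrite /E /Rintegral e fineM; [|exact: (integrable_fin_num measurableT l1)|exact: (integrable_fin_num measurableT l1')].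
rewrite -[X in X * _]/(E Pr _) e1.
have -> : \int[mu]_z (f z - q) = 0.
  have := E_D lf (L1_cst mu (- q)); rewrite E_cst /E => ->.
  by rewrite -/q subrr.
by rewrite mul0r.
Qed.

End data_moments.

(** * Energy estimate *)

Section empirical_risk.
Context (R : realType) (d : nat) (P : atlas 'rV[R]_d) (HP : is_manifold P).
Context (B : P -> 'M[R]_d).
Context (g : metric P) (Hg : is_riemannian g).
Context (K : P -> P -> R).
Hypothesis HKC : Ckfun 3 (fun xy : mprod P P => K xy.1 xy.2).
Context (HK : rkhs K).
Context (N : nat) (N0 : (0 < N)%N) (z : nat -> P).
Implicit Types (f h u v : hsp HK).

Let hs := hdot_semi HK.
Let gs z := metric_semi Hg z.

(** The form lives on arbitrary sequences of vectors, so that noise and restrictions to good or bad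
    points can be paired with Hamiltonian fields. *)
Definition empdot (a b : nat -> 'rV[R]_d) : R :=
  N%:R^-1 * \sum_(n < N) g (z n) (a n) (b n).

Lemma empdot_semi : semi_inner empdot.
Proof.
split=> [a b|c a a' b|a]; rewrite /empdot.
- by congr (_ * _); apply: eq_bigr => n _; exact: (si_sym (gs _)).
- rewrite mulrCA -mulrDr; congr (_ * _); rewrite mulr_sumr -big_split /=.
  by apply: eq_bigr => n _; exact: (si_lin (gs _)).
- by rewrite mulr_ge0 ?invr_ge0// sumr_ge0// => n _; exact: (si_ge0 (gs _)).
Qed.

Definition Aemp f : nat -> 'rV[R]_d := fun n => Xham B f (z n).

Lemma Aemp_lin a f h : Aemp (a *: f + h) = a *: Aemp f + Aemp h.
Proof. by apply/funext => n; rewrite /Aemp (Xham_lin HP B HKC). Qed.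

Lemma AempB f h : Aemp (f - h) = Aemp f - Aemp h.
Proof. by apply/funext => n; rewrite /Aemp (XhamB HP B HKC). Qed.

Lemma AempZ a f : Aemp (a *: f) = a *: Aemp f.
Proof. by apply/funext => n; rewrite /Aemp (XhamZ HP B HKC). Qed.

Lemma Aemp_sum n (F : 'I_n -> hsp HK) : Aemp (\sum_i F i) = \sum_i Aemp (F i).
Proof. by apply/funext => m; rewrite /Aemp (Xham_sum HP B HKC) fct_sumE. Qed.

Let es := empdot_semi.

Context (x : nat -> 'rV[R]_d) (lambda : R) (l0 : 0 < lambda).

Lemma emp_riskE f : emp_risk g B HK N z x lambda f =
  empdot (Aemp f - x) (Aemp f - x) + lambda * hsq f.
Proof. by rewrite /emp_risk hnorm_sq. Qed.

Definition sqform v := empdot (Aemp v) (Aemp v) + lambda * hsq v.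

Lemma emp_risk_expand h v t :
  emp_risk g B HK N z x lambda (h + t *: v) = emp_risk g B HK N z x lambda h
   + 2 * t * (empdot (Aemp h - x) (Aemp v) + lambda * hdot h v) + t ^+ 2 * sqform v.
Proof.
rewrite -/(hfun (h + t *: v)) !emp_riskE /sqform.
have -> : Aemp (h + t *: v) - x = (Aemp h - x) + t *: Aemp v.
  by rewrite [h + _]addrC Aemp_lin -addrA addrC.
rewrite (ip_sqrD es) /hsq (ip_sqrD hs) !(ipZr es) !(ipZl es) !(ipZr hs) !(ipZl hs); ring.
Qed.

Context (hh : hsp HK) (hmin : is_minimizer HK (emp_risk g B HK N z x lambda) hh).

Lemma euler_lagrange v : empdot (Aemp hh - x) (Aemp v) + lambda * hdot hh v = 0.
Proof.
have [_ H] := hmin.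
have H' t : 0 <= 2 * t * (empdot (Aemp hh - x) (Aemp v) + lambda * hdot hh v) + t ^+ 2 * sqform v.
  by have := H _ (hsp_in (hh + t *: v)); rewrite emp_risk_expand; lra.
set L := empdot _ _ + _ in H' *.
have s0 : 0 <= sqform v.
  by rewrite addr_ge0 ?(si_ge0 es)// mulr_ge0 ?(ltW l0)// hsq_ge0.
(* Nearly the minimizer of the quadratic in [t]; the [+ 1] avoids dividing by a vanishing
   [sqform v]. *)
have h := H' (- L / (sqform v + 1)).
have e : 2 * (- L / (sqform v + 1)) * L + (- L / (sqform v + 1)) ^+ 2 * sqform v
   = - (L ^+ 2) * ((sqform v + 2) / (sqform v + 1) ^+ 2).
  by field; rewrite gt_eqF// ltr_wpDl.
rewrite e in h.
have p : 0 < (sqform v + 2) / (sqform v + 1) ^+ 2.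
  by rewrite divr_gt0 ?exprn_gt0 ?ltr_wpDl.
apply/eqP; rewrite -sqrf_eq0 eq_le sqr_ge0 andbT.
by move: h; rewrite pmulr_lge0// oppr_ge0.
Qed.

(** The risk is quadratic and its linear part vanishes at the minimizer. As [sqform] dominates
    [lambda * hsq], the excess risk controls the distance to the minimizer. *)
Lemma emp_risk_gap f : emp_risk g B HK N z x lambda f =
  emp_risk g B HK N z x lambda hh + sqform (f - hh).
Proof.
have := emp_risk_expand hh (f - hh) 1; rewrite scale1r addrC subrK => ->.
by rewrite euler_lagrange mulr0 addr0 expr1n mul1r.
Qed.

End empirical_risk.

(** Here [U] is |X_u|_N^2 and [s] is |u|^2; [x1], [x2], [x3] are the pieces of the noise term and
    [y1] to [y6] those of <H, u>. Two quarters of [U] and seven sixteenths of [lambda * s] are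
    absorbed, leaving at least [lambda / 2 * s]. *)
Lemma energy_arith (R : realType) (U lambda tau M s x1 x2 x3 y1 y2 y3 y4 y5 y6 a1 a2 a3 a4 a5 a6 a7 a8 : R) :
  0 < lambda -> 0 <= U -> 0 <= s -> 0 <= a8 ->
  U - (x1 + (x2 + x3)) + (lambda * s + lambda * (y1 + y2 + (y4 - y5 - y6 + y3))) = 0 ->
  `|x1| <= a1 + U / 4 -> `|x3| <= tau * a2 + tau * s ->
  `|x2| <= lambda / 16 * s + 4 / lambda * a3 ->
  `|y1| <= 4 * a4 + s / 16 -> `|y2| <= 4 * a5 + s / 16 ->
  `|y3| <= 4 * (M + 1) * a6 + s / 16 -> `|y6| <= 1 / 16 * s + 4 / 1 * a7 ->
  lambda * `|y4| <= lambda ^+ 2 * a8 + U / 4 -> `|y5| <= tau * a8 + tau * s ->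
  tau <= lambda / 16 -> tau <= 1 / 16 ->
  lambda / 2 * s <= a1 + tau * a2 + 4 / lambda * a3 + 4 * lambda * a4 + 4 * lambda * a5
    + 4 * lambda * (M + 1) * a6 + 4 * lambda * a7 + (lambda ^+ 2 + lambda * tau) * a8.
Proof.
move=> l0 U0 s0 a80 EL; rewrite !ler_norml.
move=> /andP[_ T1a] /andP[_ T1b] /andP[_ T1c] /andP[T2 _] /andP[T3 _] /andP[T4 _] /andP[_ T5] T6 /andP[_ T7] t1 t2.
have T2' : - (lambda * y1) <= lambda * (4 * a4 + s / 16) by rewrite -mulrN ler_pM2l//; lra.
have T3' : - (lambda * y2) <= lambda * (4 * a5 + s / 16) by rewrite -mulrN ler_pM2l//; lra.
have T4' : - (lambda * y3) <= lambda * (4 * (M + 1) * a6 + s / 16) by rewrite -mulrN ler_pM2l//; lra.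
have T5' : lambda * y6 <= lambda * (1 / 16 * s + 4 / 1 * a7) by rewrite ler_pM2l.
have T6' : - (lambda * y4) <= lambda ^+ 2 * a8 + U / 4.
  by apply: le_trans T6; rewrite -mulrN ler_pM2l// -normrN ler_norm.
have T7' : lambda * y5 <= lambda * (tau * a8 + tau * s) by rewrite ler_pM2l.
have ts : tau * s <= lambda / 16 * s by rewrite ler_wpM2r.
have lts : lambda * (tau * s) <= lambda * (1 / 16 * s) by rewrite ler_pM2l// ler_wpM2r.
have ls : 0 <= lambda * s by rewrite mulr_ge0// ltW.
move: T1c; set q3 := 4 / lambda * a3 => T1c.
lra.
Qed.

Section energy.
Context (R : realType) (d : nat) (P : atlas 'rV[R]_d) (HP : is_manifold P).
Context (br : (P -> R) -> (P -> R) -> (P -> R)) (B : P -> 'M[R]_d).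
Hypothesis HB : is_poisson_tensor br B.
Context (g : metric P) (Hg : is_riemannian g).
Context (K : P -> P -> R).
Hypothesis HKC : Ckfun 3 (fun xy : mprod P P => K xy.1 xy.2).
Context (HK : rkhs K).
Context (mu : probability (mborel P) R).
Hypothesis HA : A_welldefined g B HK mu.
Context (M : R) (M0 : 0 <= M).
Hypothesis QM : forall f, hset HK f ->
  hset HK (Qop g B K mu f) /\ hnorm HK (Qop g B K mu f) <= M * hnorm HK f.
Context (N : nat) (N0 : (0 < N)%N).
Context (lambda tau : R) (l0 : 0 < lambda) (t0 : 0 < tau).
Context (k : nat) (eta H : hsp HK).

Let hs := hdot_semi HK.
Let gs z := metric_semi Hg z.
Let G := good HP B g HKC HK tau k.
Let ej j := onb HP HKC HK j.

Let mG : measurable (G : set (mborel P)).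
Proof. exact: (good_measurable HP HB Hg). Qed.

Definition good_ham_dot j z : R := \1_G z * g z (Xham B (ej j) z) (Xham B eta z).
Definition good_ham_mean j : R := \int[mu]_z good_ham_dot j z.

Lemma good_ham_dot_measurable j : @measurable_fun _ _ (mborel P) R setT (good_ham_dot j).
Proof.
apply: measurable_funM; first exact: measurable_indic.
exact: (ham_pair_measurable HP HB Hg HKC).
Qed.

(** The cap [k] on the norm of f |-> X_f(z) at good points yields a bound uniform in [z], hence the
    second moments needed for the law of large numbers. *)
Lemma good_ham_dot_bound j z : `|good_ham_dot j z| <= 4 * k%:R ^+ 2 * (1 + hsq eta).
Proof.
have K0 : 0 <= 4 * k%:R ^+ 2 :> R by rewrite mulr_ge0// sqr_ge0.
rewrite /good_ham_dot indicE; case: (boolP (z \in G)) => [/set_mem Gz|_]; last first.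
  by rewrite mul0r normr0 mulr_ge0// addr_ge0// hsq_ge0.
rewrite mul1r; have := ip_young (gs z) (Xham B (ej j) z) (Xham B eta z) ltr01.
have := good_bound Hg (ej j) Gz; have := good_bound Hg eta Gz.
have := hsq_onb HP HKC HK j; have := si_ge0 (gs z) (Xham B eta z).
rewrite -/(ej j); set a := g z _ _; set b := g z _ _; set c := `|_|.
have := hsq_ge0 (ej j); have := hsq_ge0 eta.
set s := hsq eta; set t := hsq (ej j); move: K0; set K4 := 4 * _ => *.
have : K4 * t <= K4 by rewrite ler_piMr.
lra.
Qed.

Section fixed_design.
Context (z : nat -> P) (e : nat -> 'rV[R]_d).

(* In order: noise at bad points, projection error at good points, noise against the
   first k basis fields, approximation of H by Q eta and of Q eta by its projection,
   X_eta at bad points, fluctuation of <X_{e_j}, X_eta>, and regularization bias. *)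
Definition error_bound : R :=
  N%:R^-1 * (\sum_(n < N) \1_(~` G) (z n) * g (z n) (e n) (e n))
  + tau * (N%:R^-1 * \sum_(n < N) \1_setT (z n) * g (z n) (e n) (e n))
  + 4 / lambda * (\sum_(j < k) (N%:R^-1 * \sum_(n < N)
       \1_G (z n) * g (z n) (e n) (Xham B (ej j) (z n))) ^+ 2)
  + 4 * lambda * hsq (H - Qh QM eta)
  + 4 * lambda * hsq (Qh QM eta - pr HP HKC k (Qh QM eta))
  + 4 * lambda * (M + 1) * (\int[mu]_y (g y (Xham B eta y) (Xham B eta y) * \1_(~` G) y))
  + 4 * lambda * (\sum_(j < k) (N%:R^-1 * \sum_(n < N) (good_ham_dot j (z n) - good_ham_mean j)) ^+ 2)
  + (lambda ^+ 2 + lambda * tau) * (N%:R^-1 * \sum_(n < N) g (z n) (Xham B eta (z n)) (Xham B eta (z n))).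

Let es := empdot_semi Hg N z.
Let A := @Aemp _ _ _ B _ HK z.
Let emp := empdot g N z.
Let onG (a : nat -> 'rV[R]_d) : nat -> 'rV[R]_d := fun n => \1_G (z n) *: a n.
Let onB (a : nat -> 'rV[R]_d) : nat -> 'rV[R]_d := fun n => \1_(~` G) (z n) *: a n.

Let indic01 (S : set P) y : \1_S y * \1_S y = \1_S y :> R.
Proof. by rewrite indicE; case: (y \in S); rewrite ?mulr1 ?mulr0. Qed.

Let emp_onG a b : emp (onG a) b = N%:R^-1 * \sum_(n < N) \1_G (z n) * g (z n) (a n) (b n).
Proof. by congr (_ * _); apply: eq_bigr => n _; rewrite (ipZl (gs _)). Qed.

Let emp_onB a : emp (onB a) (onB a) = N%:R^-1 * \sum_(n < N) \1_(~` G) (z n) * g (z n) (a n) (a n).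
Proof.
by congr (_ * _); apply: eq_bigr => n _; rewrite (ipZl (gs _)) (ipZr (gs _)) mulrA indic01.
Qed.

Let split_GB a : a = onG a + onB a.
Proof.
apply/funext => n; rewrite /onG /onB -[RHS]/(\1_G (z n) *: a n + \1_(~` G) (z n) *: a n).
rewrite -scalerDl !indicE in_setC; case: (z n \in G) => /=.
  by rewrite addr0 scale1r.
by rewrite add0r scale1r.
Qed.

Let emp_onG_le a : emp (onG a) (onG a) <= emp a a.
Proof.
rewrite /emp /empdot ler_wpM2l ?invr_ge0//; apply: ler_sum => n _.
rewrite (ipZl (gs _)) (ipZr (gs _)) mulrA indic01 indicE.
by case: (z n \in G); rewrite ?mul1r// mul0r (si_ge0 (gs _)).
Qed.

(** At good points the field of [u - pr u] has squared norm at most [4 * tau ^+ 2 * hsq u], so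
    Young's inequality with weight [tau] returns [tau * hsq u]. *)
Let tail_bound a u : `|emp (onG a) (A (u - pr HP HKC k u))| <= tau * emp a a + tau * hsq u.
Proof.
have -> : emp (onG a) (A (u - pr HP HKC k u)) = emp (onG a) (onG (A (u - pr HP HKC k u))).
  rewrite /emp /empdot; congr (_ * _); apply: eq_bigr => n _.
  by rewrite !(ipZl (gs _)) (ipZr (gs _)) mulrA indic01.
apply: le_trans (ip_young es _ _ t0) _; apply: lerD; first by rewrite ler_wpM2l ?(ltW t0)// emp_onG_le.
have h : emp (onG (A (u - pr HP HKC k u))) (onG (A (u - pr HP HKC k u))) <= 4 * tau ^+ 2 * hsq u.
  have N0' : N%:R != 0 :> R by rewrite pnatr_eq0 -lt0n.
  apply: le_trans (_ : _ <= N%:R^-1 * \sum_(n < N) 4 * tau ^+ 2 * hsq u) _; last first.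
    by rewrite sumr_const card_ord -[X in _ * X](mulr_natl) mulKf.
  rewrite /emp /empdot ler_wpM2l ?invr_ge0//; apply: ler_sum => n _.
  rewrite (ipZl (gs _)) (ipZr (gs _)) mulrA indic01 indicE.
  case: (boolP (z n \in G)) => [/set_mem Gz|_]; first by rewrite mul1r; exact: (good_tail Hg u Gz).
  by rewrite mul0r mulr_ge0 ?hsq_ge0// mulr_ge0 ?sqr_ge0.
rewrite ler_pdivrMl ?mulr_gt0//; apply: le_trans h _; nra.
Qed.

(* Testing the Euler-Lagrange equation with u = hh - H, every term linear in u is
   absorbed by Young's inequality into |X_u|_N^2 or lambda |u|^2. *)
Lemma energy (hh : hsp HK) :
  is_minimizer HK (emp_risk g B HK N z (fun n => Xham B H (z n) + e n) lambda) hh ->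
  tau <= lambda / 16 -> tau <= 1 / 16 ->
  lambda / 2 * hsq (hh - H) <= error_bound.
Proof.
move=> hmin t1 t2; set u := hh - H.
have EL := euler_lagrange HP Hg HKC l0 hmin u.
have xE : Aemp B z hh - (fun n => Xham B H (z n) + e n) = A u - e.
  apply/funext => n; rewrite /A /u (AempB HP B HKC).
  by rewrite -[LHS]/(Xham B hh (z n) - (Xham B H (z n) + e n)) opprD addrA.
rewrite xE (ipBl es) -/emp -/A in EL.
have hhE : hdot hh u = hsq u + hdot H u by rewrite /hsq -(ipDl hs) /u subrK.
rewrite hhE mulrDr in EL.
set U := emp (A u) (A u) in EL; set s := hsq u in EL *.
have U0 : 0 <= U := si_ge0 es _; have s0 : 0 <= s := hsq_ge0 u.
pose c j := hdot u (ej j).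
have cs : \sum_(j < k) c j ^+ 2 <= s.
  by rewrite -(gsproj_sq hs); exact: (gsproj_le hs).
have prA : A (pr HP HKC k u) = \sum_(j < k) c j *: A (ej j).
  by rewrite /A prE (Aemp_sum HP B HKC); apply: eq_bigr => j _; rewrite (AempZ HP B HKC).
have usplit : A u = A (pr HP HKC k u) + A (u - pr HP HKC k u).
  by rewrite /A (AempB HP B HKC) addrC subrK.
(* Completing the square for each [j]; Bessel's inequality then sums the [c j ^+ 2] to at most [s].
   Used with [t = lambda] for the noise and [t = 1] for the fluctuation of <X_{e_j}, X_eta>. *)
have sum_young (a : 'I_k -> R) t : 0 < t ->
    `|\sum_(j < k) c j * a j| <= t / 16 * s + 4 / t * \sum_(j < k) a j ^+ 2.
  move=> tp; apply: le_trans (_ : _ <= \sum_(j < k) (t / 16 * c j ^+ 2 + 4 / t * a j ^+ 2)) _.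
    apply: le_trans (ler_norm_sum _ _ _) _; apply: ler_sum => j _.
    have e1 : t / 16 * c j ^+ 2 + 4 / t * a j ^+ 2 - c j * a j = t / 16 * (c j - 8 / t * a j) ^+ 2.
      by field; rewrite gt_eqF.
    have e2 : t / 16 * c j ^+ 2 + 4 / t * a j ^+ 2 + c j * a j = t / 16 * (c j + 8 / t * a j) ^+ 2.
      by field; rewrite gt_eqF.
    have p1 : 0 <= t / 16 * (c j - 8 / t * a j) ^+ 2 by rewrite mulr_ge0 ?sqr_ge0// divr_ge0// ltW.
    have p2 : 0 <= t / 16 * (c j + 8 / t * a j) ^+ 2 by rewrite mulr_ge0 ?sqr_ge0// divr_ge0// ltW.
    rewrite ler_norml; lra.
  rewrite big_split /= -!mulr_sumr lerD2r; apply: ler_wpM2l cs.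
  by rewrite divr_ge0// ltW.
have T1a : `|emp (onB e) (A u)| <= emp (onB e) (onB e) + U / 4.
  by have := ip_young es (onB e) (A u) ltr01; rewrite mul1r mulr1 [4^-1 * _]mulrC.
have T1b := tail_bound e u.
have T1c : `|emp (onG e) (A (pr HP HKC k u))| <= lambda / 16 * s + 4 / lambda * \sum_(j < k) (emp (onG e) (A (ej j))) ^+ 2.
  rewrite prA /emp (ip_sumr es); under eq_bigr do rewrite (ipZr es).
  exact: sum_young.
have eE : emp e (A u) = emp (onB e) (A u) + (emp (onG e) (A (pr HP HKC k u)) + emp (onG e) (A (u - pr HP HKC k u))).
  by rewrite /emp -(ipDr es) -usplit -(ipDl es) addrC -split_GB.
have T2 : `|hdot (H - Qh QM eta) u| <= 4 * hsq (H - Qh QM eta) + s / 16.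
  have := ip_young hs (H - Qh QM eta) u (ltr0Sn R 3).
  have -> : (4 * 4 : R)^-1 * hdot u u = s / 16 by rewrite /s /hsq; field.
  by [].
set Qe := Qh QM eta in T2 *.
have T3 : `|hdot (Qe - pr HP HKC k Qe) u| <= 4 * hsq (Qe - pr HP HKC k Qe) + s / 16.
  have := ip_young hs (Qe - pr HP HKC k Qe) u (ltr0Sn R 3).
  have -> : (4 * 4 : R)^-1 * hdot u u = s / 16 by rewrite /s /hsq; field.
  by [].
(* Symmetry moves the projection from Q eta to [u], where Q can be exchanged for the L^2 form. *)
have HuE : hdot H u = hdot (H - Qe) u + hdot (Qe - pr HP HKC k Qe) u + L2dot B g mu (pr HP HKC k u) eta.
  rewrite -(Qh_span HP HB Hg HKC HA QM eta).2 -/Qe -(gsproj_sym hs) -!(ipDl hs).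
  by rewrite addrA subrK subrK.
pose FB y : R := \1_(~` G) y * g y (Xham B (pr HP HKC k u) y) (Xham B eta y).
pose FG y : R := \1_G y * g y (Xham B (pr HP HKC k u) y) (Xham B eta y).
have lF (S : set (mborel P)) : measurable S ->
    L1 mu ((fun y => \1_S y * g y (Xham B (pr HP HKC k u) y) (Xham B eta y)) : mborel P -> R).
  move=> mS; apply: (@L1_dom _ (mborel P) R mu _ (fun y => `|g y (Xham B (pr HP HKC k u) y) (Xham B eta y)|)).
  - apply: measurable_funM; first exact: measurable_indic.
    exact: (ham_pair_measurable HP HB Hg HKC).
  - move=> y; rewrite normrM indicE; case: (y \in S); rewrite ?normr1 ?mul1r//.
    by rewrite normr0 mul0r.
  - by apply: integrable_norm; exact: (ham_pair_integrable HP HB Hg HKC HA).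
have mBad : measurable (~` G : set (mborel P)) by exact: measurableC.
have lFG : L1 mu FG := lF _ mG.
have lFB : L1 mu FB := lF _ mBad.
have muE : L2dot B g mu (pr HP HKC k u) eta = E mu FG + E mu FB.
  rewrite -E_D//; apply: eq_Rintegral => y _; rewrite /FG /FB !indicE in_setC.
  by case: (y \in G) => /=; rewrite ?mul1r ?mul0r ?addr0 ?add0r.
have lhdot j : L1 mu (good_ham_dot j : mborel P -> R).
  apply: (@L1_dom _ (mborel P) R mu _ (fun=> 4 * k%:R ^+ 2 * (1 + hsq eta))) => //.
  - exact: good_ham_dot_measurable.
  - exact: good_ham_dot_bound.
  - exact: L1_cst.
have FGE : E mu FG = \sum_(j < k) c j * good_ham_mean j.
  have [_ es1] := L1_sum (fun j : 'I_k => L1Z (c j) (lhdot j)).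
  rewrite (_ : FG = fun y => \sum_(j < k) c j * good_ham_dot j y).
    by rewrite es1; apply: eq_bigr => j _; exact: (E_Z (c j) (lhdot j)).
  apply/funext => y; rewrite /FG prE (Xham_sum HP B HKC) (ip_suml (gs y)) mulr_sumr.
  by apply: eq_bigr => j _; rewrite (XhamZ HP B HKC) (ipZl (gs y)) mulrCA.
pose bB y : R := g y (Xham B eta y) (Xham B eta y) * \1_(~` G) y.
have lbB : L1 mu (bB : mborel P -> R).
  apply: (@L1_dom _ (mborel P) R mu _ (fun y => g y (Xham B eta y) (Xham B eta y))).
  - apply: measurable_funM; last exact: measurable_indic.
    exact: (ham_pair_measurable HP HB Hg HKC).
  - move=> y; rewrite /bB normrM (ger0_norm (si_ge0 (gs y) _)) indicE.
    by case: (y \in _); rewrite ?normr1 ?mulr1// normr0 mulr0 (si_ge0 (gs y)).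
  - exact: (ham_pair_integrable HP HB Hg HKC HA).
have M1 : 0 < 4 * (M + 1) by rewrite mulr_gt0// ltr_wpDl.
(* The Young weight [4 * (M + 1)] is chosen so that the bound [M * s] on the projected energy costs
   at most [s / 16]. *)
have FBle : `|E mu FB| <= 4 * (M + 1) * E mu bB + s / 16.
  have lp := ham_pair_integrable HP HB Hg HKC HA (pr HP HKC k u) (pr HP HKC k u).
  apply: le_trans (le_normr_Rintegral measurableT lFB) _.
  have l1 := L1Z (4 * (M + 1)) lbB; have l2 := L1Z ((4 * (4 * (M + 1)))^-1) lp.
  apply: le_trans (_ : _ <= E mu (fun y => 4 * (M + 1) * bB y + (4 * (4 * (M + 1)))^-1 *
      g y (Xham B (pr HP HKC k u) y) (Xham B (pr HP HKC k u) y))) _.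
    apply: E_le; [exact: integrable_norm|exact: L1D|move=> y].
    have p0 := si_ge0 (gs y) (Xham B (pr HP HKC k u) y).
    rewrite /FB /bB indicE; case: (y \in _); last first.
      by rewrite mul0r normr0 mulr0 mulr0 add0r mulr_ge0// invr_ge0 mulr_ge0// ltW.
    rewrite mul1r mulr1 (si_sym (gs y)); exact: (ip_young (gs y)).
  rewrite (E_D l1 l2) (E_Z _ lbB) (E_Z _ lp) lerD2l -/(L2dot B g mu _ _).
  rewrite ler_pdivrMl ?mulr_gt0 ?ltr_wpDl//.
  apply: le_trans (L2dot_pr_le HP HB Hg HKC HA M0 QM k u) _; rewrite -/s.
  have -> : 4 * (4 * (M + 1)) * (s / 16) = M * s + s by field.
  by rewrite lerDl.
have T5 : `|\sum_(j < k) c j * (N%:R^-1 * \sum_(n < N) (good_ham_dot j (z n) - good_ham_mean j))| <=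
    1 / 16 * s + 4 / 1 * \sum_(j < k) (N%:R^-1 * \sum_(n < N) (good_ham_dot j (z n) - good_ham_mean j)) ^+ 2.
  exact: sum_young.
(* The population pairing over good points becomes the empirical pairing with the full X_u, to be
   absorbed in [U], minus a projection error and the fluctuations in [k] directions. *)
have FGsplit : E mu FG = emp (onG (A eta)) (A u) - emp (onG (A eta)) (A (u - pr HP HKC k u))
    - \sum_(j < k) c j * (N%:R^-1 * \sum_(n < N) (good_ham_dot j (z n) - good_ham_mean j)).
  have -> : emp (onG (A eta)) (A u) - emp (onG (A eta)) (A (u - pr HP HKC k u))
     = emp (onG (A eta)) (A (pr HP HKC k u)).
    by rewrite {1}usplit /emp (ipDr es) addrK.
  rewrite prA /emp (ip_sumr es) FGE -sumrB; apply: eq_bigr => j _.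
  rewrite (ipZr es) -/emp emp_onG -mulrBr; congr (_ * _).
  rewrite sumrB sumr_const card_ord mulrBr -(mulr_natl (good_ham_mean j)) mulKf; last first.
    by rewrite pnatr_eq0 -lt0n.
  rewrite opprB addrCA -mulrBr -sumrB big1 ?mulr0 ?addr0// => n _.
  by rewrite /good_ham_dot [X in _ * X - _](si_sym (gs _)) subrr.
have T6 : lambda * `|emp (onG (A eta)) (A u)| <= lambda ^+ 2 * emp (A eta) (A eta) + U / 4.
  have := ip_young es (lambda *: onG (A eta)) (A u) ltr01.
  rewrite (ipZl es) (ipZl es) (ipZr es) mul1r mulr1 normrM (gtr0_norm l0) => h.
  apply: le_trans h _; rewrite mulrA -expr2 [4^-1 * _]mulrC lerD2r.
  by rewrite ler_wpM2l ?sqr_ge0// emp_onG_le.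
have T7 := tail_bound (A eta) u.
have epsE : N%:R^-1 * (\sum_(n < N) \1_setT (z n) * g (z n) (e n) (e n)) = emp e e.
  by congr (_ * _); apply: eq_bigr => n _; rewrite indicT mul1r.
have aE : \sum_(j < k) (N%:R^-1 * \sum_(n < N)
       \1_G (z n) * g (z n) (e n) (Xham B (ej j) (z n))) ^+ 2 = \sum_(j < k) (emp (onG e) (A (ej j))) ^+ 2.
  by apply: eq_bigr => j _; rewrite emp_onG.
rewrite /error_bound -(emp_onB e) epsE aE -/(emp (A eta) (A eta)) -/Qe -/(E mu bB).
rewrite eE HuE muE FGsplit in EL.
exact: (energy_arith l0 U0 s0 (si_ge0 es (A eta)) EL T1a T1b T1c T2 T3 FBle T5 T6 T7 t1 t2).
Qed.

End fixed_design.
End energy.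

(** * Measurability of the error event *)

(** The radius [r] depends on [b] only through the bound [c], because it will serve for approximants
    chosen after it. Each of the two Young terms is allotted [e / 2]. *)
Lemma semi_inner_sq_continuous (R : realType) (V : lmodType R) (ip : V -> V -> R) (c e : R) :
  semi_inner ip -> 0 <= c -> 0 < e -> exists2 r, 0 < r &
  forall a b, ip b b <= c -> ip a a <= r -> ip (a + b) (a + b) <= ip b b + e.
Proof.
move=> s c0 e0; pose t := e / (4 * (c + 1)).
have c1 : 0 < 4 * (c + 1) by rewrite mulr_gt0// ltr_wpDl.
have t0 : 0 < t by rewrite divr_gt0.
have d0 : 0 < 2 * (1 + (2 * t)^-1) by rewrite mulr_gt0// addr_gt0// invr_gt0 mulr_gt0.
exists (e / (2 * (1 + (2 * t)^-1))); first by rewrite divr_gt0.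
move=> a b bc ar; rewrite (ip_sqrD s) (si_sym s a b).
have := ip_young s b a t0; rewrite ler_norml => /andP[_ h].
have b0 := si_ge0 s b.
have h1 : t * ip b b <= e / 4.
  apply: le_trans (ler_wpM2l (ltW t0) bc) _; rewrite /t.
  have -> : e / (4 * (c + 1)) * c = e / 4 * (c / (c + 1)) by field; rewrite gt_eqF// ltr_wpDl.
  apply: ler_piMr; first by rewrite divr_ge0// ltW.
  by rewrite ler_pdivrMr ?mul1r ?lerDl// ltr_wpDl.
have h2 : (1 + (2 * t)^-1) * ip a a <= e / 2.
  by move: ar; rewrite ler_pdivlMr// => ar; lra.
have e4 : 2 * ((4 * t)^-1 * ip a a) = (2 * t)^-1 * ip a a by field; rewrite gt_eqF.
move: h2 e4 h; rewrite mulrDl mul1r; set q := (2 * t)^-1 * _; set q' := (4 * t)^-1 * _; lra.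
Qed.

Section event.
Context (R : realType) (d : nat) (P : atlas 'rV[R]_d) (HP : is_manifold P).
Context (br : (P -> R) -> (P -> R) -> (P -> R)) (B : P -> 'M[R]_d).
Hypothesis HB : is_poisson_tensor br B.
Context (g : metric P) (Hg : is_riemannian g).
Context (K : P -> P -> R).
Hypothesis HKC : Ckfun 3 (fun xy : mprod P P => K xy.1 xy.2).
Context (HK : rkhs K).
Context (dO : measure_display) (Omega : measurableType dO).
Context (Z : nat -> Omega -> P) (noise : nat -> Omega -> 'rV[R]_d).
Hypothesis mZ : forall n, @measurable_fun _ _ Omega (mborel P) setT (Z n).
Hypothesis mzeta : forall n, @measurable_fun _ _ Omega (mborel (tangent P)) setT (zeta Z noise n).
Context (H : hsp HK) (N : nat) (lambda : R) (l0 : 0 < lambda).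

Let hs := hdot_semi HK.
Let gs z := metric_semi Hg z.

Definition risk (w : Omega) (f : hsp HK) : R :=
  emp_risk g B HK N (fun n => Z n w) (fun n => Xham B H (Z n w) + noise n w) lambda f.

Lemma risk_measurable f : measurable_fun setT (fun w => risk w f).
Proof.
pose v := f - H.
(* With the square expanded, every summand is a measurable function of [Z n] or of the pair
   [zeta n]. *)
have -> : (fun w => risk w f) = fun w => N%:R^-1 * (\sum_(n < N)
   (g (Z n w) (Xham B v (Z n w)) (Xham B v (Z n w))
    - 2 * g (Z n w) (noise n w) (Xham B v (Z n w))
    + g (Z n w) (noise n w) (noise n w))) + lambda * hsq f.
  apply/funext => w; rewrite /risk /emp_risk hnorm_sq; congr (_ * _ + _).
  apply: eq_bigr => n _; rewrite /gnormsq.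
  have -> : Xham B f (Z n w) - (Xham B H (Z n w) + noise n w) = Xham B v (Z n w) - noise n w.
    by rewrite /v (XhamB HP B HKC) opprD addrA.
  by rewrite (ip_sqrB (gs _)) (si_sym (gs _) (noise n w)).
apply: measurable_funD => //; apply: measurable_funM => //.
apply: measurable_sum => n; apply: measurable_funD; first apply: measurable_funB.
- exact: (measurableT_comp (ham_pair_measurable HP HB Hg HKC v v) (mZ n)).
- apply: measurable_funM => //.
  exact: (measurableT_comp (tangent_pair_measurable HP HB Hg HKC v) (mzeta n)).
- exact: (measurableT_comp (tangent_sq_measurable HP Hg) (mzeta n)).
Qed.

Lemma empirical_bound (z : nat -> P) : exists2 C, 0 <= C & forall v : hsp HK,
  sqform B g N z lambda v <= C * hsq v.
Proof.
have bnd n := Xham_bound HP B Hg HKC HK (z n).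
pose c n := sval (cid2 (bnd n)).
have c0 n : 0 <= c n by rewrite /c; case: cid2.
have cP n (v : hsp HK) : g (z n) (Xham B v (z n)) (Xham B v (z n)) <= c n * hsq v.
  by rewrite /c; case: cid2.
exists (N%:R^-1 * (\sum_(n < N) c n) + lambda).
  by rewrite addr_ge0 ?(ltW l0)// mulr_ge0 ?invr_ge0// sumr_ge0.
move=> v; rewrite /sqform mulrDl lerD2r -mulrA ler_wpM2l ?invr_ge0// mulr_suml.
by apply: ler_sum => n _; exact: cP.
Qed.

Context (hh : Omega -> hsp HK).
Hypothesis hmin : forall w, is_minimizer HK
  (emp_risk g B HK N (fun n => Z n w) (fun n => Xham B H (Z n w) + noise n w) lambda) (hh w).

Let D i := dseq HP HKC HK i.

(* The minimizer is not assumed measurable in w. By coercivity of the risk, it lies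
   in the ball iff for every p some member of a fixed dense sequence lies in the ball
   up to 1/(p+1) and minimizes the risk up to 1/(p+1), which only involves countably
   many measurable functions of w. *)
Lemma minimizer_event_measurable (c : R) : 0 <= c ->
  measurable [set w | hsq (hh w - H) <= c].
Proof.
move=> c0.
have gap w f : risk w f = risk w (hh w) + sqform B g N (fun n => Z n w) lambda (f - hh w).
  exact: (emp_risk_gap HP Hg HKC l0 (hmin w)).
have sq_ge w (v : hsp HK) : lambda * hsq v <= sqform B g N (fun n => Z n w) lambda v.
  by rewrite /sqform lerDr; exact: (si_ge0 (empdot_semi Hg N _)).
have dense w e : 0 < e -> forall r, 0 < r -> exists i,
    hsq (D i - hh w) <= r /\ risk w (D i) <= risk w (hh w) + e.
  move=> e0 r r0; have [C C0 HC] := empirical_bound (fun n => Z n w).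
  have m0 : 0 < Num.min r (e / (C + 1)).
    by rewrite lt_min r0 divr_gt0// ltr_wpDl.
  have [i] := dseq_dense HP HKC (hh w) m0; rewrite lt_min => /andP[i1 i2].
  have eqs : hsq (D i - hh w) = hsq (hh w - D i).
    by rewrite /hsq -opprB (ipNl hs) (ipNr hs) opprK.
  exists i; rewrite gap eqs; split; first exact: ltW.
  rewrite lerD2l; apply: le_trans (HC _) _; rewrite eqs.
  move: i2; rewrite ltr_pdivlMr ?ltr_wpDl// => i2; apply: le_trans (ltW i2).
  by rewrite mulrC ler_wpM2l ?hsq_ge0// lerDl.
have -> : [set w | hsq (hh w - H) <= c] = \bigcap_p \bigcup_i
    ([set w | hsq (D i - H) <= c + p.+1%:R^-1] `&`
     \bigcap_j [set w | risk w (D i) - risk w (D j) <= p.+1%:R^-1]).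
  apply/seteqP; split=> [w /= wc p _|w /= H1].
    have p0 : 0 < p.+1%:R^-1 :> R by rewrite invr_gt0 ltr0n.
    have [r r0 Hr] := semi_inner_sq_continuous hs c0 p0.
    have [i [i1 i2]] := dense w _ p0 r r0.
    exists i => //; split => /=.
      have -> : D i - H = (D i - hh w) + (hh w - H) by rewrite addrA subrK.
      by apply: le_trans (Hr _ _ wc i1) _; rewrite lerD2r; exact: wc.
    move=> j _ /=; rewrite lerBlDr; apply: le_trans i2 _; rewrite addrC lerD2l [risk w (D j)]gap lerDl.
    have h0 : 0 <= lambda * hsq (D j - hh w) by rewrite mulr_ge0 ?(ltW l0)// hsq_ge0.
    exact: (le_trans h0 (sq_ge w _)).
  apply/ler_addgt0Pr => e e0; have e2 : 0 < e / 2 by rewrite divr_gt0.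
  have c1 : 0 <= c + 1 by rewrite addr_ge0.
  have [r r0 Hr] := semi_inner_sq_continuous hs c1 e2.
  (* [e / 2] serves the radius. [lambda * r / 2] is half of the excess risk allowed to [D i], the
     other half going to the comparison point; an excess of at most [lambda * r] puts [D i] within
     squared distance [r] of the minimizer. *)
  have m0 : 0 < Num.min (e / 2) (lambda * r / 2).
    by rewrite lt_min e2 divr_gt0// mulr_gt0.
  pose p := Num.truncn (Num.min (e / 2) (lambda * r / 2))^-1.
  have hp : p.+1%:R^-1 < Num.min (e / 2) (lambda * r / 2).
    by rewrite invf_plt ?posrE// truncnS_gt.
  move: hp; rewrite lt_min => /andP[p1 p2].
  have [i _ [/= i1 i2]] := H1 p I.
  have lr : 0 < lambda * r / 2 by rewrite divr_gt0// mulr_gt0.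
  (* The minimizer need not occur in the dense sequence; [D j] replaces it in the comparison of
     risks. *)
  have [j [_ j2]] := dense w _ lr r r0.
  have := i2 j I => /= {}i2.
  have i3 : hsq (D i - hh w) <= r.
    rewrite -(ler_pM2l l0); have := sq_ge w (D i - hh w); have := gap w (D i).
    move: i2 j2 p2; set sq := sqform _ _ _ _ _ _; set q := _^-1.
    set x := hsq _; set ri := risk w _; lra.
  have i3' : hsq (hh w - D i) <= r.
    by rewrite /hsq -opprB (ipNl hs) (ipNr hs) opprK.
  have -> : hh w - H = (hh w - D i) + (D i - H) by rewrite addrA subrK.
  have inv1 : p.+1%:R^-1 <= 1 :> R by rewrite invf_le1 ?ltr0n// ler1n.
  have i1' : hdot (D i - H) (D i - H) <= c + 1.
    by apply: le_trans i1 _; rewrite lerD2l.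
  apply: le_trans (Hr _ _ i1' i3') _.
  by move: i1 p1; rewrite /hsq; set t := hdot (D i - H) _; set q := _^-1; lra.
apply: bigcapT_measurable => p; apply: bigcupT_measurable => i; apply: measurableI.
  have [h|h] := pselect (hsq (D i - H) <= c + p.+1%:R^-1).
    have -> : [set w : Omega | hsq (D i - H) <= c + p.+1%:R^-1] = setT.
      by apply/seteqP; split.
    exact: measurableT.
  have -> : [set w : Omega | hsq (D i - H) <= c + p.+1%:R^-1] = set0.
    by apply/seteqP; split.
  exact: measurable0.
apply: bigcapT_measurable => j.
have mJ : measurable_fun setT (fun w => risk w (D i) - risk w (D j)).
  by apply: measurable_funB; exact: risk_measurable.
have := mJ measurableT `]-oo, p.+1%:R^-1]%classic (measurable_itv _).
by rewrite setTI.
Qed.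

End event.

(** * Expected error *)

Section mean_bounds.
Context (dO : measure_display) (Omega : measurableType dO) (R : realType).
Context (Pr : probability Omega R).
Implicit Types (f h : Omega -> R).

(** Integrability travels with the bound, so that the bounds can be added and scaled term by
    term. *)
Definition mean_le f (a : R) := L1 Pr f /\ E Pr f <= a.

Lemma mean_leD f h a b : mean_le f a -> mean_le h b -> mean_le (fun w => f w + h w) (a + b).
Proof.
by move=> [lf ef] [lh eh]; split; [exact: L1D|rewrite E_D// lerD].
Qed.

Lemma mean_leZ f c a : 0 <= c -> mean_le f a -> mean_le (fun w => c * f w) (c * a).
Proof.
by move=> c0 [lf ef]; split; [exact: L1Z|rewrite E_Z// ler_wpM2l].
Qed.

Lemma mean_le_cst (a : R) : mean_le (fun=> a) a.
Proof. by split; [exact: L1_cst|rewrite E_cst]. Qed.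

Lemma mean_le_sum n (f : 'I_n -> Omega -> R) (a : 'I_n -> R) : (forall i, mean_le (f i) (a i)) ->
  mean_le (fun w => \sum_i f i w) (\sum_i a i).
Proof.
move=> H; have [l e] := L1_sum (fun i => (H i).1).
by split => //; rewrite e; apply: ler_sum => i _; have [] := H i.
Qed.

Lemma mean_le_avg N (f : nat -> Omega -> R) a : (0 < N)%N -> (forall n, mean_le (f n) a) ->
  mean_le (fun w => N%:R^-1 * \sum_(n < N) f n w) a.
Proof.
move=> N0 H; have N1 : N%:R != 0 :> R by rewrite pnatr_eq0 -lt0n.
have -> : a = N%:R^-1 * \sum_(n < N) a.
  by rewrite sumr_const card_ord -[X in _ * X](mulr_natl) mulKf.
by apply: mean_leZ; [rewrite invr_ge0|apply: (mean_le_sum (f := fun i : 'I_N => f i))].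
Qed.

End mean_bounds.

Section mean_of_error_bound.
Context (R : realType) (d : nat) (P : atlas 'rV[R]_d) (HP : is_manifold P).
Context (br : (P -> R) -> (P -> R) -> (P -> R)) (B : P -> 'M[R]_d).
Hypothesis HB : is_poisson_tensor br B.
Context (g : metric P) (Hg : is_riemannian g).
Context (K : P -> P -> R).
Hypothesis HKC : Ckfun 3 (fun xy : mprod P P => K xy.1 xy.2).
Context (HK : rkhs K).
Context (dO : measure_display) (Omega : measurableType dO) (Pr : probability Omega R).
Context (mu : probability (mborel P) R) (Z : nat -> Omega -> P) (HZ : iid_with Pr mu Z).
Hypothesis HA : A_welldefined g B HK mu.
Context (M : R) (M0 : 0 <= M).
Hypothesis QM : forall f, hset HK f ->
  hset HK (Qop g B K mu f) /\ hnorm HK (Qop g B K mu f) <= M * hnorm HK f.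
Context (sigma : R) (nu : nat -> P -> probability (vborel 'rV[R]_d) R).
Hypothesis Hnu : noise_kernel g sigma nu.
Context (noise : nat -> Omega -> 'rV[R]_d) (Hnoise : noise_with Pr nu Z noise).
Context (N : nat) (N0 : (0 < N)%N).
Context (lambda tau : R) (l0 : 0 < lambda) (t0 : 0 < tau).
Context (k : nat) (eta H : hsp HK).

Let gs z := metric_semi Hg z.
Let G := good HP B g HKC HK tau k.

Definition variance_sum : R :=
  \sum_(j < k) sigma ^+ 2 * L2dot B g mu (onb HP HKC HK j) (onb HP HKC HK j).

(** Three of the eight terms are deterministic, three are averages of variables with a common mean
    bound, and the two sums of squared averages decay like [1 / N] because their terms are pairwise
    uncorrelated. *)
Lemma error_bound_mean :
  mean_le Pr (fun w => error_bound HP HKC QM N lambda tau k eta H (fun n => Z n w) (fun n => noise n w))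
   (sigma ^+ 2 * d%:R * (\int[mu]_z \1_(~` G) z)
  + tau * (sigma ^+ 2 * d%:R)
  + 4 / lambda * (variance_sum / N%:R)
  + 4 * lambda * hsq (H - Qh QM eta)
  + 4 * lambda * hsq (Qh QM eta - pr HP HKC k (Qh QM eta))
  + 4 * lambda * (M + 1) * (\int[mu]_y (g y (Xham B eta y) (Xham B eta y) * \1_(~` G) y))
  + 4 * lambda * (k%:R * ((2 * (4 * k%:R ^+ 2 * (1 + hsq eta))) ^+ 2 / N%:R))
  + (lambda ^+ 2 + lambda * tau) * L2dot B g mu eta eta).
Proof.
have mG : measurable (G : set (mborel P)) by exact: (good_measurable HP HB Hg).
have mB : measurable (~` G : set (mborel P)) by exact: measurableC.
apply: mean_leD; last first.
  apply: mean_leZ; first by rewrite addr_ge0 ?sqr_ge0// mulr_ge0// ltW.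
  apply: (mean_le_avg (f := fun n w => g (Z n w) (Xham B eta (Z n w)) (Xham B eta (Z n w)))) => // n.
  have [l e] := L1_Z HZ n (ham_pair_measurable HP HB Hg HKC eta eta) (fun z => si_ge0 (gs z) _)
    (ham_sq_integrable HP HB Hg HKC HA eta).
  by split => //; rewrite e.
apply: mean_leD; last first.
  apply: mean_leZ; first by rewrite mulr_ge0// ltW.
  have -> : k%:R * ((2 * (4 * k%:R ^+ 2 * (1 + hsq eta))) ^+ 2 / N%:R) =
     \sum_(j < k) ((2 * (4 * k%:R ^+ 2 * (1 + hsq eta))) ^+ 2 / N%:R).
    by rewrite sumr_const card_ord -[RHS]mulr_natl.
  apply: (mean_le_sum (f := fun (j : 'I_k) w => (N%:R^-1 * \sum_(n < N)
    (good_ham_dot HP B g HKC tau k eta j (Z n w) - good_ham_mean HP B g HKC mu tau k eta j)) ^+ 2)) => j.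
  have [c1 c2 c3] := bounded_Z_centered HZ
    (good_ham_dot_measurable HP HB Hg HKC tau k eta j) (good_ham_dot_bound HP B Hg HKC tau k eta j).
  exact: (uncorrelated_mean N0 c1 c2 c3).
apply: mean_leD; last exact: mean_le_cst.
apply: mean_leD; last exact: mean_le_cst.
apply: mean_leD; last exact: mean_le_cst.
apply: mean_leD; last first.
  apply: mean_leZ; first by rewrite divr_ge0// ltW.
  rewrite /variance_sum mulr_suml.
  apply: (mean_le_sum (f := fun (j : 'I_k) w => (N%:R^-1 * \sum_(n < N)
       \1_G (Z n w) * g (Z n w) (noise n w) (Xham B (onb HP HKC HK j) (Z n w))) ^+ 2)) => j.
  apply: (uncorrelated_mean (Y := fun n w => \1_G (Z n w) * g (Z n w) (noise n w) (Xham B (onb HP HKC HK j) (Z n w)))) => //.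
  - by move=> n; have [] := noise_ham_sq HP HB Hg HKC HZ HA Hnu Hnoise n (onb HP HKC HK j) mG.
  - by move=> n; have [] := noise_ham_sq HP HB Hg HKC HZ HA Hnu Hnoise n (onb HP HKC HK j) mG.
  - by move=> n m nm; exact: (noise_ham_cross HP HB Hg HKC HZ HA Hnu Hnoise (onb HP HKC HK j) mG nm).
apply: mean_leD; last first.
  apply: mean_leZ; first exact: ltW.
  apply: (mean_le_avg (f := fun n w => \1_setT (Z n w) * g (Z n w) (noise n w) (noise n w))) => // n.
  have [l e] := noise_sq_moment HP Hg HZ Hnu Hnoise n (@measurableT _ (mborel P)).
  split => //; rewrite e.
  have -> : \int[mu]_z (\1_setT z : R) = 1.
    transitivity (E mu (fun=> 1)); last exact: E_cst.
    by apply: eq_Rintegral => z _; rewrite indicT.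
  by rewrite mulr1.
apply: (mean_le_avg (f := fun n w => \1_(~` G) (Z n w) * g (Z n w) (noise n w) (noise n w))) => // n.
have [l e] := noise_sq_moment HP Hg HZ Hnu Hnoise n mB.
by split => //; rewrite e.
Qed.

End mean_of_error_bound.

(** * Choice of the parameters and conclusion *)

Lemma divn_le_eventually (R : realType) (c q : R) : 0 <= c -> 0 < q ->
  exists n, (0 < n)%N /\ forall N, (n < N)%N -> c / N%:R <= q.
Proof.
move=> c0 q0; exists (Num.truncn (c / q)).+1; split=> // N nN.
have N0 : 0 < N%:R :> R by rewrite ltr0n (leq_ltn_trans _ nN).
rewrite ler_pdivrMr// mulrC -ler_pdivrMr//; apply/ltW/(lt_trans (truncnS_gt _)).
by rewrite ltr_nat.
Qed.

(** [q] is a tenth of the target [l / 2 * T]. The terms form seven groups of at most [q] each, the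
    two terms depending on [N] sharing one group. *)
Lemma error_budget (R : realType) (T l tau m v M b1 b2 r1 r2 x y q : R) :
  0 < T -> 0 < l -> 0 <= m -> 0 <= v -> 0 <= M ->
  l * (40 * (m + 1)) = T -> q = l * T / 20 ->
  b1 * (v + 1) < q -> tau * (v + 1) <= q -> 0 <= b1 -> 0 < tau -> tau <= l ->
  r1 <= T / 80 -> r2 < T / 80 -> 80 * (M + 1) * b2 < T -> x + y <= q ->
  v * b1 + tau * v + x + 4 * l * r1 + 4 * l * r2 + 4 * l * (M + 1) * b2 + y
    + (l ^+ 2 + l * tau) * m < l / 2 * T.
Proof.
move=> T0 l0 m0 v0 M0 lE qE h1 h2 b0 t0 tl h3 h4 h5 h6.
have e1 : v * b1 < q by apply: le_lt_trans h1; rewrite mulrDr mulr1 mulrC lerDl.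
have e2 : tau * v <= q by apply: le_trans h2; rewrite mulrDr mulr1 lerDl ltW.
have e3 : 4 * l * r1 <= q.
  have := ler_pM2l l0 r1 (T / 80); rewrite h3 qE => e; lra.
have e4 : 4 * l * r2 < q.
  have := ltr_pM2l l0 r2 (T / 80); rewrite h4 qE => e; lra.
have e5 : 4 * l * (M + 1) * b2 < q.
  have := ltr_pM2l l0 (80 * (M + 1) * b2) T; rewrite h5 qE => /esym e; lra.
have e6 : (l ^+ 2 + l * tau) * m <= q.
  have a1 : l * tau <= l ^+ 2 by rewrite expr2 ler_pM2l.
  have a2 : (l ^+ 2 + l * tau) * m <= 2 * l ^+ 2 * m by apply: ler_wpM2r => //; lra.
  have a3 : l * (l * (40 * (m + 1))) = l * T by rewrite lE.
  have a4 : 0 < l ^+ 2 by rewrite exprn_gt0.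
  rewrite qE; lra.
have lT : 0 < l * T by rewrite mulr_gt0.
lra.
Qed.

Theorem theorem4p6
  (R : realType) (d : nat)
  (P : atlas 'rV[R]_d) (HP : is_manifold P)
  (br : (P -> R) -> (P -> R) -> (P -> R)) (Hbr : is_poisson_bracket br)
  (B : P -> 'M[R]_d) (HB : is_poisson_tensor br B)
  (g : metric P) (Hg : complete_riemannian g)
  (gammaJ : P -> R) (C : R) (HC : 0 < C)
  (HgammaJ : forall z, 0 < gammaJ z <= C ^+ 2)
  (HJ : forall z v,
     g z (compatJ g B z v) (compatJ g B z v) <= gammaJ z * g z v v)
  (gk : forall k, metric (tbundle (mprod P P) k))
  (Hgk0 : gk 0%N = prod_metric g g)
  (Hgk : forall k, complete_riemannian (gk k))
  (K : P -> P -> R) (HKmercer : mercer K)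
  (HKCb : Cb 3 gk (fun xy : mprod P P => K xy.1 xy.2))
  (HK : rkhs K)
  (dO : measure_display) (Omega : measurableType dO)
  (Pr : probability Omega R)
  (mu : probability (mborel P) R)
  (HA : A_welldefined g B HK mu)
  (Z : nat -> Omega -> P) (HZ : iid_with Pr mu Z)
  (sigma : R) (nu : nat -> P -> probability (vborel 'rV[R]_d) R)
  (Hnu : noise_kernel g sigma nu)
  (noise : nat -> Omega -> 'rV[R]_d) (Hnoise : noise_with Pr nu Z noise)
  (H : P -> R)
  (hhat : R -> nat -> Omega -> P -> R)
  (Hhat : forall (lambda : R) (N : nat) (w : Omega),
     0 < lambda -> (0 < N)%N ->
     is_minimizer HK
       (emp_risk g B HK N (fun n => Z n w)
          (fun n => Xham B H (Z n w) + noise n w) lambda)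
       (hhat lambda N w))
  (gamma S : R) (Hgamma : 0 < gamma < 1) (HS : 0 < S)
  (Hsource : source_set HK (Qop g B K mu) gamma S H)
  (epsilon delta : R) (Hepsilon : 0 < epsilon) (Hdelta : 0 < delta) :
  exists lambda : R, 0 < lambda /\
  exists n : nat, (0 < n)%N /\
  forall N : nat, (n < N)%N ->
    (Pr [set w | (epsilon < hnorm HK (hhat lambda N w \- H))%R] < delta%:E)%E.
Proof.
have [HgR _] := Hg; have [HKC _] := HKCb; have [g0 _] := andP Hgamma.
have [HH [M [QM M0 closure]]] := source_closure_range HP HB HgR HKC HA g0 Hsource.
(* Markov's inequality for [lambda / 2 * hsq (hh - Hh)] at level [lambda / 2 * epsilon ^+ 2] asks
   for a mean below [lambda / 2 * T]. *)
pose Hh := to_hsp HH; pose T := epsilon ^+ 2 * delta.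
have T0 : 0 < T by rewrite mulr_gt0// exprn_gt0.
have [eta eta_le] := closure (T / 80) (divr_gt0 T0 (ltr0Sn R 79)).
pose m := L2dot B g mu eta eta.
have m0 : 0 <= m := si_ge0 (L2dot_semi HP HB HgR HKC HA) eta.
pose lambda := T / (40 * (m + 1)).
have m1 : 0 < 40 * (m + 1) by rewrite mulr_gt0// ltr_wpDl.
have l0 : 0 < lambda by rewrite divr_gt0.
have lE : lambda * (40 * (m + 1)) = T by rewrite mulfVK// gt_eqF.
pose q := lambda * T / 20; have q0 : 0 < q by rewrite divr_gt0// mulr_gt0.
pose v := sigma ^+ 2 * d%:R; have v0 : 0 <= v by rewrite mulr_ge0// sqr_ge0.
have v1 : 0 < v + 1 by rewrite ltr_wpDl.
(* The first two constraints let [tau * s] be absorbed in the energy estimate; the third keeps [tau]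
   times the noise energy within [q]. *)
pose tau := Num.min (lambda / 16) (Num.min (1 / 16) (q / (v + 1))).
have t0 : 0 < tau.
  by rewrite /tau !lt_min (divr_gt0 l0)// (divr_gt0 q0)// divr_gt0.
have tl : tau <= lambda / 16 by rewrite ge_min lexx.
have t1 : tau <= 1 / 16 by rewrite ge_min [X in _ || X]ge_min lexx orbT.
have tq : tau * (v + 1) <= q.
  by rewrite -ler_pdivlMr// ge_min [X in _ || X]ge_min lexx !orbT.
have tl' : tau <= lambda by lra.
pose bad k : set (mborel P) := ~` good HP B g HKC HK tau k.
have mbad k : measurable (bad k) by apply: measurableC; exact: (good_measurable HP HB HgR).
have badN z : exists k0, forall k, (k0 <= k)%N -> ~ bad k z.
  have [k0 k0P] := good_eventually HP B HgR HKC HK z t0.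
  by exists k0 => k /k0P gk0 /(_ gk0).
have M1 : 0 < 80 * (M + 1) by rewrite mulr_gt0// ltr_wpDl.
(* With the constant function 1 this is the measure of the bad points. *)
have [k1 k1P] := vanishing_integral mbad badN (fun=> ler01) (L1_cst mu 1) (divr_gt0 q0 v1).
have [k2 k2P] := vanishing_integral mbad badN (fun z => si_ge0 (metric_semi HgR z) _)
  (ham_sq_integrable HP HB HgR HKC HA eta) (divr_gt0 T0 M1).
have [k3 k3P] := pr_cvg HP HKC (Qh QM eta) (divr_gt0 T0 (ltr0Sn R 79)).
pose k := maxn k1 (maxn k2 k3).
have k1k : (k1 <= k)%N by rewrite leq_maxl.
have k2k : (k2 <= k)%N by rewrite /k leq_max leq_maxl orbT.
have k3k : (k3 <= k)%N by rewrite /k !leq_max leqnn !orbT.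
pose V := variance_sum HP B g HKC HK mu sigma k.
have V0 : 0 <= V.
  apply: sumr_ge0 => j _; apply: mulr_ge0; first exact: sqr_ge0.
  exact: (si_ge0 (L2dot_semi HP HB HgR HKC HA)).
pose W := (2 * (4 * k%:R ^+ 2 * (1 + hsq eta))) ^+ 2.
(* The coefficient of [1 / N] in the mean bound, with all other parameters already fixed. *)
pose c := 4 / lambda * V + 4 * lambda * (k%:R * W).
have c0 : 0 <= c.
  apply: addr_ge0; first by apply: mulr_ge0 => //; rewrite divr_ge0// ltW.
  apply: mulr_ge0; first by rewrite mulr_ge0// ltW.
  by apply: mulr_ge0 => //; exact: sqr_ge0.
have [n [n0 nP]] := divn_le_eventually c0 q0.
exists lambda; split=> //; exists n; split=> // N nN.
have N0 : (0 < N)%N by exact: leq_ltn_trans nN.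
have [lJ EJ] := error_bound_mean HP HB HgR HKC HZ HA QM Hnu Hnoise N0 l0 t0 k eta Hh.
set J := (fun w => error_bound _ _ _ _ _ _ _ _ _ _ _) in lJ EJ.
pose hh w : hsp HK := to_hsp (Hhat lambda N w l0 N0).1.
have hmin w : is_minimizer HK (emp_risk g B HK N (fun n => Z n w)
    (fun n => Xham B Hh (Z n w) + noise n w) lambda) (hh w) := Hhat lambda N w l0 N0.
have JP w : lambda / 2 * hsq (hh w - Hh) <= J w.
  exact: (energy HP HB HgR HKC HA M0 QM N0 l0 t0 k eta (hmin w) tl t1).
have mev : measurable [set w | hsq (hh w - Hh) <= epsilon ^+ 2].
  by apply: (minimizer_event_measurable HP HB HgR HKC (mZ HZ) (mzeta Hnoise) l0 hmin); rewrite sqr_ge0.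
have evE : [set w | epsilon < hnorm HK (hhat lambda N w \- H)] =
    ~` [set w | hsq (hh w - Hh) <= epsilon ^+ 2].
  apply/seteqP; split=> w /=; rewrite -[hnorm _ _]/(hnorm HK (hh w - Hh)) -hnorm_sq.
    by move=> h; apply/negP; rewrite -ltNge ltr_pXn2r// nnegrE ?sqrtr_ge0 ?ltW.
  by move=> /negP; rewrite -ltNge ltr_pXn2r// nnegrE ?sqrtr_ge0 ?ltW.
have le0 : 0 < lambda / 2 * epsilon ^+ 2 by rewrite mulr_gt0 ?divr_gt0// exprn_gt0.
rewrite evE; apply: le_lt_trans (markov_bound (W := J) (measurableC mev) le0 lJ _ _) _.
- by move=> w; apply: le_trans (JP w); rewrite mulr_ge0 ?hsq_ge0// divr_ge0// ltW.
- move=> w /negP; rewrite -ltNge => h; apply: le_trans (JP w).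
  by rewrite ler_pM2l ?divr_gt0// ltW.
rewrite lte_fin ltr_pdivrMr// mulrCA [delta * _]mulrC -/T.
apply: le_lt_trans EJ _; apply: (error_budget T0 l0 m0 v0 M0 lE (erefl q)) => //.
- rewrite -ltr_pdivlMr//; have := k1P k k1k; congr (_ < _).
  by apply: eq_Rintegral => z _; rewrite mul1r.
- by apply: Rintegral_ge0 => z _; rewrite indicE; case: (_ \in _).
- exact: k3P.
- by rewrite mulrC -ltr_pdivlMr//; exact: k2P.
rewrite (_ : _ + _ = c / N%:R); first exact: nP.
by rewrite /c [RHS]mulrDl -[in RHS]mulrA -(mulrA (4 * lambda)) -(mulrA k%:R).
Qed.
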